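(* For $d\ge1$ let $c_d$ be the largest constant such that for every probability measure $\mu$ on $\mathbb{R}^d$ which satisfies the convex Poincaré inequality with constant $1$, every random vector $X$ with law $\mu$, and every convex $1$-Lipschitz function $f:\mathbb{R}^d\to\mathbb{R}$, $$\mathbb{P}\bigl(f(X)\le\mathbb{E}f(X)-t\bigr)\le2\exp(-c_dt),\qquad t\ge0 .$$ Then $$c_d\le\frac{d\log(2d)}{(d-1)^{3/2}},\qquad d\ge2 .$$ In particular, $\limsup_{d\to\infty}c_d\sqrt d/\log(d)\le1$.
   Context: $|\cdot|$ is the Euclidean norm and Lipschitz is meant with respect to it. A probability measure $\mu$ on $\mathbb{R}^d$ satisfies the convex Poincaré inequality with constant $C\in(0,\infty)$ if $\mathrm{Var}_\mu(f)\le C\int_{\mathbb{R}^d}|\nabla f(x)|^2d\mu(x)$ for all convex functions $f:\mathbb{R}^d\to\mathbb{R}$, where $|\nabla f(x)|:=\limsup_{y\to x}\frac{|f(y)-f(x)|}{|y-x|}$ and $\mathrm{Var}_\mu(f)=\int f^2d\mu-(\int f\,d\mu)^2$. Convention: an estimate $A\le B$ means that if $B<\infty$, then $A$ is well defined (here: $f\in L^2(\mu)$) and the inequality holds. *)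

(* Defs.v *)
From HB Require Import structures.
From mathcomp Require Import all_boot all_order all_algebra.
From mathcomp Require Import all_classical all_reals all_analysis.

Set Implicit Arguments.
Unset Strict Implicit.
Unset Printing Implicit Defensive.

Import Order.TTheory GRing.Theory Num.Theory.
Import numFieldNormedType.Exports.

Local Open Scope classical_set_scope.
Local Open Scope ring_scope.

(* ['rV[R]_d] with its Borel sigma-algebra.  The topology of ['rV[R]_d] comes
   from the sup norm, hence coincides with the Euclidean one. *)
Notation borel_rV R d := (g_sigma_algebraType (@open 'rV[R]_d)).

(* The library norm [`|x|] on ['rV[R]_d] is the sup norm. *)
Definition enorm (R : realType) (d : nat) (x : 'rV[R]_d) : R :=
  Num.sqrt (\sum_(i < d) x ord0 i ^+ 2).

Definition lipschitz1 (R : realType) (d : nat) (f : 'rV[R]_d -> R) : Prop :=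
  forall x y, `|f x - f y| <= enorm (x - y).

Definition grad_norm (R : realType) (d : nat) (f : 'rV[R]_d -> R)
    (x : 'rV[R]_d) : \bar R :=
  limf_esup (fun y => (`|f y - f x| / enorm (y - x))%:E) x^'.

(* Following the convention that an estimate A <= B asserts, when B < +oo,
   that A is well defined, finiteness of the right-hand side is required to
   imply that f is square integrable. *)
Definition convex_poincare (R : realType) (d : nat)
    (mu : probability (borel_rV R d) R) (C : R) : Prop :=
  forall f : 'rV[R]_d -> R, convex_function (E := 'rV[R]_d) setT f ->
  let rhs := (C%:E * \int[mu]_x (grad_norm f x ^+ 2))%E in
  (rhs < +oo)%E ->
  (f : borel_rV R d -> R) \in Lfun mu 2%:E /\
  ('E_mu[fun x => (f x ^+ 2)%R] - 'E_mu[f] ^+ 2 <= rhs)%E.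

(* A measure is a function on all sets whose values on non-measurable sets are
   irrelevant, hence the restriction to measurable sets. *)
Definition has_law disp (Omega : measurableType disp) (R : realType) (d : nat)
    (P : probability Omega R) (X : {mfun Omega >-> borel_rV R d})
    (mu : probability (borel_rV R d) R) : Prop :=
  forall A, measurable A -> distribution P X A = mu A.

Definition deviation_constant (R : realType) (d : nat) (c : R) : Prop :=
  forall mu : probability (borel_rV R d) R, convex_poincare mu 1 ->
  forall (disp : measure_display) (Omega : measurableType disp)
    (P : probability Omega R) (X : {mfun Omega >-> borel_rV R d}),
  has_law P X mu ->
  forall f : 'rV[R]_d -> R,
    convex_function (E := 'rV[R]_d) setT f -> lipschitz1 f ->
  forall t : R, 0 <= t ->
  (P [set w | (f (X w))%:E <= 'E_P[fun w' => f (X w')] - t%:E]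
     <= (2 * expR (- (c * t)))%:E)%E.

(* [sup] is a default value unless the set is nonempty and bounded above; that
   it is a maximum for d >= 1 is part of the theorem. *)
Definition largest_deviation_constant (R : realType) (d : nat) : R :=
  sup [set c : R | deviation_constant d c].

(* Main.v *)
Require Import Defs.
From mathcomp Require Import all_boot all_order all_algebra.
From mathcomp Require Import all_classical all_reals all_analysis.
From HB Require Import structures.
From mathcomp Require Import ring lra measurable_realfun.

(* The extremal measure puts mass 1/d at the origin and spreads the rest
   uniformly over the sphere of radius r = sqrt (d - 1).  Its Euclidean norm has
   mean t = (d - 1)^(3/2) / d and vanishes with probability at least 1/d, so that
   1/d <= 2 exp (- c t), which is the bound.

   The point is the convex Poincare inequality with constant 1.  For g convex and
   smooth, apply the Gaussian Poincare inequality to the 1-homogeneous function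
   |x| (g (r x / |x|) - m), with m chosen to make it centred.  This bounds the
   variance of g on the sphere by E |grad g|^2 - E T^2, where T is the radial
   derivative.  Convexity gives g (x) - g (0) <= r T (x), so that E T^2 dominates
   the contribution of the atom to the variance.  A general convex f is
   approximated by its Moreau envelopes, whose gradients are bounded by |grad f|.

   The Gaussian Poincare inequality comes from rotation invariance alone: by
   repeatedly halving a right angle, the correlation of F (X) and
   F (cos a X + sin a Y) is at most cos a for centred F, and one lets a tend to 0
   in E (F (cos a X + sin a Y) - cos a F (X))^2 / sin^2 a. *)

Set Implicit Arguments.
Unset Strict Implicit.
Unset Printing Implicit Defensive.

Import Order.TTheory GRing.Theory Num.Theory.
Import numFieldNormedType.Exports.

Local Open Scope classical_set_scope.
Local Open Scope ring_scope.

(** * Rotation invariance of Gaussian vectors *)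

(** The constants come from one computation. The gradient of the homogeneous function F splits
    orthogonally into a radial part of length |g - m| and a tangential part of squared length r ^ 2
    (|grad g| ^ 2 - T ^ 2), with g taken on the sphere. As |X| ^ 2 has mean n and is independent of
    the direction, E F ^ 2 is n times E (g - m) ^ 2; the radial part cancels one of these n copies,
    and r ^ 2 = n - 1 makes the constant exactly 1. Relative to the sphere, an atom of mass p costs
    p (E g - g (0)) ^ 2, which is at most p (n - 1) E T ^ 2, so p = 1 / n is light enough.
    Homogeneity has a second use: F (c X + s Y) - c F (X) equals c times F (X + (s / c) Y) - F (X),
    so the correlation bound becomes one on ordinary difference quotients. Polar coordinates,
    integration by parts and derivatives are replaced by one-sided inequalities: comparing the
    Gaussian law with its dilation by t near 1 bounds second moments, and a Moreau envelope enters
    only through its affine lower and quadratic upper bounds. *)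

Section Lebesgue_affine.
Context {R : realType}.
Local Notation mu := (@lebesgue_measure R).

(** Uniqueness of Lebesgue measure: the pushforward scaled by a has the right value on half-open
    intervals. *)
Lemma lebesgue_measure_affine (a b : R) (A : set R) : 0 < a -> measurable A ->
  (mu A = a%:E * mu ((fun x => a * x + b)%R @^-1` A))%E.
Proof.
move=> a0 mA.
have mf : measurable_fun [set: measurableTypeR R]
   ((fun x => a * x + b) : measurableTypeR R -> measurableTypeR R).
  apply: measurable_funD => //; exact: measurable_funM.
pose phi : measurableTypeR R -> measurableTypeR R := fun x => a * x + b.
have a0' := ltW a0.
pose m : {measure set (measurableTypeR R) -> \bar R} :=
  mscale (NngNum a0') (pushforward mu phi).
rewrite (@lebesgue_measure_unique _ (m mf)) //.
move=> _ [[u v]] _ <-.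
have pre : phi @^-1` `]u, v] = `](u - b) / a, (v - b) / a]%classic.
  apply/seteqP; split=> x /=; rewrite /phi !in_itv/= ltr_pdivrMr// ler_pdivlMr//;
    move=> /andP[? ?]; apply/andP; split; lra.
transitivity (a%:E * mu (phi @^-1` `]u, v]))%E; last by [].
rewrite pre.
rewrite !lebesgue_measure_itv/= !lte_fin ltr_pM2r ?invr_gt0//.
rewrite ltrD2r; case: ifP => _; last by rewrite mule0.
by rewrite -!EFinD -EFinM; congr EFin; field; lra.
Qed.

Lemma ge0_integral_affine (a b : R) (f : R -> \bar R) : 0 < a ->
  measurable_fun [set: R] f -> (forall x, 0 <= f x)%E ->
  (\int[mu]_x f x = a%:E * \int[mu]_x f (a * x + b)%R)%E.
Proof.
move=> a0 mf f0.
have mphi : measurable_fun [set: measurableTypeR R]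
   ((fun x => a * x + b) : measurableTypeR R -> measurableTypeR R).
  by apply: measurable_funD => //; exact: measurable_funM.
pose phi : measurableTypeR R -> measurableTypeR R := fun x => a * x + b.
pose m : {measure set (measurableTypeR R) -> \bar R} :=
  pushforward mu phi.
have a0' := ltW a0.
rewrite (eq_measure_integral (mscale (NngNum a0') (m mphi))).
  rewrite ge0_integral_mscale//.
  by rewrite ge0_integral_pushforward//= => ? ?.
by move=> A mA _; exact: lebesgue_measure_affine.
Qed.

Lemma ge0_integral_oppr (f : R -> \bar R) :
  measurable_fun [set: R] f -> (forall x, 0 <= f x)%E ->
  (\int[mu]_x f x = \int[mu]_x f (- x)%R)%E.
Proof.
move=> mf f0.
rewrite (eq_measure_integral
  (pushforward mu (-%R : measurableTypeR R -> measurableTypeR R))).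
  by rewrite ge0_integral_pushforward//= => ? ?.
by move=> A mA _; exact/esym/lebesgue_measureN.
Qed.

End Lebesgue_affine.

(** * Changes of variables for the standard normal law on the line *)

Section normal01.
Context {R : realType}.
Local Notation mu := (@lebesgue_measure R).
Local Notation N := (@normal_prob R 0 1).
Local Notation p := (@normal_pdf R 0 1).

Lemma normal01_pdfE x : p x = normal_peak 1 * expR (- (x ^+ 2) / 2).
Proof.
by rewrite normal_pdfE ?oner_neq0// /normal_fun subr0 expr1n.
Qed.

(** The Radon-Nikodym derivative agrees almost everywhere with [p], since both have the same
    integral over every measurable set. *)
Lemma ge0_integral_normal01 (f : R -> \bar R) :
  measurable_fun [set: R] f -> (forall x, 0 <= f x)%E ->
  (\int[N]_x f x = \int[mu]_x (f x * (p x)%:E))%E.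
Proof.
move=> mf f0.
rewrite -(Radon_Nikodym_SigmaFinite.change_of_variables
  (@normal_prob_dominates R 0 1))//.
have mp : measurable_fun [set: R] (EFin \o p).
  by apply/measurable_EFinP; exact: measurable_normal_pdf.
have ri := Radon_Nikodym_SigmaFinite.f_integrable (@normal_prob_dominates R 0 1).
apply: ae_eq_integral => //.
- apply: emeasurable_funM => //; exact: (measurable_int mu).
- exact: emeasurable_funM.
apply: ae_eqe_mul2l => /=.
apply: integral_ae_eq => //= E _ mE.
by rewrite -Radon_Nikodym_SigmaFinite.f_integral//; exact: normal_prob_dominates.
Qed.

(** The exponential is the ratio of the densities at t x and x. Taking t close to 1 plays the part
    of integration by parts in what follows. *)
Lemma ge0_integral_normal01_scale (t : R) (f : R -> \bar R) : 0 < t ->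
  measurable_fun [set: R] f -> (forall x, 0 <= f x)%E ->
  (\int[N]_x f x =
   t%:E * \int[N]_x (f (t * x)%R * (expR (- (t ^+ 2 - 1) / 2 * x ^+ 2))%:E))%E.
Proof.
move=> t0 mf f0.
rewrite ge0_integral_normal01// (@ge0_integral_affine _ t 0)//; last 2 first.
- apply: emeasurable_funM => //.
  by apply/measurable_EFinP; exact: measurable_normal_pdf.
- by move=> x; rewrite mule_ge0// lee_fin normal_pdf_ge0.
congr (_ * _)%E; rewrite ge0_integral_normal01//; last 2 first.
- apply: emeasurable_funM => //.
    by apply: measurableT_comp => //; exact: measurable_funM.
  apply/measurable_EFinP; apply: measurableT_comp => //.
  by apply: measurable_funM => //; exact: measurable_funX.
- by move=> x; rewrite mule_ge0// lee_fin expR_ge0.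
apply: eq_integral => x _; rewrite addr0 -muleA -EFinM; congr (_ * _%:E)%E.
rewrite !normal01_pdfE mulrCA -expRD; congr (_ * expR _); by field.
Qed.

Lemma ge0_integral_normal01N (f : R -> \bar R) :
  measurable_fun [set: R] f -> (forall x, 0 <= f x)%E ->
  (\int[N]_x f x = \int[N]_x f (- x)%R)%E.
Proof.
move=> mf f0.
rewrite ge0_integral_normal01// ge0_integral_oppr//; last 2 first.
- apply: emeasurable_funM => //.
  by apply/measurable_EFinP; exact: measurable_normal_pdf.
- by move=> x; rewrite mule_ge0// lee_fin normal_pdf_ge0.
rewrite ge0_integral_normal01//; last by exact: measurableT_comp.
by apply: eq_integral => x _; rewrite !normal01_pdfE sqrrN.
Qed.

End normal01.

Section rotation.
Context {R : realType}.
Local Notation mu := (@lebesgue_measure R).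
Local Notation N := (@normal_prob R 0 1).
Local Notation p := (@normal_pdf R 0 1).

Local Notation RR := (measurableTypeR R * measurableTypeR R)%type.

Lemma measurable_fun_lin2 (a b : R) :
  measurable_fun setT (fun z : RR => a * z.1 + b * z.2 : measurableTypeR R).
Proof. by apply: measurable_funD => //; exact: measurable_funM. Qed.

Lemma measurable_fun_linpair (a b a' b' : R) :
  measurable_fun setT (fun z : RR => (a * z.1 + b * z.2, a' * z.1 + b' * z.2) : RR).
Proof. by apply/measurable_fun_pairP; split; exact: measurable_fun_lin2. Qed.

(** A shear translates each horizontal slice, so Tonelli reduces it to translation invariance on the
    line. *)
Lemma ge0_integral_shear1 (k : R) (g : RR -> \bar R) :
  measurable_fun setT g -> (forall z, 0 <= g z)%E ->
  (\int[mu \x mu]_z g (z.1 + k * z.2, z.2)%R = \int[mu \x mu]_z g z)%E.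
Proof.
move=> mg g0.
have mgk : measurable_fun setT (fun z : RR => g (z.1 + k * z.2, z.2)).
  apply: (measurableT_comp mg).
  apply: (eq_measurable_fun _ _ (measurable_fun_linpair 1 k 0 1)) => z _.
  by congr pair; lra.
rewrite (fubini_tonelli2 _ mgk (fun=> g0 _)) (fubini_tonelli2 _ mg g0).
apply: eq_integral => y _; rewrite /fubini_G/= [in RHS](@ge0_integral_affine _ 1 (k * y))//.
  by rewrite mul1e; apply: eq_integral => x _; rewrite mul1r.
exact: measurableT_comp.
Qed.

Lemma ge0_integral_shear2 (k : R) (g : RR -> \bar R) :
  measurable_fun setT g -> (forall z, 0 <= g z)%E ->
  (\int[mu \x mu]_z g (z.1, z.2 + k * z.1)%R = \int[mu \x mu]_z g z)%E.
Proof.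
move=> mg g0.
have mgk : measurable_fun setT (fun z : RR => g (z.1, z.2 + k * z.1)).
  apply: (measurableT_comp mg).
  apply: (eq_measurable_fun _ _ (measurable_fun_linpair 1 0 k 1)) => z _.
  by congr pair; lra.
rewrite (fubini_tonelli1 _ mgk (fun=> g0 _)) (fubini_tonelli1 _ mg g0).
apply: eq_integral => y _; rewrite /fubini_F/= [in RHS](@ge0_integral_affine _ 1 (k * y))//.
  by rewrite mul1e; apply: eq_integral => x _; rewrite mul1r.
exact: measurableT_comp.
Qed.

Lemma measurable_normal01_pdf2 : measurable_fun setT
  (fun z : RR => (p z.1 * p z.2)%:E).
Proof.
apply/measurable_EFinP; apply: measurable_funM;
  by apply: measurableT_comp => //; exact: measurable_normal_pdf.
Qed.

Lemma ge0_integral_normal01_prod (f : RR -> \bar R) :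
  measurable_fun setT f -> (forall z, 0 <= f z)%E ->
  (\int[N \x N]_z f z = \int[mu \x mu]_z (f z * (p z.1 * p z.2)%:E))%E.
Proof.
move=> mf f0; rewrite fubini_tonelli1// fubini_tonelli1//; last 2 first.
- by apply: emeasurable_funM => //; exact: measurable_normal01_pdf2.
- by move=> z; rewrite mule_ge0// lee_fin mulr_ge0// normal_pdf_ge0.
rewrite ge0_integral_normal01//; last 2 first.
- exact: measurable_fun_fubini_tonelli_F.
- by move=> x; apply: integral_ge0.
apply: eq_integral => x _.
have mfx : measurable_fun [set: measurableTypeR R] (fun y : measurableTypeR R => f (x, y)).
  exact: measurableT_comp.
have mp : measurable_fun [set: measurableTypeR R] (fun y => (p y)%:E).
  by apply/measurable_EFinP; exact: measurable_normal_pdf.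
rewrite /fubini_F (ge0_integral_normal01 mfx)// -ge0_integralZr//.
- by apply: eq_integral => y _; rewrite /= -muleA -EFinM mulrC.
- exact: emeasurable_funM.
- by move=> y _; rewrite mule_ge0// lee_fin normal_pdf_ge0.
- by rewrite lee_fin normal_pdf_ge0.
Qed.

(* A plane rotation is a product of three shears. *)
Lemma ge0_integral_normal01_rot (c s : R)
    (f : RR -> \bar R) :
  c ^+ 2 + s ^+ 2 = 1 -> 0 < c ->
  measurable_fun setT f -> (forall z, 0 <= f z)%E ->
  (\int[N \x N]_z f (c * z.1 + s * z.2, c * z.2 - s * z.1)%R =
   \int[N \x N]_z f z)%E.
Proof.
move=> cs c0 mf f0.
have mfr : measurable_fun setT (fun z : RR => f (c * z.1 + s * z.2, c * z.2 - s * z.1)).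
  apply: (measurableT_comp mf).
  apply: (eq_measurable_fun _ _ (measurable_fun_linpair c s (- s) c)) => z _.
  by congr pair; lra.
rewrite (ge0_integral_normal01_prod mfr)// (ge0_integral_normal01_prod mf)//.
pose g (z : RR) := (f z * (p z.1 * p z.2)%:E)%E.
have mg : measurable_fun setT g.
  by apply: emeasurable_funM => //; exact: measurable_normal01_pdf2.
have g0 z : (0 <= g z)%E.
  by rewrite /g mule_ge0// lee_fin mulr_ge0// normal_pdf_ge0.
(* For a rotation by the angle a, [al] is tan (a / 2) and [be] is - sin a: the outer shears have
   slope [al], the middle one slope [be]. *)
pose al := s / (1 + c); pose be := - s.
have msh1 k : measurable_fun setT (fun z : RR =>
    ((z.1 + k * z.2, z.2) : RR)).
  apply: (eq_measurable_fun _ _ (measurable_fun_linpair 1 k 0 1)) => z _.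
  by congr pair; lra.
have msh2 k : measurable_fun setT (fun z : RR =>
    ((z.1, z.2 + k * z.1) : RR)).
  apply: (eq_measurable_fun _ _ (measurable_fun_linpair 1 0 k 1)) => z _.
  by congr pair; lra.
pose g1 z := g (z.1 + al * z.2, z.2).
pose g2 z := g1 (z.1, z.2 + be * z.1).
have mg1 : measurable_fun setT g1 := measurableT_comp mg (msh1 al).
have mg2 : measurable_fun setT g2 := measurableT_comp mg1 (msh2 be).
apply: (eq_trans _ (ge0_integral_shear1 al mg g0)).
apply: (eq_trans _ (ge0_integral_shear2 be mg1 (fun=> g0 _))).
apply: (eq_trans _ (ge0_integral_shear1 al mg2 (fun=> g0 _))).
apply: eq_integral => -[x y] _; rewrite /g2 /g1 /g /=.
have c1 : 1 + c != 0 by lra.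
have sE : s * (s / (1 + c)) = 1 - c.
  by rewrite mulrA -expr2 (_ : s ^+ 2 = (1 - c) * (1 + c)) ?mulfK//; lra.
have E1 : y + be * (x + al * y) = c * y - s * x.
  rewrite /al /be; transitivity (y - s * x - s * (s / (1 + c)) * y); first by ring.
  by rewrite sE; ring.
have E2 : x + al * y + al * (y + be * (x + al * y)) = c * x + s * y.
  rewrite E1 /al.
  transitivity (x - s * (s / (1 + c)) * x + s / (1 + c) * (1 + c) * y); first by ring.
  by rewrite sE divfK//; ring.
rewrite E2 E1; congr (_ * _%:E)%E.
(* The product density depends on x ^ 2 + y ^ 2 only, which the rotation preserves. *)
rewrite !normal01_pdfE mulrACA [RHS]mulrACA -!expRD; congr (_ * expR _).
transitivity (- ((c ^+ 2 + s ^+ 2) * (x ^+ 2 + y ^+ 2)) / 2); last by ring.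
by rewrite cs; ring.

Qed.

End rotation.

(** * Borel sets and measurable maps of row vectors *)

Section borel_rV.
Context {R : realType}.

Lemma ball_rVP n (x y : 'rV[R]_n) (e : R) :
  ball x e y <-> 0 < e /\ forall i, `|x ord0 i - y ord0 i| < e.
Proof.
split=> [[e0 xy]|[e0 xy]]; split=> // i; first exact: xy.
by move=> j; rewrite !ord1; exact: xy.
Qed.

(** Sup-norm balls are boxes, and those with rational centre and radius are countably many. This
    reduces Borel measurability of a vector-valued map to that of its coordinates. *)
Lemma open_rV_cover n (U : set 'rV[R]_n) : open U ->
  U = \bigcup_(k in [set k : 'rV[rat]_n * rat |
        ball (map_mx ratr k.1 : 'rV[R]_n) (ratr k.2) `<=` U])
      ball (map_mx ratr k.1 : 'rV[R]_n) (ratr k.2).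
Proof.
move=> oU; apply/seteqP; split=> [x Ux|x [k kU]]; last exact: kU.
have /nbhs_ballP[e /= e0 xeU] := open_nbhs_nbhs (conj oU Ux).
have /rat_in_itvoo[q /[!in_itv]/= /andP[q0 qe]] : 0 < e / 2 by rewrite divr_gt0.
have ratx (i : 'I_n) : {p : rat | `|x ord0 i - ratr p| < ratr q}.
  have /rat_in_itvoo/cid[p /[!in_itv]/= pp] : x ord0 i - ratr q < x ord0 i + ratr q.
    by lra.
  by exists p; rewrite distrC ltr_distl.
exists (\row_i sval (ratx i), q).
  move=> y /= /ball_rVP[_ xy]; apply: xeU; apply/ball_rVP; split=> // i.
  have := xy i; rewrite !mxE; have := svalP (ratx i); move: (sval _) => p h1 h2.
  rewrite (_ : _ - _ = x ord0 i - ratr p + (ratr p - y ord0 i)); last by lra.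
  apply: (le_lt_trans (ler_normD _ _)); lra.
apply/ball_rVP; split=> //= i; rewrite !mxE distrC.
exact: (svalP (ratx i)).
Qed.

Lemma measurable_fun_rV d (T : measurableType d) n (g : T -> borel_rV R n) :
  (forall i, measurable_fun setT (fun t => g t ord0 i)) ->
  measurable_fun setT g.
Proof.
move=> mg; apply: (@measurability _ _ T (borel_rV R n) setT g (@open 'rV[R]_n)) => //.
move=> _ [U oU <-]; rewrite setTI (open_rV_cover oU) preimage_bigcup.
rewrite bigcup_mkcond; apply: countable_bigcupT_measurable => // k.
case: ifPn => // _.
have [e0|e0] := ltP 0 (ratr k.2 : R); last first.
  rewrite (_ : _ @^-1` _ = set0) // -subset0 => t /= /ball_rVP[]; lra.
rewrite (_ : _ @^-1` _ = \bigcap_(i in [set: 'I_n])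
  ((fun t => g t ord0 i) @^-1` ball ((map_mx ratr k.1 : 'rV[R]_n) ord0 i) (ratr k.2))).
  apply: fin_bigcap_measurable; first exact: finite_finset.
  move=> i _; rewrite -[X in measurable X]setTI; apply: mg => //.
  exact: measurable_ball.
apply/seteqP; split=> t /=; first by move=> /ball_rVP[_ h] i _; exact: h.
by move=> h; apply/ball_rVP; split=> // i; exact: h.
Qed.

Lemma continuous_measurable_rV n (f : 'rV[R]_n -> R) :
  continuous f -> measurable_fun setT (f : borel_rV R n -> R).
Proof.
move=> cf; apply: (@measurability _ _ (borel_rV R n) R setT f (@RGenOpens.G R)); first exact: RGenOpens.measurableE.
move=> _ [_ [a [b ->]] <-]; rewrite setTI; apply: sub_sigma_algebra.
by apply: open_comp => // x _; exact: cf.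
Qed.

Lemma measurable_coord n (i : 'I_n) :
  measurable_fun setT (fun x : borel_rV R n => x ord0 i).
Proof.
apply: (@continuous_measurable_rV n (fun x => x ord0 i)).
exact: coord_continuous.
Qed.

Lemma measurable_fun_coord d (T : measurableType d) n (g : T -> borel_rV R n) i :
  measurable_fun setT g -> measurable_fun setT (fun t => g t ord0 i).
Proof. by move=> mg; exact: (measurableT_comp (measurable_coord i) mg). Qed.

End borel_rV.

(** * Standard Gaussian vectors, built coordinate by coordinate *)

Section gaussian_vector.
Context {R : realType}.
Local Notation mu := (@lebesgue_measure R).

Definition normal01 : probability (measurableTypeR R) R := normal_prob (0 : R) 1.

Definition consV n (z : measurableTypeR R * borel_rV R n) : borel_rV R n.+1 :=
  \row_i oapp (fun j => z.2 ord0 j) z.1 (unlift ord0 i).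

Lemma consV0 n (z : measurableTypeR R * borel_rV R n) : consV z ord0 ord0 = z.1.
Proof. by rewrite mxE unlift_none. Qed.

Lemma consV_lift n (z : measurableTypeR R * borel_rV R n) i :
  consV z ord0 (lift ord0 i) = z.2 ord0 i.
Proof. by rewrite mxE liftK. Qed.

Lemma measurable_consV n : measurable_fun setT (@consV n).
Proof.
apply: measurable_fun_rV => i.
have [j ->|->] := unliftP ord0 i.
  under eq_fun do rewrite consV_lift.
  exact: measurable_fun_coord.
under eq_fun do rewrite consV0.
exact: measurable_fst.
Qed.

HB.instance Definition _ n := isMeasurableFun.Build _ _ _ _ _ (@measurable_consV n).

(** One independent coordinate is added at a time, so that facts on the line lift by induction; each
    stage is pushed forward to the Borel space of row vectors. In dimension 0 there is only one
    point. *)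
Fixpoint normalV n : probability (borel_rV R n) R :=
  if n is n'.+1 then distribution (normal01 \x normalV n')%E (@consV n')
  else \d_(0 : borel_rV R 0).

Lemma ge0_integral_normalVS n (f : borel_rV R n.+1 -> \bar R) :
  measurable_fun setT f -> (forall x, 0 <= f x)%E ->
  (\int[normalV n.+1]_x f x =
   \int[normal01]_a \int[normalV n]_x f (consV (a, x)))%E.
Proof.
move=> mf f0; rewrite /= ge0_integral_pushforward//=.
have mfc : measurable_fun setT (f \o @consV n) := measurableT_comp mf (@measurable_consV n).
by rewrite (fubini_tonelli1 _ mfc) // => ?; exact: f0.
Qed.

End gaussian_vector.

Section dotV.
Context {R : realType}.

Definition dotV n (x y : 'rV[R]_n) : R := \sum_i x ord0 i * y ord0 i.

Lemma dotVC n (x y : 'rV[R]_n) : dotV x y = dotV y x.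
Proof. by apply: eq_bigr => i _; rewrite mulrC. Qed.

Lemma dotVDr n (x y z : 'rV[R]_n) : dotV x (y + z) = dotV x y + dotV x z.
Proof. by rewrite -big_split; apply: eq_bigr => i _; rewrite mxE mulrDr. Qed.

Lemma dotVZr n k (x y : 'rV[R]_n) : dotV x (k *: y) = k * dotV x y.
Proof. by rewrite /dotV mulr_sumr; apply: eq_bigr => i _; rewrite mxE mulrCA. Qed.

Lemma dotVDl n (x y z : 'rV[R]_n) : dotV (y + z) x = dotV y x + dotV z x.
Proof. by rewrite dotVC dotVDr !(dotVC x). Qed.

Lemma dotVZl n k (x y : 'rV[R]_n) : dotV (k *: y) x = k * dotV y x.
Proof. by rewrite dotVC dotVZr dotVC. Qed.

Lemma dotV0r n (x : 'rV[R]_n) : dotV x 0 = 0.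
Proof. by rewrite -(scale0r x) dotVZr mul0r. Qed.

Lemma dotV0l n (x : 'rV[R]_n) : dotV 0 x = 0.
Proof. by rewrite dotVC dotV0r. Qed.

Lemma dotVNr n (x y : 'rV[R]_n) : dotV x (- y) = - dotV x y.
Proof. by rewrite -scaleN1r dotVZr mulN1r. Qed.

Lemma dotVNl n (x y : 'rV[R]_n) : dotV (- x) y = - dotV x y.
Proof. by rewrite dotVC dotVNr dotVC. Qed.

Lemma dotV_ge0 n (x : 'rV[R]_n) : 0 <= dotV x x.
Proof. by apply: sumr_ge0 => i _; rewrite -expr2 sqr_ge0. Qed.

Lemma dotV_eq0 n (x : 'rV[R]_n) : (dotV x x == 0) = (x == 0).
Proof.
apply/idP/eqP => [/eqP|->]; last by rewrite dotV0r.
move=> /psumr_eq0P xx; apply/rowP => i; rewrite mxE; apply/eqP.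
by rewrite -sqrf_eq0 expr2; apply/eqP/xx => // j _; rewrite -expr2 sqr_ge0.
Qed.

Lemma dotV_gt0 n (x : 'rV[R]_n) : (0 < dotV x x) = (x != 0).
Proof. by rewrite lt_def dotV_ge0 andbT dotV_eq0. Qed.

Lemma cauchy_schwarz_dotV n (x y : 'rV[R]_n) :
  dotV x y ^+ 2 <= dotV x x * dotV y y.
Proof.
have [->|y0] := eqVneq y 0; first by rewrite !dotV0r expr0n mulr0.
have yy : 0 < dotV y y by rewrite dotV_gt0.
have := dotV_ge0 (dotV y y *: x - dotV x y *: y).
rewrite !(dotVDr, dotVDl, dotVNr, dotVNl, dotVZr, dotVZl) (dotVC y x).
set a := dotV x x; set b := dotV x y; set c := dotV y y => h.
have : 0 <= c * (c * a - b ^+ 2).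
  by apply: (le_trans h); rewrite le_eqVlt; apply/orP; left; apply/eqP; ring.
by rewrite pmulr_rge0// subr_ge0 mulrC.
Qed.

Lemma dotV_consV n (z w : measurableTypeR R * borel_rV R n) :
  dotV (consV z) (consV w) = z.1 * w.1 + dotV z.2 w.2.
Proof.
by rewrite /dotV big_ord_recl !consV0; congr (_ + _); apply: eq_bigr => i _; rewrite !consV_lift.
Qed.

Lemma measurable_dotV d (T : measurableType d) n (f g : T -> borel_rV R n) :
  measurable_fun setT f -> measurable_fun setT g ->
  measurable_fun setT (fun t => dotV (f t) (g t)).
Proof.
move=> mf mg; apply: measurable_sum => i.
by apply: measurable_funM; exact: measurable_fun_coord.
Qed.

End dotV.

(** * Second moments and dilations of Gaussian vectors *)

Section normal_moments.
Context {R : realType}.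
Local Notation N := (@normal01 R).

Lemma consV_eta n (b : 'rV[R]_n.+1) :
  b = consV (b ord0 ord0, \row_i b ord0 (lift ord0 i)).
Proof.
apply/rowP => i; have [j ->|->] := unliftP ord0 i; last by rewrite consV0.
by rewrite consV_lift /= mxE.
Qed.

(** Dilating the constant 1 gives 1 = t E exp ((1 - t ^ 2) X ^ 2 / 2); bounding the exponential from
    below by its tangent and letting t increase to 1 yields the claim. *)
Lemma normal01_sqr_le1 : (\int[N]_x (x ^+ 2)%:E <= 1)%E.
Proof.
set M := (\int[N]_x (x ^+ 2)%:E)%E.
have msq : measurable_fun [set: measurableTypeR R] (fun x : R => (x ^+ 2)%:E).
  by apply/measurable_EFinP; exact: measurable_funX.
have M0 : (0 <= M)%E by apply: integral_ge0 => x _; rewrite lee_fin sqr_ge0.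
have key t : 0 < t -> t < 1 -> (t%:E * (1 + ((1 - t ^+ 2) / 2)%:E * M) <= 1)%E.
  move=> t0 t1.
  have k0 : 0 <= (1 - t ^+ 2) / 2 by nra.
  have e1 : (\int[N]_x (1 : \bar R) = 1)%E.
    by rewrite integral_cst// mul1e; exact: probability_setT.
  rewrite -[leRHS]e1 (@ge0_integral_normal01_scale _ t (fun=> 1%E))//.
  apply: lee_wpmul2l; first by rewrite lee_fin ltW.
  rewrite -[X in (X + _)%E]e1 -ge0_integralZl//; last by move=> x _; rewrite lee_fin sqr_ge0.
  rewrite -ge0_integralD//; last 2 first.
  - by move=> x _; rewrite mule_ge0// lee_fin ?sqr_ge0.
  - exact: emeasurable_funM.
  apply: ge0_le_integral => //.
  - by move=> x _; rewrite adde_ge0// mule_ge0// lee_fin ?sqr_ge0.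
  - by apply: emeasurable_funD => //; exact: emeasurable_funM.
  - apply: emeasurable_funM => //; apply/measurable_EFinP.
    apply: measurableT_comp => //; apply: measurable_funM => //.
  move=> x _; rewrite mul1e -EFinM -EFinD lee_fin.
  apply: (le_trans _ (expR_ge1Dx _)); lra.
have Moo : (M < +oo)%E.
  rewrite ltNge leye_eq; apply/negP => /eqP Moo.
  have := key (2^-1); rewrite Moo gt0_muley; last by rewrite lte_fin; lra.
  rewrite addey// gt0_muley; last by rewrite lte_fin; lra.
  by move=> /(_ ltac:(lra) ltac:(lra)).
have Mf : M \is a fin_num by rewrite ge0_fin_numE.
move: key M0; rewrite -(fineK Mf); set m := fine M => key; rewrite !lee_fin => m0.
rewrite leNgt; apply/negP => m1; clear Moo Mf.
(* With t = 1 - dl, [key] becomes (1 - dl) (2 - dl) m <= 2. Since 3 dl = 1 - 1 / m, the left side is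
   at least m + 1, which contradicts m > 1. *)
pose dl := (1 - m^-1) / 3.
have im : 0 < m^-1 < 1 by rewrite invr_gt0 invf_lt1//; lra.
have mm : m * m^-1 = 1 by rewrite divff// lt0r_neq0//; exact: lt_trans m1.
have := key (1 - dl); rewrite -EFinM lee_fin.
have d3 : 3 * dl = 1 - m^-1 by rewrite /dl; lra.
move: dl (m^-1) im mm d3 => dl j /andP[j0 j1] mj d3 /(_ ltac:(lra) ltac:(lra)) h.
have dl0 : 0 < dl by lra.
have h2 : dl * ((1 - dl) * (2 - dl) * m) <= dl * 2 by nra.
have h3 : (1 - dl) * (2 - dl) * m <= 2 by rewrite -(ler_pM2l dl0).
nra.
Qed.

End normal_moments.

Section normalV_integrals.
Context {R : realType}.
Local Notation N := (@normal01 R).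

Lemma measurable_consVr n (a : R) :
  measurable_fun setT (fun x : borel_rV R n => consV (a, x)).
Proof.
apply: (measurableT_comp (@measurable_consV R n)).
exact: pair1_measurable.
Qed.

Lemma probability_integral_cst d (T : measurableType d) (P : probability T R) (k : \bar R) :
  (\int[P]_x k = k)%E.
Proof. by rewrite integral_cst// [X in (_ * X)%E]probability_setT mule1. Qed.

(** Averaging over a and - a removes the cross term while every integrand stays nonnegative. *)
Lemma normal01_affine_sqr (k s : R) :
  (\int[N]_a ((k * a + s) ^+ 2)%:E <= (k ^+ 2 + s ^+ 2)%:E)%E.
Proof.
have mf (k' : R) : measurable_fun [set: measurableTypeR R] (fun a : R => (k' * a + s) ^+ 2).
  by apply: measurable_funX; apply: measurable_funD => //; exact: measurable_funM.
have mh (k' : R) : measurable_fun [set: measurableTypeR R]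
    (fun a : R => (2^-1 * (k' * a + s) ^+ 2)%:E).
  by apply/measurable_EFinP; exact: measurable_funM.
have msq : measurable_fun [set: measurableTypeR R] (fun x : R => (x ^+ 2)%:E).
  by apply/measurable_EFinP; exact: measurable_funX.
have h0 (k' : R) a : (0 <= (2^-1 * (k' * a + s) ^+ 2)%:E)%E.
  by rewrite lee_fin mulr_ge0// sqr_ge0.
have e : (\int[N]_a (2^-1 * (k * a + s) ^+ 2)%:E =
          \int[N]_a (2^-1 * (- k * a + s) ^+ 2)%:E)%E.
  rewrite (ge0_integral_normal01N (mh k))//.
  by apply: eq_integral => a _; rewrite mulrN mulNr.
have -> : (\int[N]_a ((k * a + s) ^+ 2)%:E =
    \int[N]_a (2^-1 * (k * a + s) ^+ 2)%:E + \int[N]_a (2^-1 * (k * a + s) ^+ 2)%:E)%E.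
  rewrite -ge0_integralD//; apply: eq_integral => a _.
  by rewrite -EFinD; congr EFin; lra.
rewrite [X in (_ + X)%E]e -ge0_integralD//.
under eq_integral => a _.
  rewrite -EFinD (_ : 2^-1 * (k * a + s) ^+ 2 + 2^-1 * (- k * a + s) ^+ 2 =
    k ^+ 2 * a ^+ 2 + s ^+ 2); last by field.
  rewrite EFinD EFinM; over.
rewrite ge0_integralD//; last 3 first.
- by move=> a _; rewrite mule_ge0// lee_fin sqr_ge0.
- exact: emeasurable_funM.
- by move=> a _; rewrite lee_fin sqr_ge0.
rewrite ge0_integralZl//; last 2 first.
- by move=> a _; rewrite lee_fin sqr_ge0.
- by rewrite lee_fin sqr_ge0.
rewrite probability_integral_cst EFinD leeD2r// -[leRHS]mule1.
by apply: lee_wpmul2l; [rewrite lee_fin sqr_ge0|exact: normal01_sqr_le1].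
Qed.

(** Averaging the squared derivative in a Gaussian direction gives the squared length of the
    gradient [b]. The induction splits off one coordinate by [normal01_affine_sqr]. *)
Lemma normalV_dotV_sqr n (b : 'rV[R]_n) :
  (\int[normalV n]_y (dotV b y ^+ 2)%:E <= (dotV b b)%:E)%E.
Proof.
elim: n b => [b|n IH b].
  rewrite (_ : dotV b b = 0); last by rewrite /dotV big_ord0.
  under eq_integral do rewrite /dotV big_ord0 expr0n.
  by rewrite probability_integral_cst.
rewrite ge0_integral_normalVS; last 2 first.
- apply/measurable_EFinP; apply: measurable_funX; exact: measurable_dotV.
- by move=> x; rewrite lee_fin sqr_ge0.
rewrite [b]consV_eta; set b0 := b _ _; set b' := \row__ _.
pose f (z : measurableTypeR R * borel_rV R n) := ((b0 * z.1 + dotV b' z.2) ^+ 2)%:E.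
have mf : measurable_fun setT f.
  apply/measurable_EFinP; apply: measurable_funX; apply: measurable_funD.
    exact: measurable_funM.
  exact: measurable_dotV.
have f0 z : (0 <= f z)%E by rewrite lee_fin sqr_ge0.
under eq_integral do under eq_integral do rewrite dotV_consV.
rewrite (fubini_tonelli _ mf f0) dotV_consV -expr2.
have md : measurable_fun setT (fun x : borel_rV R n => (dotV b' x ^+ 2)%:E).
  by apply/measurable_EFinP; apply: measurable_funX; exact: measurable_dotV.
apply: (@le_trans _ _ (\int[normalV n]_x ((b0 ^+ 2)%:E + (dotV b' x ^+ 2)%:E))%E).
  apply: ge0_le_integral => //.
  - by move=> x _; exact: integral_ge0.
  - exact: (measurable_fun_fubini_tonelli_G f).
  - exact: emeasurable_funD.
  - move=> x _; rewrite -EFinD; exact: (normal01_affine_sqr b0 (dotV b' x)).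
rewrite ge0_integralD//; last 2 first.
- by move=> x _; rewrite lee_fin sqr_ge0.
- by move=> x _; rewrite lee_fin sqr_ge0.
by rewrite probability_integral_cst EFinD leeD2l.
Qed.

Lemma ge0_integral_normalV_scale n (t : R) (f : borel_rV R n -> \bar R) : 0 < t ->
  measurable_fun setT f -> (forall x, 0 <= f x)%E ->
  (\int[normalV n]_x f x = (t ^+ n)%:E *
   \int[normalV n]_x (f (t *: x) * (expR (- (t ^+ 2 - 1) / 2 * dotV x x))%:E))%E.
Proof.
move=> t0.
have mZ m : measurable_fun setT (fun x : borel_rV R m => t *: x : borel_rV R m).
  apply: measurable_fun_rV => i; under eq_fun do rewrite mxE.
  by apply: measurable_funM => //; exact: measurable_coord.
have me m : measurable_fun setT
    (fun x : borel_rV R m => (expR (- (t ^+ 2 - 1) / 2 * dotV x x))%:E).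
  apply/measurable_EFinP; apply: measurableT_comp => //; apply: measurable_funM => //.
  exact: measurable_dotV.
elim: n f => [f mf f0|n IH f mf f0].
  rewrite expr0 mul1e; apply: eq_integral => x _.
  by rewrite /dotV big_ord0 mulr0 expR0 mule1; congr f; apply/rowP => -[].
have fe0 m (g : borel_rV R m -> \bar R) x : (forall x, 0 <= g x)%E ->
    (0 <= g x * (expR (- (t ^+ 2 - 1) / 2 * dotV x x))%:E)%E.
  by move=> g0; rewrite mule_ge0// lee_fin expR_ge0.
pose H (z : measurableTypeR R * borel_rV R n) :=
  (f (consV (z.1, t *: z.2)) * (expR (- (t ^+ 2 - 1) / 2 * dotV z.2 z.2))%:E)%E.
have H0 z : (0 <= H z)%E by rewrite /H mule_ge0// lee_fin expR_ge0.
have mH : measurable_fun setT H.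
  apply: emeasurable_funM; last exact: (measurableT_comp (me n) measurable_snd).
  apply: (measurableT_comp mf); apply: (measurableT_comp (@measurable_consV R n)).
  apply: measurable_fun_pair => //=.
  exact: (measurableT_comp (mZ n) measurable_snd).
pose G a := (\int[normalV n]_x H (a, x))%E.
have mG : measurable_fun [set: measurableTypeR R] G by exact: measurable_fun_fubini_tonelli_F.
have G0 a : (0 <= G a)%E by exact: integral_ge0.
rewrite ge0_integral_normalVS//.
under eq_integral => a _.
  rewrite (IH (fun x => f (consV (a, x))))//; last first.
    exact: (measurableT_comp mf (measurable_consVr a)).
  rewrite -/(G a); over.
rewrite ge0_integralZl//; last by rewrite lee_fin exprn_ge0// ltW.
rewrite (ge0_integral_normal01_scale t0 mG)// muleA -EFinM -exprSr; congr (_ * _)%E.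
rewrite ge0_integral_normalVS//; last 2 first.
- by apply: emeasurable_funM => //; exact: (measurableT_comp mf (mZ n.+1)).
- by move=> x; apply: (fe0 _ (fun x => f (t *: x))).
apply: eq_integral => a _; rewrite -ge0_integralZr//; last first.
  exact: (measurableT_comp mH (pair1_measurable (t * a))).
apply: eq_integral => x _; rewrite /H /= -muleA -EFinM -expRD; congr (f _ * _%:E)%E.
  apply/rowP => i; rewrite [RHS]mxE; have [j ->|->] := unliftP ord0 i.
    by rewrite !consV_lift /= mxE.
  by rewrite !consV0.
by rewrite dotV_consV /=; congr expR; ring.
Qed.

End normalV_integrals.

(** * Product measures and the regrouping of pairs of vectors *)

Section product_probability.
Context d1 d2 (T1 : measurableType d1) (T2 : measurableType d2) (R : realType).
Variables (P : probability T1 R) (Q : probability T2 R).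

Definition pprod : probability (T1 * T2)%type R := (P \x Q)%E.

Variable f : T1 * T2 -> \bar R.
Hypotheses (mf : measurable_fun setT f) (f0 : forall z, (0 <= f z)%E).

Lemma ge0_pprod1 : (\int[pprod]_z f z = \int[P]_x \int[Q]_y f (x, y))%E.
Proof. exact: fubini_tonelli1. Qed.

Lemma ge0_pprod2 : (\int[pprod]_z f z = \int[Q]_y \int[P]_x f (x, y))%E.
Proof. exact: fubini_tonelli2. Qed.

Lemma ge0_pprodC : (\int[P]_x \int[Q]_y f (x, y) = \int[Q]_y \int[P]_x f (x, y))%E.
Proof. by rewrite -ge0_pprod1 ge0_pprod2. Qed.

Lemma measurable_pprod1 : measurable_fun setT (fun x => \int[Q]_y f (x, y))%E.
Proof. exact: measurable_fun_fubini_tonelli_F. Qed.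

End product_probability.

Section product_of_pairs.
Context d1 d2 d' (T1 : measurableType d1) (T2 : measurableType d2)
  (T' : measurableType d') (R : realType).
Variables (P : probability T1 R) (Q : probability T2 R) (Q' : probability T' R).
Variable h : T1 * T2 -> T'.
Hypothesis mh : measurable_fun setT h.
Hypothesis Q'E : forall f : T' -> \bar R, measurable_fun setT f ->
  (forall x, 0 <= f x)%E -> (\int[Q']_x f x = \int[P]_a \int[Q]_x f (h (a, x)))%E.

(** Separates the two leading entries from the two remaining vectors, because a rotation of the pair
    of vectors acts on these two groups independently. *)
Definition pair_map (wz : (T1 * T1) * (T2 * T2)) : T' * T' :=
  (h (wz.1.1, wz.2.1), h (wz.1.2, wz.2.2)).

Lemma measurable_pair_map : measurable_fun setT pair_map.
Proof.
have m11 : measurable_fun setT (fun x : (T1 * T1) * (T2 * T2) => x.1.1).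
  exact: (measurableT_comp measurable_fst measurable_fst).
have m12 : measurable_fun setT (fun x : (T1 * T1) * (T2 * T2) => x.1.2).
  exact: (measurableT_comp measurable_snd measurable_fst).
have m21 : measurable_fun setT (fun x : (T1 * T1) * (T2 * T2) => x.2.1).
  exact: (measurableT_comp measurable_fst measurable_snd).
have m22 : measurable_fun setT (fun x : (T1 * T1) * (T2 * T2) => x.2.2).
  exact: (measurableT_comp measurable_snd measurable_snd).
by apply: measurable_fun_pair; apply: (measurableT_comp mh); exact: measurable_fun_pair.
Qed.

Lemma measurable_fun_pair_map_integral (f : T' * T' -> \bar R) :
  measurable_fun setT f -> (forall z, 0 <= f z)%E ->
  measurable_fun setT (fun w => \int[pprod Q Q]_z f (pair_map (w, z)))%E.
Proof.
move=> mf f0; have mK := measurableT_comp mf measurable_pair_map.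
exact: (measurable_pprod1 (pprod Q Q) mK (fun=> f0 _)).
Qed.

Lemma ge0_integral_pair_map (f : T' * T' -> \bar R) :
  measurable_fun setT f -> (forall z, 0 <= f z)%E ->
  (\int[pprod Q' Q']_z f z = \int[pprod P P]_w \int[pprod Q Q]_z f (pair_map (w, z)))%E.
Proof.
move=> mf f0; pose K := f \o pair_map.
have mK : measurable_fun setT K := measurableT_comp mf measurable_pair_map.
have K0 z : (0 <= K z)%E by exact: f0.
have mH := measurable_fun_pair_map_integral mf f0.
rewrite (ge0_pprod1 P P mH); last by move=> w; exact: integral_ge0.
rewrite (ge0_pprod1 Q' Q' mf f0) Q'E; last 2 first.
- exact: measurable_pprod1.
- by move=> x; exact: integral_ge0.
apply: eq_integral => a _.
under eq_integral => x _.
  rewrite Q'E//; last exact: (measurableT_comp mf (pair1_measurable _)).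
  over.
(* The second leading entry and the first remaining vector must trade places in the iterated
   integral; [g] lists the variables in the order in which they stand before the exchange. *)
pose g (t : (T2 * T1) * T2) := K ((a, t.1.2), (t.1.1, t.2)).
have mg : measurable_fun setT g.
  apply: (measurableT_comp mK); apply: measurable_fun_pair.
    apply: measurable_fun_pair => //.
    exact: (measurableT_comp measurable_snd measurable_fst).
  apply: measurable_fun_pair; last exact: measurable_snd.
  exact: (measurableT_comp measurable_fst measurable_fst).
have g0 t : (0 <= g t)%E by exact: K0.
have mg1 : measurable_fun setT (fun t => \int[Q]_y g (t, y))%E.
  exact: measurable_pprod1.
rewrite (ge0_pprodC _ _ mg1); last by move=> x; exact: integral_ge0.
apply: eq_integral => b _.
have mKb : measurable_fun setT (fun z => K ((a, b), z)).
  exact: (measurableT_comp mK (pair1_measurable (a, b))).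
by rewrite (ge0_pprod1 _ _ mKb (fun=> K0 _)).
Qed.

End product_of_pairs.

Section normalV_rotation.
Context {R : realType}.
Local Notation N := (@normal01 R).
Local Notation RR := (measurableTypeR R * measurableTypeR R)%type.
Local Notation VV n := (borel_rV R n * borel_rV R n)%type.

Lemma ge0_integral_normalVVS n (f : VV n.+1 -> \bar R) :
  measurable_fun setT f -> (forall z, 0 <= f z)%E ->
  (\int[pprod (normalV n.+1) (normalV n.+1)]_z f z =
   \int[pprod N N]_w \int[pprod (normalV n) (normalV n)]_z f (pair_map (@consV R n) (w, z)))%E.
Proof. exact: (ge0_integral_pair_map (@measurable_consV R n) (@ge0_integral_normalVS R n)). Qed.

Definition rotVV n (c s : R) (z : VV n) : VV n :=
  (c *: z.1 + s *: z.2, c *: z.2 - s *: z.1).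

Lemma measurable_rotVV n c s : measurable_fun setT (@rotVV n c s).
Proof.
have m1 i : measurable_fun setT (fun z : VV n => z.1 ord0 i).
  exact: measurable_fun_coord.
have m2 i : measurable_fun setT (fun z : VV n => z.2 ord0 i).
  exact: measurable_fun_coord.
apply: measurable_fun_pair; apply: measurable_fun_rV => i; under eq_fun do rewrite !mxE.
  by apply: measurable_funD; exact: measurable_funM.
by apply: measurable_funB; exact: measurable_funM.
Qed.

(** The same plane rotation acts on each pair of matching coordinates. The leading pair is handled
    by [ge0_integral_normal01_rot], the others by induction. *)
Lemma ge0_integral_normalV_rot n (c s : R) (f : VV n -> \bar R) :
  c ^+ 2 + s ^+ 2 = 1 -> 0 < c ->
  measurable_fun setT f -> (forall z, 0 <= f z)%E ->
  (\int[pprod (normalV n) (normalV n)]_z f (rotVV c s z) =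
   \int[pprod (normalV n) (normalV n)]_z f z)%E.
Proof.
move=> cs c0; elim: n f => [|n IH] f mf f0.
  apply: eq_integral => -[x y] _; congr (f (_, _)); apply/rowP => -[] //.
have mfr : measurable_fun setT (f \o rotVV c s) := measurableT_comp mf (@measurable_rotVV n.+1 c s).
rewrite (ge0_integral_normalVVS mfr (fun=> f0 _)) (ge0_integral_normalVVS mf f0).
pose H w := (\int[pprod (normalV n) (normalV n)]_z f (pair_map (@consV R n) (w, z)))%E.
have mH : measurable_fun setT H.
  exact: (measurable_fun_pair_map_integral _ (@measurable_consV R n) mf f0).
have mK := measurableT_comp mf (measurable_pair_map (@measurable_consV R n)).
have H0 w : (0 <= H w)%E by exact: integral_ge0.
rewrite -[RHS](ge0_integral_normal01_rot cs c0 mH H0).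
apply: eq_integral => w _; rewrite /H.
pose w' : RR := (c * w.1 + s * w.2, c * w.2 - s * w.1).
rewrite -(IH (fun z => f (pair_map (@consV R n) (w', z))))//; last first.
  exact: (measurableT_comp mK (pair1_measurable w')).
apply: eq_integral => z _ /=; congr (f (_, _)); apply/rowP => i.
  rewrite 2![in LHS]mxE ![(_ *: consV _) _ _]mxE /pair_map /=.
  have [j ->|->] := unliftP ord0 i; first by rewrite !consV_lift /= !mxE.
  by rewrite !consV0.
rewrite [LHS]mxE [X in _ + X]mxE ![(_ *: consV _) _ _]mxE /pair_map /=.
have [j ->|->] := unliftP ord0 i; first by rewrite !consV_lift /= !mxE.
by rewrite !consV0.
Qed.

End normalV_rotation.

(** * Correlations of square integrable functions *)

Section square_integrable.
Context d (T : measurableType d) (R : realType) (P : probability T R).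
Implicit Types f g : T -> R.

Definition sqint f := measurable_fun setT f /\
  P.-integrable setT (fun x => (f x ^+ 2)%:E).

Lemma sqint_mul f g : sqint f -> sqint g ->
  P.-integrable setT (EFin \o (fun x => f x * g x)).
Proof.
move=> [mf f2] [mg g2].
apply: (@le_integrable _ _ _ P _ _ _ (fun x => (f x ^+ 2)%:E + (g x ^+ 2)%:E)%E) => //.
- by apply/measurable_EFinP; exact: measurable_funM.
- move=> x _ /=; rewrite lee_fin [leRHS]ger0_norm ?addr_ge0 ?sqr_ge0//.
  rewrite ler_norml; apply/andP; split; nra.
- exact: integrableD.
Qed.

Lemma sqint_lin f g (k l : R) : sqint f -> sqint g -> sqint (fun x => k * f x + l * g x).
Proof.
move=> sf sg; have fg := sqint_mul sf sg; case: sf sg => [mf f2] [mg g2]; split.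
  by apply: measurable_funD; exact: measurable_funM.
apply: (@eq_integrable _ _ _ P setT measurableT (fun x => (k ^+ 2)%:E * (f x ^+ 2)%:E +
   ((2 * k * l)%:E * (f x * g x)%:E + (l ^+ 2)%:E * (g x ^+ 2)%:E))%E) => //.
  by move=> x _ /=; congr EFin; ring.
by apply: integrableD => //; [|apply: integrableD => //]; exact: integrableZl.
Qed.

Lemma Rintegral_sqr_lin f g (k l : R) : sqint f -> sqint g ->
  \int[P]_x ((k * f x + l * g x) ^+ 2) =
  k ^+ 2 * \int[P]_x (f x ^+ 2) + 2 * k * l * \int[P]_x (f x * g x) +
  l ^+ 2 * \int[P]_x (g x ^+ 2).
Proof.
move=> sf sg; have fg := sqint_mul sf sg; case: sf sg => [mf f2] [mg g2].
have i1 : P.-integrable setT (EFin \o (fun x => k ^+ 2 * f x ^+ 2)).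
  exact: (integrableZl measurableT _ f2).
have i2 : P.-integrable setT (EFin \o (fun x => 2 * k * l * (f x * g x))).
  exact: (integrableZl measurableT _ fg).
have i3 : P.-integrable setT (EFin \o (fun x => l ^+ 2 * g x ^+ 2)).
  exact: (integrableZl measurableT _ g2).
have i12 : P.-integrable setT
    (EFin \o (fun x => k ^+ 2 * f x ^+ 2 + 2 * k * l * (f x * g x))).
  exact: (integrableD measurableT i1 i2).
rewrite -!RintegralZl// -!RintegralD//.
by apply: eq_Rintegral => x _; ring.
Qed.

Lemma Rintegral_mul_linl f g h (k l : R) : sqint f -> sqint g -> sqint h ->
  \int[P]_x ((k * f x + l * g x) * h x) =
  k * \int[P]_x (f x * h x) + l * \int[P]_x (g x * h x).
Proof.
move=> sf sg sh; have fh := sqint_mul sf sh; have gh := sqint_mul sg sh.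
have i1 : P.-integrable setT (EFin \o (fun x => k * (f x * h x))).
  exact: (integrableZl measurableT _ fh).
have i2 : P.-integrable setT (EFin \o (fun x => l * (g x * h x))).
  exact: (integrableZl measurableT _ gh).
rewrite -!RintegralZl// -!RintegralD//.
by apply: eq_Rintegral => x _; ring.
Qed.

(* Three unit vectors whose consecutive angles are equal: the outer pair makes
   at most the double angle. *)
Lemma double_angle_le f g h (c V : R) : sqint f -> sqint g -> sqint h -> 0 <= c ->
  \int[P]_x (f x ^+ 2) = V -> \int[P]_x (g x ^+ 2) = V -> \int[P]_x (h x ^+ 2) = V ->
  \int[P]_x (f x * g x) = \int[P]_x (g x * h x) ->
  \int[P]_x (f x * h x) <= (2 * c ^+ 2 - 1) * V ->
  \int[P]_x (f x * g x) <= c * V.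
Proof.
move=> sf sg sh c0 fV gV hV fggh fh.
set r := \int[P]_x (f x * g x).
have V0 : 0 <= V by rewrite -fV; apply: Rintegral_ge0 => x _; exact: sqr_ge0.
have sfh := sqint_lin 1 1 sf sh.
have key k : 0 <= 2 * V + 2 * \int[P]_x (f x * h x) + k ^+ 2 * V - 4 * k * r.
  apply: (@le_trans _ _ (\int[P]_x ((1 * (1 * f x + 1 * h x) + (- k) * g x) ^+ 2))).
    by apply: Rintegral_ge0 => x _; exact: sqr_ge0.
  rewrite (Rintegral_sqr_lin _ _ sfh sg) (Rintegral_sqr_lin _ _ sf sh).
  rewrite (Rintegral_mul_linl _ _ sf sh sg) fV gV hV -/r.
  rewrite (_ : \int[P]_x (h x * g x) = r); last first.
    by rewrite /r fggh; apply: eq_Rintegral => x _; rewrite mulrC.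
  by rewrite le_eqVlt; apply/orP; left; apply/eqP; ring.
have [V00|Vn0] := eqVneq V 0.
  have := key 1; have := key (-1); rewrite V00 in fh *; move: fh; nra.
have Vp : 0 < V by rewrite lt_def Vn0.
rewrite leNgt; apply/negP => rc.
(* This k minimises the quadratic in [key]; the minimum being nonnegative means r ^ 2 <= c ^ 2 V ^
   2. *)
have := key (2 * (r / V)); have rV : r / V * V = r by rewrite divfK.
have : c < r / V by rewrite ltr_pdivlMr.
set u := r / V in rV *; rewrite -rV => cu.
nra.
Qed.

End square_integrable.

(** * The Gaussian Poincare inequality *)

Section dyadic_angles.
Context {R : realType}.

(* Cosine and sine of the angle [pi / 2 ^ m.+1]. *)
Fixpoint dyadic_cs (m : nat) : R * R :=
  if m is m'.+1 then
    let: (c, s) := dyadic_cs m' in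
    let c' := Num.sqrt ((1 + c) / 2) in (c', s / (2 * c'))
  else (0, 1).

Lemma dyadic_csP m : let: (c, s) := dyadic_cs m in
  [/\ 0 <= c, 0 < s & c ^+ 2 + s ^+ 2 = 1].
Proof.
elim: m => [|m] /=; first by split=> //; rewrite ?expr0n ?expr1n ?add0r.
case: (dyadic_cs m) => c s [c0 s0 cs1].
have h0 : 0 < (1 + c) / 2 by lra.
have c'0 : 0 < Num.sqrt ((1 + c) / 2) by rewrite sqrtr_gt0.
have c'2 : Num.sqrt ((1 + c) / 2) ^+ 2 = (1 + c) / 2 by rewrite sqr_sqrtr// ltW.
split; [exact: ltW|by rewrite divr_gt0// mulr_gt0|].
rewrite expr_div_n exprMn c'2 (_ : s ^+ 2 = (1 - c) * (1 + c)); last by lra.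
by field; lra.
Qed.

(** The last bound is s' ^ 2 = (1 - c) / 2 against s ^ 2 = (1 - c) (1 + c), with c >= 0. It drives
    the sines to 0 geometrically. *)
Lemma dyadic_csS m : let: (c, s) := dyadic_cs m in let: (c', s') := dyadic_cs m.+1 in
  [/\ 0 < c', c = c' ^+ 2 - s' ^+ 2, s = 2 * (c' * s') & s' ^+ 2 <= s ^+ 2 / 2].
Proof.
have := dyadic_csP m; have := dyadic_csP m.+1 => /=.
case: (dyadic_cs m) => c s [_ _ cs'1] [c0 s0 cs1].
have h0 : 0 < (1 + c) / 2 by lra.
have c'0 : 0 < Num.sqrt ((1 + c) / 2) by rewrite sqrtr_gt0.
have c'2 : Num.sqrt ((1 + c) / 2) ^+ 2 = (1 + c) / 2 by rewrite sqr_sqrtr// ltW.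
have s'2 : (s / (2 * Num.sqrt ((1 + c) / 2))) ^+ 2 = (1 - c) / 2 by lra.
split => //; first by rewrite c'2 s'2; lra.
  by field; rewrite gt_eqF.
have c1 : 0 <= 1 - c by nra.
have := mulr_ge0 c0 c1; rewrite s'2 (_ : s ^+ 2 = (1 - c) * (1 + c)); lra.
Qed.

Lemma dyadic_sin_le m : (dyadic_cs m).2 ^+ 2 <= 2^-1 ^+ m.
Proof.
elim: m => [|m IH]; first by rewrite /= expr1n expr0.
have := dyadic_csS m; case: (dyadic_cs m) IH => c s IH.
case: (dyadic_cs m.+1) => c' s' [_ _ _ h]; rewrite [leRHS]exprS; move: IH => /=; move: (_ ^+ m) => p; lra.
Qed.

End dyadic_angles.

(** * Correlation and gradient bounds for two independent Gaussian vectors *)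

Section gaussian_pair.
Context {R : realType} (n : nat).
Local Notation G := (@normalV R n).
Local Notation G2 := (pprod G G).
Local Notation V := (borel_rV R n).

Lemma integral_rotVV (c s : R) (f : V * V -> \bar R) :
  c ^+ 2 + s ^+ 2 = 1 -> 0 < c -> measurable_fun setT f ->
  (\int[G2]_z f (rotVV c s z) = \int[G2]_z f z)%E.
Proof.
move=> cs c0 mf; rewrite integralE [RHS]integralE; congr (_ - _)%E.
- rewrite -(ge0_integral_normalV_rot cs c0 (measurable_funepos mf))//; apply: eq_integral => z _; exact: (congr1 (@^~ z) (funepos_comp f (rotVV c s))).
- rewrite -(ge0_integral_normalV_rot cs c0 (measurable_funeneg mf))//; apply: eq_integral => z _; exact: (congr1 (@^~ z) (funeneg_comp f (rotVV c s))).
Qed.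

Lemma Rintegral_rotVV (c s : R) (f : V * V -> R) :
  c ^+ 2 + s ^+ 2 = 1 -> 0 < c -> measurable_fun setT f ->
  \int[G2]_z f (rotVV c s z) = \int[G2]_z f z.
Proof.
move=> cs c0 mf; rewrite /Rintegral; congr fine.
by apply: (integral_rotVV (f := EFin \o f)) => //; exact/measurable_EFinP.
Qed.

Lemma sqint_rotVV (c s : R) (f : V * V -> R) :
  c ^+ 2 + s ^+ 2 = 1 -> 0 < c -> sqint G2 f -> sqint G2 (f \o rotVV c s).
Proof.
move=> cs c0 [mf f2]; have mfr := measurableT_comp mf (@measurable_rotVV R n c s).
split => //; move/integrableP: f2 => [m2 f2]; apply/integrableP; split.
  by apply/measurable_EFinP; exact: measurable_funX.
rewrite (integral_rotVV (f := fun z => `|(f z ^+ 2)%:E|%E))//.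
exact: measurableT_comp.
Qed.

Lemma integral_fst (f : V -> \bar R) : measurable_fun setT f -> (forall x, 0 <= f x)%E ->
  (\int[G2]_z f z.1 = \int[G]_x f x)%E.
Proof.
move=> mf f0; have mff : measurable_fun setT (fun z : V * V => f z.1).
  exact: (measurableT_comp mf measurable_fst).
rewrite (ge0_pprod1 _ _ mff (fun=> f0 _)).
by apply: eq_integral => x _ /=; rewrite probability_integral_cst.
Qed.

Lemma sqint_fst (F : V -> R) : sqint G F -> sqint G2 (F \o fst).
Proof.
move=> [mF F2]; split; first exact: (measurableT_comp mF measurable_fst).
move/integrableP: F2 => [m2 F2]; apply/integrableP; split.
  exact: (measurableT_comp m2 measurable_fst).
rewrite (integral_fst (f := fun x => `|(F x ^+ 2)%:E|%E))//.
exact: measurableT_comp.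
Qed.

Lemma Rintegral_sqr_fst (F : V -> R) : measurable_fun setT F ->
  \int[G2]_z (F z.1 ^+ 2) = \int[G]_x (F x ^+ 2).
Proof.
move=> mF; rewrite /Rintegral; congr fine.
apply: (integral_fst (f := fun x => (F x ^+ 2)%:E)).
  by apply/measurable_EFinP; exact: measurable_funX.
by move=> x; rewrite lee_fin sqr_ge0.
Qed.

Section mean_zero.
Variable F : V -> R.
Hypotheses (sF : sqint G F) (F0 : (\int[G]_x (F x)%:E = 0)%E).
Local Notation v := (\int[G]_x (F x ^+ 2)).

Lemma Rintegral_independent : \int[G2]_z (F z.1 * F z.2) = 0.
Proof.
have mF2 : measurable_fun setT (F \o snd : V * V -> R).
  exact: (measurableT_comp sF.1 measurable_snd).
have c0 : (1 : R) ^+ 2 + 0 ^+ 2 = 1 by rewrite expr1n expr0n addr0.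
have sF1 := sqint_fst sF.
have sF2 : sqint G2 (F \o snd).
  split => //; apply/integrableP; split.
    by apply/measurable_EFinP; exact: measurable_funX.
  move/integrableP: sF.2 => [m2 h]; apply: le_lt_trans h.
  rewrite (ge0_pprod2 G G (f := fun z => `|(F z.2 ^+ 2)%:E|%E))//; last first.
    apply: measurableT_comp => //; apply/measurable_EFinP.
    exact: measurable_funX.
  rewrite le_eqVlt; apply/orP; left; apply/eqP; apply: eq_integral => y _ /=.
  by rewrite probability_integral_cst.
have i12 := sqint_mul sF1 sF2.
rewrite /Rintegral (_ : integral _ _ _ = 0%E)//.
rewrite -(integral12_prod_meas1 (m1 := G) (m2 := G) i12) /fubini_F.
apply: integral0_eq => x _ /=.
under eq_integral do rewrite EFinM.
rewrite integralZl//; first by rewrite F0 mule0.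
have [mF F2] := sF.
apply: (@le_integrable _ _ _ G _ _ _ (fun x => 1 + (F x ^+ 2)%:E)%E) => //.
- exact/measurable_EFinP.
- move=> y _ /=; rewrite lee_fin [leRHS]ger0_norm ?addr_ge0 ?sqr_ge0//.
  rewrite ler_norml; apply/andP; split; nra.
- apply: integrableD => //; exact: finite_measure_integrable_cst.
Qed.

(* The Ornstein-Uhlenbeck contraction E F(X) F(c X + s Y) <= c E F(X)^2, by
   halving the angle: at a right angle the two factors are independent. *)
Lemma mehler_bound m : let: (c, s) := dyadic_cs m in
  \int[G2]_z (F z.1 * F (c *: z.1 + s *: z.2)) <= c * v.
Proof.
elim: m => [|m IH].
  rewrite /= mul0r (_ : \int[G2]_z _ = 0)// -[RHS]Rintegral_independent.
  by apply: eq_Rintegral => z _; rewrite scale0r scale1r add0r.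
have := @dyadic_csS R m; have := @dyadic_csP R m.+1.
case: (dyadic_cs m) IH => c s IH; case: (dyadic_cs m.+1) => c' s'.
move=> [_ _ cs'1] [c'0 cE sE _].
pose f (z : V * V) := F z.1.
have sf : sqint G2 f := sqint_fst sF.
(* F (X) and its rotations by once and twice the halved angle have equal second moments and equal
   consecutive correlations. The outer correlation is the one at the full angle, controlled by
   [IH]. *)
have sg := sqint_rotVV cs'1 c'0 sf.
have sh := sqint_rotVV cs'1 c'0 sg.
have mf := sf.1; have mg := sg.1; have mh := sh.1.
have fv : \int[G2]_z (f z ^+ 2) = v by exact: (Rintegral_sqr_fst sF.1).
have gv : \int[G2]_z ((f \o rotVV c' s') z ^+ 2) = v.
  rewrite -fv (Rintegral_rotVV (f := fun z => f z ^+ 2))//.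
  exact: measurable_funX.
have hv : \int[G2]_z ((f \o rotVV c' s' \o rotVV c' s') z ^+ 2) = v.
  rewrite -gv (Rintegral_rotVV (f := fun z => (f \o rotVV c' s') z ^+ 2))//.
  exact: measurable_funX.
apply: (double_angle_le sf sg sh (ltW c'0) fv gv hv).
  by rewrite -(Rintegral_rotVV cs'1 c'0)//; exact: measurable_funM.
rewrite (_ : 2 * c' ^+ 2 - 1 = c); last by lra.
apply: le_trans IH; rewrite le_eqVlt; apply/orP; left; apply/eqP.
apply: eq_Rintegral => z _; rewrite /f /=; congr (_ * F _).
by apply/rowP => i; rewrite !mxE cE sE; ring.
Qed.

(** The subtracted term is c F (X) and not F (X), because c is the extremal correlation in
    [mehler_bound]. Index 0 is the right angle, where c = 0 and [rotVV] invariance does not apply,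
    hence the successors below. *)
Definition difference_quotient m (z : V * V) : R :=
  let: (c, s) := dyadic_cs m in
  s^-1 * F (c *: z.1 + s *: z.2) + - (c / s) * F z.1.

Lemma sqint_difference_quotient m : sqint G2 (difference_quotient m.+1).
Proof.
rewrite /difference_quotient.
have := @dyadic_csS R m; have := @dyadic_csP R m.+1.
case: (dyadic_cs m.+1) => c s [c0 s0 cs1]; case: (dyadic_cs m) => c1 s1 [cp _ _ _].
have sf := sqint_fst sF; exact: (sqint_lin _ _ (sqint_rotVV cs1 cp sf) sf).
Qed.

(** With r the correlation, expanding the square gives v + 2 c (c v - r) / s ^ 2, and [mehler_bound]
    says r <= c v. *)
Lemma gaussian_difference_bound m :
  v <= \int[G2]_z (difference_quotient m.+1 z ^+ 2).
Proof.
rewrite /difference_quotient; have := mehler_bound m.+1.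
have := @dyadic_csS R m; have := @dyadic_csP R m.+1.
case: (dyadic_cs m.+1) => c s [c0 s0 cs1]; case: (dyadic_cs m) => c1 s1 [cp _ _ _] h.
pose f (z : V * V) := F z.1.
have sf : sqint G2 f := sqint_fst sF.
have sg := sqint_rotVV cs1 cp sf.
have fv : \int[G2]_z (f z ^+ 2) = v by exact: (Rintegral_sqr_fst sF.1).
have gv : \int[G2]_z ((f \o rotVV c s) z ^+ 2) = v.
  rewrite -fv (Rintegral_rotVV (f := fun z => f z ^+ 2))//.
  by apply: measurable_funX; exact: sf.1.
have := Rintegral_sqr_lin (s^-1) (- (c / s)) sg sf; rewrite fv gv /f /= => ->.
set r := \int[G2]_z _; have rv : r <= c * v.
  apply: le_trans h; rewrite le_eqVlt; apply/orP; left; apply/eqP.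
  by apply: eq_Rintegral => z _; rewrite mulrC.
have -> : s^-1 ^+ 2 * v + 2 / s * - (c / s) * r + (- (c / s)) ^+ 2 * v =
    (v * s ^+ 2 + 2 * c * (c * v - r)) / s ^+ 2.
  rewrite (_ : s ^+ 2 = 1 - c ^+ 2) in |- *; last by lra.
  have -> : s^-1 ^+ 2 = (1 - c ^+ 2)^-1 by rewrite exprVn; congr (_^-1); lra.
  have -> : 2 / s * - (c / s) = - (2 * c) * (1 - c ^+ 2)^-1.
    by rewrite (_ : (1 - c ^+ 2)^-1 = s^-1 ^+ 2); [ring|rewrite exprVn; congr (_^-1); lra].
  have -> : (- (c / s)) ^+ 2 = c ^+ 2 * (1 - c ^+ 2)^-1.
    by rewrite (_ : (1 - c ^+ 2)^-1 = s^-1 ^+ 2); [ring|rewrite exprVn; congr (_^-1); lra].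
  by ring.
rewrite ler_pdivlMr ?exprn_gt0// lerDl mulr_ge0//; lra.
Qed.

(** The bound holds at every dyadic angle with the same left side, so dominated convergence carries
    it to the limiting derivative. *)
Lemma gaussian_derivative_bound (D H : V * V -> R) :
  measurable_fun setT D -> G2.-integrable setT (EFin \o H) ->
  (forall m z, difference_quotient m.+1 z ^+ 2 <= H z) ->
  {ae G2, forall z, difference_quotient m.+1 z @[m --> \oo] --> D z} ->
  (\int[G]_x (F x ^+ 2)%:E <= \int[G2]_z (D z ^+ 2)%:E)%E.
Proof.
move=> mD iH qH qD.
have mq m : measurable_fun setT (fun z : V * V => (difference_quotient m.+1 z ^+ 2)%:E).
  by apply/measurable_EFinP; apply: measurable_funX; exact: (sqint_difference_quotient m).1.
have mD2 : measurable_fun setT (fun z : V * V => (D z ^+ 2)%:E).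
  by apply/measurable_EFinP; exact: measurable_funX.
have [_ _ cv] := @dominated_convergence _ _ _ G2 setT measurableT
  (fun m z => (difference_quotient m.+1 z ^+ 2)%:E) (fun z => (D z ^+ 2)%:E) (EFin \o H)
  mq mD2 (ltac:(
    apply: filterS qD => z h _; apply/cvg_EFin; [exact: nearW|exact: (cvgM h h)]))
  iH (ltac:(apply: nearW => z m _ /=; rewrite lee_fin ger0_norm ?sqr_ge0//)).
rewrite -(cvg_lim _ cv)//.
apply: lime_ge; first by apply/cvg_ex; eexists; exact: cv.
apply: nearW => m /=.
have fin1 : (\int[G]_x (F x ^+ 2)%:E)%E \is a fin_num by apply: integrable_fin_num => //; exact: sF.2.
have fin2 : (\int[G2]_z (difference_quotient m.+1 z ^+ 2)%:E)%E \is a fin_num.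
  by apply: integrable_fin_num => //; exact: (sqint_difference_quotient m).2.
rewrite -(fineK fin1) -(fineK fin2) lee_fin; exact: gaussian_difference_bound.
Qed.

Lemma gaussian_gradient_bound (b : V -> V) (H : V * V -> R) :
  measurable_fun setT b -> G2.-integrable setT (EFin \o H) ->
  (forall m z, difference_quotient m.+1 z ^+ 2 <= H z) ->
  {ae G2, forall z, difference_quotient m.+1 z @[m --> \oo] --> dotV (b z.1) z.2} ->
  (\int[G]_x (F x ^+ 2)%:E <= \int[G]_x (dotV (b x) (b x))%:E)%E.
Proof.
move=> mb iH qH qD.
have mD : measurable_fun setT (fun z : V * V => dotV (b z.1) z.2).
  by apply: measurable_dotV; [exact: (measurableT_comp mb measurable_fst)|exact: measurable_snd].
apply: (le_trans (gaussian_derivative_bound mD iH qH qD)).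
have mD2 : measurable_fun setT (fun z : V * V => (dotV (b z.1) z.2 ^+ 2)%:E).
  by apply/measurable_EFinP; exact: measurable_funX.
rewrite (ge0_pprod1 _ _ mD2); last by move=> z; rewrite lee_fin sqr_ge0.
apply: ge0_le_integral => //.
- by move=> x _; apply: integral_ge0 => y _; rewrite lee_fin sqr_ge0.
- apply: (measurable_pprod1 _ mD2) => z; rewrite lee_fin sqr_ge0//.
- by apply/measurable_EFinP; exact: measurable_dotV.
- by move=> x _ /=; exact: normalV_dotV_sqr.
Qed.

End mean_zero.

End gaussian_pair.

(** * Homogeneous functions of a Gaussian vector *)

Section normalV_homogeneous.
Context {R : realType} (n : nat).
Local Notation G := (@normalV R n).
Local Notation V := (borel_rV R n).

Lemma measurable_sqnorm : measurable_fun setT (fun x : V => dotV x x).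
Proof. exact: measurable_dotV. Qed.

(** A substitute for polar coordinates; equality holds in truth, as |X| ^ 2 has mean n and is
    independent of the direction. A dilation by t leaves [psi] unchanged, so comparing the two sides
    of [ge0_integral_normalV_scale] as t decreases to 1 compares t ^ n - 1 with the exponent. *)
Lemma homogeneous0_sqnorm_ge (psi : V -> R) (M : R) :
  measurable_fun setT psi -> (forall x, 0 <= psi x <= M) ->
  (forall t x, 0 < t -> psi (t *: x) = psi x) ->
  (n%:R%:E * \int[G]_x (psi x)%:E <= \int[G]_x (psi x * dotV x x)%:E)%E.
Proof.
move=> mpsi psiM psih.
have psi0 x : 0 <= psi x by case/andP: (psiM x).
have mpsi' : measurable_fun setT (fun x : V => (psi x)%:E) by exact/measurable_EFinP.
have mB : measurable_fun setT (fun x : V => (psi x * dotV x x)%:E).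
  by apply/measurable_EFinP; apply: measurable_funM => //; exact: measurable_sqnorm.
set A := (\int[G]_x (psi x)%:E)%E; set B := (\int[G]_x (psi x * dotV x x)%:E)%E.
have A0 : (0 <= A)%E by apply: integral_ge0 => x _; rewrite lee_fin.
have B0 : (0 <= B)%E.
  by apply: integral_ge0 => x _; rewrite lee_fin mulr_ge0// dotV_ge0.
have Afin : A \is a fin_num.
  rewrite ge0_fin_numE//; apply: (@le_lt_trans _ _ (\int[G]_x M%:E)%E).
    apply: ge0_le_integral => // x _; rewrite lee_fin//.
    by case/andP: (psiM x).
  by rewrite probability_integral_cst ltry.
have [Boo|Bfin] := eqVneq B +oo%E; first by rewrite Boo leey.
have {}Bfin : B \is a fin_num by rewrite ge0_fin_numE// ltey.
have key (dl : R) : 0 < dl ->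
    n%:R * fine A <= (1 + dl) ^+ n * (1 + dl / 2) * fine B.
  move=> dl0; pose t := 1 + dl; pose k := (t ^+ 2 - 1) / 2.
  have t0 : 0 < t by rewrite addr_gt0.
  have k0 : 0 <= k by rewrite /k /t; nra.
  have me : measurable_fun setT (fun x : V => (psi x * expR (- k * dotV x x))%:E).
    apply/measurable_EFinP; apply: measurable_funM => //.
    by apply: measurableT_comp => //; apply: measurable_funM => //; exact: measurable_sqnorm.
  set C := (\int[G]_x (psi x * expR (- k * dotV x x))%:E)%E.
  have AC : (A = (t ^+ n)%:E * C)%E.
    rewrite /A (ge0_integral_normalV_scale t0 mpsi')//.
    congr (_ * _)%E; apply: eq_integral => x _; rewrite psih// -EFinM.
    by rewrite /k; congr (_ * expR _)%:E; ring.
  have tn0 : 0 < t ^+ n by rewrite exprn_gt0.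
  have C0 : (0 <= C)%E by apply: integral_ge0 => x _; rewrite lee_fin mulr_ge0// expR_ge0.
  (* This is exp (- u) >= 1 - u under the integral. Together with A = t ^ n C and Bernoulli's
     inequality it gives [key] after division by dl. *)
  have ACB : (A <= C + k%:E * B)%E.
    rewrite /B -ge0_integralZl//; last by move=> x _; rewrite lee_fin mulr_ge0// dotV_ge0.
    rewrite -ge0_integralD//; last 3 first.
    - by move=> x _; rewrite lee_fin mulr_ge0// expR_ge0.
    - by move=> x _; rewrite mule_ge0// lee_fin// mulr_ge0// dotV_ge0.
    - exact: emeasurable_funM.
    apply: ge0_le_integral => //.
    - by move=> x _; rewrite lee_fin.
    - by apply: emeasurable_funD => //; exact: emeasurable_funM.
    move=> x _; rewrite -EFinM -EFinD lee_fin.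
    have := expR_ge1Dx (- k * dotV x x); have := psi0 x; nra.
  have Cfin : C \is a fin_num.
    rewrite ge0_fin_numE// ltNge leye_eq; apply/negP => /eqP Coo.
    by move: Afin; rewrite AC Coo gt0_muley ?lte_fin.
  move: ACB AC; rewrite -(fineK Afin) -(fineK Bfin) -(fineK Cfin).
  rewrite -!EFinM -EFinD lee_fin => ACB [] AC.
  have a0 : 0 <= fine A by rewrite fine_ge0.
  have bern : 1 + dl *+ n <= t ^+ n.
    rewrite /t; elim: (n) => [|m IH]; first by rewrite mulr0n addr0 expr0.
    rewrite exprS mulrSr.
    have := ler_wpM2l (ltW t0) IH; have : 0 <= dl *+ m by rewrite mulrn_wge0// ltW.
    rewrite /t; nra.
  have h : t ^+ n * fine A <= fine A + t ^+ n * k * fine B.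
    by have := ler_wpM2l (ltW tn0) ACB; rewrite mulrDr -AC mulrA.
  have h2 : dl * (n%:R * fine A) <= dl * (t ^+ n * (1 + dl / 2) * fine B).
    have -> : dl * (t ^+ n * (1 + dl / 2) * fine B) = t ^+ n * k * fine B.
      by rewrite /k /t; field.
    apply: (@le_trans _ _ (t ^+ n * fine A - fine A)); last by lra.
    have -> : dl * (n%:R * fine A) = (dl *+ n) * fine A by rewrite -mulr_natr; ring.
    have := ler_wpM2r a0 bern; lra.
  by rewrite -(ler_pM2l dl0).
rewrite -(fineK Afin) -(fineK Bfin) -EFinM lee_fin.
have cv : (fun m => (1 + harmonic m) ^+ n * (1 + harmonic m / 2) * fine B) @ \oo -->
    (1 + 0) ^+ n * (1 + 0 / 2) * fine B.
  apply: cvgM; last exact: cvg_cst.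
  have ch : (@harmonic R) @ \oo --> 0 by exact: cvg_harmonic.
  apply: cvgM.
    have c1 : (fun m => 1 + @harmonic R m) @ \oo --> (1 + 0 : R).
      by apply: cvgD => //; exact: cvg_cst.
    exact: (continuous_cvg _ (@exprn_continuous R n (1 + 0)) c1).
  apply: cvgD; first exact: cvg_cst.
  by apply: cvgM => //; exact: cvg_cst.
have -> : fine B = (1 + 0) ^+ n * (1 + 0 / 2) * fine B by rewrite mul0r !addr0 expr1n !mul1r.
rewrite -(cvg_lim _ cv)//; apply: limr_ge; first by apply/cvg_ex; eexists; exact: cv.
by apply: nearW => m; apply: key; rewrite harmonic_gt0.
Qed.

Lemma measurable_set1_rV (x : 'rV[R]_n) : measurable ([set x] : set V).
Proof.
rewrite -[X in measurable X]setCK; apply: measurableC; apply: sub_sigma_algebra.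
by apply/closed_openC; apply: accessible_closed_set1; apply: hausdorff_accessible; exact: (@norm_hausdorff R 'rV[R]_n).
Qed.

(** The indicator of the origin is 0-homogeneous and vanishes when multiplied by |x| ^ 2, so n times
    its integral is at most 0. *)
Lemma normalV_set0 : (0 < n)%N -> G [set 0] = 0%E.
Proof.
move=> n0; have m0 := measurable_set1_rV 0.
have := @homogeneous0_sqnorm_ge (\1_[set (0 : V)]) 1 _ _ _.
have -> : (\int[G]_x (\1_[set (0 : V)] x * dotV x x)%:E = 0)%E.
  apply: integral0_eq => x _; rewrite indicE; case: (boolP (x \in _)) => [|_].
    by rewrite inE => ->; rewrite dotV0r mulr0.
  by rewrite mul0r.
rewrite integral_indic// setIT => /(_ _ _ _) h; apply/eqP.
rewrite eq_le measure_ge0 andbT -(@lee_pmul2l _ n%:R%:E)//.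
  rewrite mule0; apply: h.
  - exact: measurable_indic.
  - by move=> x; rewrite indicE ler0n lern1 leq_b1.
  - move=> t x t0; rewrite !indicE; congr ((nat_of_bool _)%:R).
    apply/idP/idP; rewrite !inE /=; last by move=> ->; rewrite scaler0.
    by move=> /eqP; rewrite scaler_eq0 gt_eqF//= => /eqP.
by rewrite lte_fin ltr0n.
Qed.

Lemma integrable_sqnorm : G.-integrable setT (fun x => (dotV x x)%:E).
Proof.
apply/integrableP; split; first by apply/measurable_EFinP; exact: measurable_sqnorm.
under eq_integral do rewrite gee0_abs ?lee_fin ?dotV_ge0//.
have -> : (\int[G]_x (dotV x x)%:E =
    \sum_(i < n) \int[G]_x (dotV (delta_mx ord0 i) x ^+ 2)%:E)%E.
  rewrite -ge0_integral_sum//.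
  - apply: eq_integral => x _; rewrite sumEFin; congr EFin; apply: eq_bigr => i _.
    rewrite expr2; congr (_ * _); rewrite /dotV (bigD1 i)//= mxE !eqxx mul1r big1 ?addr0//;
    by move=> j ji; rewrite mxE (negbTE ji) andbF mul0r.
  - by move=> i; apply/measurable_EFinP; apply: measurable_funX; exact: measurable_dotV.
  - by move=> i x _; rewrite lee_fin sqr_ge0.
apply: lte_sum_pinfty => i _; apply: le_lt_trans (normalV_dotV_sqr _) _.
exact: ltry.
Qed.

End normalV_homogeneous.

(** * Convex functions and Moreau envelopes *)

Section enorm.
Context {R : realType} {n : nat}.
Implicit Types x y : 'rV[R]_n.

Lemma le_of_sqr (a b : R) : 0 <= b -> a ^+ 2 <= b ^+ 2 -> a <= b.
Proof. by move=> b0 ab; rewrite leNgt; apply/negP => h; nra. Qed.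

Lemma enormE x : enorm x = Num.sqrt (dotV x x).
Proof. by rewrite /enorm /dotV; congr Num.sqrt; apply: eq_bigr => i _; rewrite expr2. Qed.

Lemma enorm_ge0 x : 0 <= enorm x.
Proof. by rewrite enormE sqrtr_ge0. Qed.

Lemma enorm_sqr x : enorm x ^+ 2 = dotV x x.
Proof. by rewrite enormE sqr_sqrtr// dotV_ge0. Qed.

Lemma enorm0 : enorm (0 : 'rV[R]_n) = 0.
Proof. by rewrite enormE dotV0r sqrtr0. Qed.

Lemma enorm_eq0 x : (enorm x == 0) = (x == 0).
Proof. by rewrite -sqrf_eq0 enorm_sqr dotV_eq0. Qed.

Lemma enorm_gt0 x : (0 < enorm x) = (x != 0).
Proof. by rewrite lt_def enorm_ge0 andbT enorm_eq0. Qed.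

Lemma enormZ k x : enorm (k *: x) = `|k| * enorm x.
Proof. by rewrite !enormE dotVZl dotVZr mulrA -expr2 sqrtrM ?sqr_ge0// sqrtr_sqr. Qed.

Lemma enormN x : enorm (- x) = enorm x.
Proof. by rewrite -scaleN1r enormZ normrN1 mul1r. Qed.

Lemma enormB x y : enorm (x - y) = enorm (y - x).
Proof. by rewrite -enormN opprB. Qed.

Lemma dotV_le_enorm x y : dotV x y <= enorm x * enorm y.
Proof.
apply: le_of_sqr; first by rewrite mulr_ge0 ?enorm_ge0.
by rewrite exprMn !enorm_sqr cauchy_schwarz_dotV.
Qed.

Lemma normr_dotV_le_enorm x y : `|dotV x y| <= enorm x * enorm y.
Proof.
rewrite ler_norml lerNl -dotVNl; apply/andP; split; last exact: dotV_le_enorm.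
by rewrite -(enormN x) dotV_le_enorm.
Qed.

Lemma enormD x y : enorm (x + y) <= enorm x + enorm y.
Proof.
apply: le_of_sqr; first by rewrite addr_ge0 ?enorm_ge0.
rewrite enorm_sqr dotVDl !dotVDr (dotVC y x) sqrrD !enorm_sqr.
have := dotV_le_enorm x y; lra.
Qed.

Lemma coord_le_enorm x i : `|x ord0 i| <= enorm x.
Proof.
apply: le_of_sqr; first exact: enorm_ge0.
rewrite enorm_sqr real_normK ?num_real// /dotV (bigD1 i)//= -expr2 lerDl.
by apply: sumr_ge0 => j _; rewrite -expr2 sqr_ge0.
Qed.

Lemma enorm_le_norm x : enorm x <= n%:R * `|x|.
Proof.
have cn i : `|x ord0 i| <= `|x|.
  by rewrite [leRHS]/Num.norm/= mx_normrE; apply/bigmax_geP; right; exists (ord0, i).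
apply: le_of_sqr; first by rewrite mulr_ge0.
rewrite enorm_sqr /dotV; apply: (@le_trans _ _ (\sum_(i < n) `|x| ^+ 2)).
  apply: ler_sum => i _; rewrite -expr2 -(real_normK (num_real (x ord0 i))).
  by rewrite ler_sqr ?nnegrE.
rewrite sumr_const card_ord -[leLHS]mulr_natl exprMn ler_wpM2r ?sqr_ge0//.
by rewrite -natrX ler_nat; case: (n) => // m; rewrite -mulnn leq_pmull.
Qed.

Lemma norm_le_enorm x : `|x| <= enorm x.
Proof.
rewrite [leLHS]/Num.norm/= mx_normrE; apply/bigmax_leP; split; first exact: enorm_ge0.
by move=> [i j] _ /=; rewrite ord1; exact: coord_le_enorm.
Qed.

End enorm.

(** * Local boundedness and Lipschitz continuity of convex functions *)

Section convex.
Context {R : realType} {n : nat}.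
Variable f : 'rV[R]_n -> R.
Hypothesis cf : convex_function (E := 'rV[R]_n) setT f.

Lemma convexE (t : R) x y : 0 <= t -> t <= 1 ->
  f (t *: x + (1 - t) *: y) <= t * f x + (1 - t) * f y.
Proof.
move=> t0 t1; have t01 : Itv.spec (@Itv.num_sem R) (Itv.Real `[0%Z, 1%Z]) t.
  by apply/and3P; split; rewrite ?num_real//= bnd_simp.
exact: (cf (Itv.mk t01) (in_setT x) (in_setT y)).
Qed.

Lemma convex_mid x y : f (x + y) <= 2^-1 * f (2 *: x) + 2^-1 * f (2 *: y).
Proof.
have := @convexE 2^-1 (2 *: x) (2 *: y) (ltac:(lra)) (ltac:(lra)).
by rewrite (_ : 1 - 2^-1 = 2^-1 :> R); [rewrite !scalerA mulVf// !scale1r|lra].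
Qed.

(** Induction on the number k of leading coordinates allowed to be nonzero: x is the midpoint of 2
    u, which has one such coordinate fewer, and of twice its own k-th component. The bound on the
    coordinates doubles at each stage. *)
Lemma convex_ub (r : R) : 0 <= r -> exists M, forall x, enorm x <= r -> f x <= M.
Proof.
move=> r0.
have ub k : forall r, 0 <= r -> exists M, forall x : 'rV[R]_n,
    (forall i : 'I_n, (k <= i)%N -> x ord0 i = 0) -> (forall i, `|x ord0 i| <= r) -> f x <= M.
  elim: k => [|k IH] s s0.
    by exists (f 0) => x x0 _; rewrite (_ : x = 0)//; apply/rowP => i; rewrite mxE x0.
  have [M HM] := IH (2 * s) (mulr_ge0 (ler0n _ 2) s0).
  have [kn|nk] := ltnP k n; last first.
    exists M => x _ xs; apply: HM => [i ki|i]; last by apply: (le_trans (xs i)); lra.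
    by have := leq_trans (leq_trans (ltn_ord i) nk) ki; rewrite ltnn.
  pose e : 'rV[R]_n := delta_mx ord0 (Ordinal kn).
  exists (2^-1 * M + 2^-1 * Num.max (f ((2 * s) *: e)) (f (- (2 * s) *: e))) => x x0 xs.
  pose u : 'rV[R]_n := \row_i (if i == Ordinal kn then 0 else x ord0 i).
  pose xk := x ord0 (Ordinal kn).
  have xE : x = u + xk *: e.
    apply/rowP => i; rewrite !mxE eqxx /=; case: eqP => [->|_].
      by rewrite add0r mulr1.
    by rewrite mulr0 addr0.
  rewrite [in leLHS]xE; apply: (le_trans (convex_mid _ _)).
  apply: lerD; apply: ler_wpM2l; rewrite ?invr_ge0//.
    apply: HM => i; rewrite !mxE; case: eqP => [_|ik].
    - by rewrite mulr0.
    - move=> ki; rewrite x0 ?mulr0// ltn_neqAle ki andbT; apply/eqP => kE.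
      by apply: ik; apply/val_inj.
    - by rewrite mulr0 normr0; lra.
    - by rewrite normrM ger0_norm// ler_wpM2l.
  have := xs (Ordinal kn); rewrite -/xk ler_norml => /andP[xl xu].
  have [s00|sn0] := eqVneq s 0.
    by rewrite (_ : xk = 0) ?s00 ?mulr0 ?scale0r ?scaler0 ?le_max ?lexx//; lra.
  have sp : 0 < s by rewrite lt_def sn0.
  pose t := (xk + s) / (2 * s).
  have t0 : 0 <= t by rewrite divr_ge0//; lra.
  have t1 : t <= 1 by rewrite ler_pdivrMr; lra.
  rewrite (_ : 2 *: (xk *: e) = t *: ((2 * s) *: e) + (1 - t) *: (- (2 * s) *: e)); last first.
    by rewrite !scalerA -scalerDl; congr (_ *: _); rewrite /t; field.
  apply: (le_trans (convexE _ _ t0 t1)).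
  set a := f _; set b := f _.
  have : a <= Num.max a b by rewrite le_max lexx.
  have : b <= Num.max a b by rewrite le_max lexx orbT.
  move: (Num.max a b) => m; nra.
have [M HM] := ub n r r0; exists M => x xr; apply: HM => [i|i].
  by rewrite leqNgt ltn_ord.
exact: le_trans (coord_le_enorm _ _) xr.
Qed.

(** The lower bound is the upper one reflected: f 0 is at most the mean of f x and f (- x). *)
Lemma convex_bounded (r : R) : 0 <= r ->
  exists2 M, 0 <= M & forall x, enorm x <= r -> `|f x| <= M.
Proof.
move=> r0; have [M HM] := convex_ub r0.
exists (`|M| + 2 * `|f 0|) => [|x xr]; first by rewrite addr_ge0// mulr_ge0.
have := HM x xr; have := HM (- x); rewrite enormN => /(_ xr).
have := convex_mid (2^-1 *: x) (2^-1 *: - x).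
rewrite scalerN subrr scalerN scalerA divff// scale1r.
have := ler_norm M; have := ler_norm (f 0); have := ler_norm (- f 0); rewrite normrN.
move=> *; rewrite ler_norml; apply/andP; split; lra.
Qed.

Lemma convex_lipschitz_ball (r : R) : 0 <= r ->
  exists2 L, 0 <= L & forall x y, enorm x <= r -> enorm y <= r ->
    `|f x - f y| <= L * enorm (x - y).
Proof.
move=> r0; have [M M0 HM] := convex_bounded (addr_ge0 r0 ler01).
exists (2 * M); first by rewrite mulr_ge0.
suff h x y : enorm x <= r -> enorm y <= r -> f y - f x <= 2 * M * enorm (y - x).
  move=> x y xr yr; rewrite ler_norml lerNl opprB h//=.
  by rewrite enormB h.
move=> xr yr; have [->|xy] := eqVneq y x.
  by rewrite !subrr enorm0 mulr0.
pose dl := enorm (y - x).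
have dl0 : 0 < dl by rewrite enorm_gt0 subr_eq0.
(* The segment from x to y is prolonged by a unit length, which stays in the ball of radius r + 1;
   the slope from x to y is at most the one from x to z. *)
pose z := y + dl^-1 *: (y - x).
have zr : enorm z <= r + 1.
  apply: (le_trans (enormD _ _)); apply: lerD => //.
  by rewrite enormZ -/dl ger0_norm ?invr_ge0 ?(ltW dl0)// mulVf ?gt_eqF.
pose t := dl / (1 + dl).
have t0 : 0 <= t by rewrite divr_ge0//; lra.
have t1 : t <= 1 by rewrite ler_pdivrMr; lra.
have td : t <= dl by rewrite ler_pdivrMr; nra.
have yE : y = t *: z + (1 - t) *: x.
  apply/rowP => i; rewrite !mxE /t; move: (y ord0 i) (x ord0 i) => a b.
  by field; rewrite !gt_eqF//; lra.
have := convexE z x t0 t1; rewrite -yE.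
have xr1 : enorm x <= r + 1 by lra.
have := HM z zr; have := HM x xr1.
rewrite !ler_norml -/dl => /andP[a1 a2] /andP[b1 b2] c.
have : t * (f z - f x) <= t * (2 * M) by apply: ler_wpM2l => //; lra.
have : t * (2 * M) <= dl * (2 * M) by apply: ler_wpM2r => //; lra.
lra.
Qed.

Lemma convex_continuous : continuous f.
Proof.
move=> /= x U /= /nbhs_ballP[e1 /= e10 eU].
have [L L0 HL] := convex_lipschitz_ball (addr_ge0 (enorm_ge0 x) ler01).
pose e := e1 / 2; have e0 : 0 < e by rewrite divr_gt0.
have n0 : 0 < n%:R + 1 :> R by rewrite ltr_wpDl.
have k0 : 0 < (L + 1) * (n%:R + 1) by rewrite mulr_gt0//; lra.
(* The first bound keeps y in the ball of radius |x| + 1, where L is a Lipschitz constant; the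
   second makes the increment at most e. The factor n + 1 converts the sup norm to [enorm] and is
   positive also for n = 0. *)
pose dl := Num.min (n%:R + 1)^-1 (e / ((L + 1) * (n%:R + 1))).
have dl0 : 0 < dl by rewrite lt_min invr_gt0 n0/= divr_gt0.
apply/nbhs_ballP; exists dl => //= y; rewrite -ball_normE /= => xydl; apply: eU.
rewrite -ball_normE /=; apply: (@le_lt_trans _ _ e); last by rewrite /e; lra.
have xy : enorm (x - y) <= (n%:R + 1) * `|x - y|.
  by apply: (le_trans (enorm_le_norm _)); rewrite ler_wpM2r// lerDl.
have d1 : `|x - y| <= (n%:R + 1)^-1 by rewrite (le_trans (ltW xydl))// ge_min lexx.
have d2 : `|x - y| <= e / ((L + 1) * (n%:R + 1)).
  by rewrite (le_trans (ltW xydl))// ge_min lexx orbT.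
have xy1 : enorm (x - y) <= 1.
  by apply: (le_trans xy); rewrite mulrC -ler_pdivlMr// div1r.
have yr : enorm y <= enorm x + 1.
  rewrite (_ : y = x + (y - x)); last by rewrite addrC subrK.
  by apply: (le_trans (enormD _ _)); rewrite lerD2l enormB.
apply: (le_trans (HL x y (ltac:(lra)) yr)).
apply: (@le_trans _ _ ((L + 1) * ((n%:R + 1) * `|x - y|))).
  apply: (@le_trans _ _ (L * ((n%:R + 1) * `|x - y|))); first exact: ler_wpM2l.
  by rewrite ler_wpM2r// ?lerDl// mulr_ge0// ltW.
by rewrite mulrA mulrC -ler_pdivlMr.
Qed.

End convex.

(** * Slopes of convex functions *)

Section grad_norm.
Context {R : realType} {n : nat}.
Variable f : 'rV[R]_n -> R.
Implicit Types x p : 'rV[R]_n.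

(* In dimension 0 the punctured neighbourhood filter is improper and
   [grad_norm f x] is [-oo]. *)
Lemma grad_norm_ge0 x : (0 < n)%N -> (0 <= grad_norm f x)%E.
Proof.
move=> n0; rewrite /grad_norm limf_esupE.
apply: le_ereal_inf_tmp => _ [A /nbhs_ballP[e /= e0 xA] <-].
pose v : 'rV[R]_n := delta_mx ord0 (Ordinal n0).
have v0 : v != 0.
  by apply/eqP => /rowP/(_ (Ordinal n0)); rewrite !mxE !eqxx => /eqP; rewrite oner_eq0.
have nv0 : 0 < `|v| by rewrite normr_gt0.
pose y := x + (e / (2 * `|v|)) *: v.
have Ay : A y.
  apply: xA.
    rewrite -ball_normE /= /y opprD addrA subrr add0r normrN normrZ ger0_norm; last first.
      by rewrite divr_ge0// ?mulr_ge0// ltW.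
    by rewrite invfM mulrA mulfVK ?gt_eqF//; lra.
  rewrite /y -subr_eq0 addrAC subrr add0r scaler_eq0 negb_or v0 andbT.
  by rewrite mulf_neq0// ?invr_eq0 ?mulf_neq0// gt_eqF.
apply: le_ereal_sup_tmp; exists ((`|f y - f x| / enorm (y - x))%:E); first by exists y.
by rewrite lee_fin divr_ge0// enorm_ge0.
Qed.

(** By convexity the slopes from x to points of the segment towards p are at least the slope to p,
    and such points come arbitrarily close to x. *)
Lemma grad_norm_ge_slope x p : convex_function (E := 'rV[R]_n) setT f -> x != p ->
  (((f x - f p) / enorm (x - p))%:E <= grad_norm f x)%E.
Proof.
move=> cf xp; rewrite /grad_norm limf_esupE.
apply: le_ereal_inf_tmp => _ [A /nbhs_ballP[e /= e0 xA] <-].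
have dxp : 0 < enorm (x - p) by rewrite enorm_gt0 subr_eq0.
have nxp : 0 < `|x - p| by rewrite normr_gt0 subr_eq0.
pose s := Num.min 1 (e / (2 * `|x - p|)).
have s0 : 0 < s by rewrite lt_min ltr01 divr_gt0// mulr_gt0.
have s1 : s <= 1 by rewrite ge_min lexx.
have se : s * `|x - p| < e.
  apply: (@le_lt_trans _ _ (e / (2 * `|x - p|) * `|x - p|)).
    by rewrite ler_wpM2r// ge_min lexx orbT.
  by rewrite invfM mulrA mulfVK ?gt_eqF//; lra.
pose y := s *: p + (1 - s) *: x.
have xy : x - y = s *: (x - p) by apply/rowP => i; rewrite !mxE; ring.
have Ay : A y.
  apply: xA; first by rewrite -ball_normE /= xy normrZ gtr0_norm.
  by rewrite eq_sym -subr_eq0 xy scaler_eq0 gt_eqF//= subr_eq0.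
apply: le_ereal_sup_tmp; exists ((`|f y - f x| / enorm (y - x))%:E); first by exists y.
rewrite lee_fin (enormB y x) xy enormZ (gtr0_norm s0) invfM mulrA ler_pM2r ?invr_gt0//.
rewrite ler_pdivlMr//.
have := convexE cf p x (ltW s0) s1; rewrite -/y => h.
by rewrite distrC (le_trans _ (ler_norm _))//; lra.
Qed.

End grad_norm.

(** * Moreau envelopes and their gradients *)

Section moreau.
Context {R : realType} {n : nat}.
Implicit Types x y z : 'rV[R]_n.

Lemma convex_functionP (f : 'rV[R]_n -> R) :
  (forall (t : R) x y, 0 <= t -> t <= 1 ->
    f (t *: x + (1 - t) *: y) <= t * f x + (1 - t) * f y) ->
  convex_function (E := 'rV[R]_n) setT f.
Proof. by move=> h t x y _ _; apply: h. Qed.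

Lemma sqdist_conv (t : R) x y z :
  dotV (z - (t *: x + (1 - t) *: y)) (z - (t *: x + (1 - t) *: y)) =
  t * dotV (z - x) (z - x) + (1 - t) * dotV (z - y) (z - y)
    - t * (1 - t) * dotV (x - y) (x - y).
Proof.
rewrite !(dotVDl, dotVDr, dotVNl, dotVNr, dotVZl, dotVZr).
rewrite (dotVC y x) (dotVC x z) (dotVC y z); ring.
Qed.

Variable f : 'rV[R]_n -> R.
Hypothesis cf : convex_function (E := 'rV[R]_n) setT f.

(** Convexity along a ray prolongs the Lipschitz bound on the unit ball to a linear bound at
    infinity, which the quadratic term of [moreau_obj] beats. *)
Lemma convex_lower_bound : exists2 L, 0 <= L & forall y, f 0 - L * (1 + enorm y) <= f y.
Proof.
have [L L0 HL] := convex_lipschitz_ball cf ler01.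
exists L => // y; have [y1|y1] := leP (enorm y) 1.
  have := HL y 0 y1; rewrite enorm0 subr0 => /(_ ler01).
  rewrite ler_norml => /andP[h _]; nra.
have y0 : 0 < enorm y by lra.
pose t := (enorm y)^-1.
have t0 : 0 <= t by rewrite invr_ge0 enorm_ge0.
have t1 : t <= 1 by rewrite invf_le1// ltW.
have ty : t * enorm y = 1 by rewrite mulVf ?gt_eqF.
have e1 : enorm (t *: y) <= 1 by rewrite enormZ ger0_norm// ty.
have := HL (t *: y) 0 e1; rewrite enorm0 subr0 => /(_ ler01).
rewrite ler_norml => /andP[h _].
have := convexE cf y 0 t0 t1; rewrite scaler0 addr0 => h2.
have h3 : t * (f 0 - f y) <= L.
  have : L * enorm (t *: y) <= L by rewrite -[leRHS]mulr1 ler_wpM2l.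
  lra.
have : enorm y * (t * (f 0 - f y)) <= enorm y * L by rewrite ler_wpM2l// ltW.
rewrite mulrA (mulrC (enorm y)) ty mul1r; nra.
Qed.

Variable lam : R.
Hypothesis lam0 : 0 < lam.

Definition moreau_obj x y := f y + dotV (x - y) (x - y) / (2 * lam).

Lemma moreau_obj_convex x : convex_function (E := 'rV[R]_n) setT (moreau_obj x).
Proof.
have l0 := lam0; apply: convex_functionP => t y z t0 t1; rewrite /moreau_obj sqdist_conv.
have := convexE cf y z t0 t1.
have k0 : 0 <= (2 * lam)^-1 by rewrite invr_ge0 mulr_ge0// ltW.
have : 0 <= t * (1 - t) * dotV (y - z) (y - z) / (2 * lam).
  by rewrite mulr_ge0// mulr_ge0 ?dotV_ge0// mulr_ge0//; lra.
lra.
Qed.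

Lemma prox_exists x : exists p, forall y, moreau_obj x p <= moreau_obj x y.
Proof.
have l0 := lam0; have [L L0 HL] := convex_lower_bound.
pose C := f x - f 0 + L * (1 + enorm x).
(* Beyond this distance d the quadratic term d ^ 2 / (2 lam) exceeds |C| + L d, so y does worse than
   x itself; the summand 1 ensures d >= 1. *)
pose rho := 1 + 2 * lam * (`|C| + L).
have rho1 : 1 <= rho by rewrite lerDl mulr_ge0 ?addr_ge0//; lra.
pose K := [set y : 'rV[R]_n | `|x - y| <= rho].
have Kx : K x by rewrite /K /= subrr normr0; lra.
have cK : compact K.
  have -> : K = closed_ball x rho by rewrite closed_ballE//; lra.
  apply: bounded_closed_compact; last exact: closed_ball_closed.
  rewrite closed_ballE; last by lra.
  exists (`|x| + rho); split; first exact: num_real.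
  move=> M xM y /= xy; apply: (@le_trans _ _ (`|x| + `|x - y|)).
    by rewrite -[X in `|X| <= _](subKr x) ler_normB.
  by rewrite (le_trans _ (ltW xM))// lerD2l.
have K0 : K !=set0 by exists x.
have ch : {within K, continuous (moreau_obj x)}.
  apply: continuous_subspaceT; exact: (convex_continuous (moreau_obj_convex x)).
have [p Kp pmin] := EVT_min_rV K0 cK ch.
exists p => y; have [Ky|] := pselect (K y); first by apply: pmin; rewrite inE.
move=> /negP; rewrite -ltNge => rxy.
apply: (@le_trans _ _ (moreau_obj x x)); first by apply: pmin; rewrite inE.
rewrite /moreau_obj subrr dotV0l mul0r addr0 -enorm_sqr.
have dxy : rho < enorm (x - y) := lt_le_trans rxy (norm_le_enorm _).
set d := enorm (x - y) in dxy *.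
have d0 : 0 <= d by exact: enorm_ge0.
have yd : enorm y <= enorm x + d.
  by rewrite -{1}(subKr x y) (le_trans (enormD _ _))// enormN.
have := HL y; have := ler_norm C.
have h1 : L * (1 + enorm y) <= L * (1 + enorm x) + L * d by rewrite -mulrDr ler_wpM2l//; lra.
have h2 : `|C| + L * d <= d ^+ 2 / (2 * lam).
  rewrite ler_pdivlMr; last by lra.
  have c1 : `|C| <= `|C| * d by rewrite ler_peMr//; lra.
  have c2 : 2 * lam * `|C| <= 2 * lam * (`|C| * d) by rewrite ler_wpM2l//; lra.
  have : 2 * lam * (`|C| + L) * d <= d * d by rewrite ler_wpM2r//; rewrite /rho in dxy; lra.
  lra.
rewrite /C; lra.
Qed.

Definition prox x := sval (cid (prox_exists x)).

Lemma proxP x y : moreau_obj x (prox x) <= moreau_obj x y.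
Proof. exact: (svalP (cid (prox_exists x))). Qed.

Definition moreau_env x := moreau_obj x (prox x).

(** The gradient of [moreau_env], in the sense of [moreau_env_lower] and [moreau_env_upper]
    together. *)
Definition moreau_grad x := lam^-1 *: (x - prox x).

Lemma subr_prox x : x - prox x = lam *: moreau_grad x.
Proof. by rewrite scalerA divff ?gt_eqF// scale1r. Qed.

Lemma proxE x : prox x = x - lam *: moreau_grad x.
Proof. by rewrite -subr_prox subKr. Qed.

Lemma ge0_of_small (A B : R) : (forall s, 0 < s -> s <= 1 -> 0 <= A + s * B) -> 0 <= A.
Proof.
move=> h; rewrite leNgt; apply/negP => A0.
have [B0|B0] := leP B 0; first by have := h 1 ltr01 (lexx 1); lra.
have := h (Num.min 1 (- A / (2 * B))).
have p : 0 < - A / (2 * B) by rewrite divr_gt0; lra.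
rewrite lt_min ltr01 p ge_min lexx => /(_ isT isT).
have : Num.min 1 (- A / (2 * B)) * B <= - A / (2 * B) * B.
  by rewrite ler_pM2r// ge_min lexx orbT.
rewrite (_ : - A / (2 * B) * B = - A / 2); last by field; rewrite gt_eqF.
lra.
Qed.

(** The minimality of [prox x] is tested against points moved a fraction s towards q: the
    first-order terms give the claim, the quadratic ones are of order s ^ 2 and disappear as s tends
    to 0. *)
Lemma moreau_grad_subgradient x q :
  f (prox x) + dotV (moreau_grad x) (q - prox x) <= f q.
Proof.
have l0 := lam0; rewrite -subr_ge0; set p := prox x.
apply: (@ge0_of_small _ (dotV (q - p) (q - p) / (2 * lam))) => s s0 s1.
have := proxP x (s *: q + (1 - s) *: p); rewrite /moreau_obj sqdist_conv -/p.
have := convexE cf q p (ltW s0) s1.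
have -> : dotV (x - q) (x - q) = dotV (x - p) (x - p) - 2 * dotV (x - p) (q - p)
    + dotV (q - p) (q - p).
  rewrite !(dotVDl, dotVDr, dotVNl, dotVNr) (dotVC p x) (dotVC q x) (dotVC q p); ring.
have xp : x - p = lam *: moreau_grad x := subr_prox x.
move: (moreau_grad x) xp => G xp; rewrite xp !dotVZl !dotVZr.
set Q := dotV (q - p) _; set g := dotV _ (q - p).
set D := dotV _ _; set a := f _; set b := f p; set c := f q.
move=> h1 h2.
have h3 : 0 <= s * (c - (b + g) + s * (Q / (2 * lam))).
  have e : a + (s * (lam * (lam * D) - 2 * (lam * g) + Q) + (1 - s) * (lam * (lam * D))
      - s * (1 - s) * Q) / (2 * lam) =
    a + lam * (lam * D) / (2 * lam) - s * g + s ^+ 2 * (Q / (2 * lam)) by field; lra.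
  move: h2; rewrite e.
  move: (Q / (2 * lam)) (_ / (2 * lam)) => Q' D' h2; lra.
by rewrite -(pmulr_rge0 _ s0).
Qed.

(** [prox x] is a competitor in the minimisation at z. *)
Lemma moreau_env_upper x z :
  moreau_env z <= moreau_env x + dotV (moreau_grad x) (z - x) + dotV (z - x) (z - x) / (2 * lam).
Proof.
have l0 := lam0; apply: (le_trans (proxP z (prox x))); rewrite /moreau_env /moreau_obj.
have -> : z - prox x = (z - x) + (x - prox x) by rewrite addrA subrK.
rewrite subr_prox; move: (z - x) (moreau_grad x) => w g.
rewrite !(dotVDl, dotVDr, dotVZl, dotVZr) (dotVC g w).
by rewrite le_eqVlt; apply/orP; left; apply/eqP; field; lra.
Qed.

(** The subgradient inequality at [prox x], tested at [prox z], gives the claim with lam / 2 times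
    the squared distance of the two gradients to spare. *)
Lemma moreau_env_lower x z :
  moreau_env x + dotV (moreau_grad x) (z - x) <= moreau_env z.
Proof.
have l0 := lam0; rewrite /moreau_env /moreau_obj.
have := moreau_grad_subgradient x (prox z); rewrite !subr_prox.
rewrite (_ : prox z - prox x = z - x - lam *: (moreau_grad z - moreau_grad x)); last first.
  by rewrite !proxE scalerBr; apply/rowP => i; rewrite !mxE; ring.
move: (z - x) (moreau_grad x) (moreau_grad z) => w g h.
have := dotV_ge0 (g - h).
rewrite !(dotVDl, dotVDr, dotVNl, dotVNr, dotVZl, dotVZr) (dotVC h g).
set a := f _; set b := f _.
move: (dotV g w) (dotV g g) (dotV g h) (dotV h h) => gw gg gh hh p1 p2.
have -> : lam * (lam * gg) / (2 * lam) = lam * gg / 2 by field; lra.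
have -> : lam * (lam * hh) / (2 * lam) = lam * hh / 2 by field; lra.
have : 0 <= lam * (gg - gh - (gh - hh)) by apply: mulr_ge0; lra.
lra.
Qed.

Lemma moreau_env_le x : moreau_env x <= f x.
Proof. by have := proxP x x; rewrite /moreau_obj subrr dotV0l mul0r addr0. Qed.

(** Once f drops from x to [prox x] by at most L d, where d is their distance, minimising - L d + d
    ^ 2 / (2 lam) over d gives the error lam L ^ 2 / 2. *)
Lemma moreau_env_ge (r L : R) x : 0 <= r -> 0 <= L ->
  (forall y z, enorm y <= r + 1 -> enorm z <= r + 1 -> `|f y - f z| <= L * enorm (y - z)) ->
  enorm x <= r -> f x - lam * L ^+ 2 / 2 <= moreau_env x.
Proof.
move=> r0 L0 HL xr; have l0 := lam0; rewrite /moreau_env /moreau_obj -enorm_sqr.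
have lip : f x - L * enorm (x - prox x) <= f (prox x).
  have [->|px] := eqVneq (prox x) x; first by rewrite subrr enorm0 mulr0 subr0.
  set p := prox x in px *; set d := enorm (x - p).
  have d0 : 0 < d by rewrite enorm_gt0 subr_eq0 eq_sym.
  (* [prox x] may leave the ball where f is known to be L-Lipschitz. The point of the segment at
     distance t d < 1 from x stays inside, and convexity transfers its estimate to [prox x]. *)
  pose t := (1 + d)^-1.
  have t0 : 0 < t by rewrite invr_gt0; lra.
  have t1 : t <= 1 by rewrite invf_le1; lra.
  have td : t * (1 + d) = 1 by rewrite mulVf// gt_eqF//; lra.
  have h1 := convexE cf p x (ltW t0) t1.
  set y := t *: p + (1 - t) *: x in h1.
  have xy : x - y = t *: (x - p) by apply/rowP => i; rewrite !mxE; ring.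
  have xyd : enorm (x - y) = t * d by rewrite xy enormZ ger0_norm// ltW.
  have yr : enorm y <= r + 1.
    rewrite -(subKr x y); apply: (le_trans (enormD _ _)); rewrite enormN xyd; nra.
  have := HL x y (ltac:(lra)) yr; rewrite xyd ler_norml => /andP[_ h2].
  have : t * (f x - f p) <= t * (L * d) by nra.
  by rewrite ler_pM2l//; lra.
apply: (@le_trans _ _ (f x - L * enorm (x - prox x) + enorm (x - prox x) ^+ 2 / (2 * lam)));
  last by rewrite lerD2r.
set d := enorm _.
have -> : f x - L * d + d ^+ 2 / (2 * lam) =
   f x - lam * L ^+ 2 / 2 + (d - lam * L) ^+ 2 / (2 * lam) by field; lra.
by rewrite lerDl divr_ge0 ?sqr_ge0//; lra.
Qed.

(** Sum of the subgradient inequalities at [prox x] and [prox z]. This cocoercivity is the source of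
    the Lipschitz constant 1 / lam. *)
Lemma moreau_grad_monotone x z :
  lam * dotV (moreau_grad x - moreau_grad z) (moreau_grad x - moreau_grad z) <=
  dotV (moreau_grad x - moreau_grad z) (x - z).
Proof.
have := moreau_grad_subgradient x (prox z); have := moreau_grad_subgradient z (prox x).
have E : prox x - prox z = (x - z) - lam *: (moreau_grad x - moreau_grad z).
  by rewrite !proxE scalerBr; apply/rowP => i; rewrite !mxE; ring.
rewrite -(opprB (prox x)) E dotVNr.
move: (moreau_grad x) (moreau_grad z) (x - z) (f _) (f _) => g h w a b.
rewrite !(dotVDl, dotVDr, dotVNl, dotVNr, dotVZl, dotVZr) (dotVC h g); lra.
Qed.

Lemma moreau_grad_lipschitz x z :
  enorm (moreau_grad x - moreau_grad z) <= lam^-1 * enorm (x - z).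
Proof.
have l0 := lam0; have := moreau_grad_monotone x z; rewrite -enorm_sqr.
set g := moreau_grad x - _ => h.
have [g0|gn0] := eqVneq (enorm g) 0.
  by rewrite g0 mulr_ge0 ?enorm_ge0// invr_ge0 ltW.
have gp : 0 < enorm g by rewrite lt_def gn0 enorm_ge0.
rewrite ler_pdivlMl// -(ler_pM2l gp) mulrCA -expr2.
exact: le_trans h (dotV_le_enorm _ _).
Qed.

Lemma measurable_moreau_grad : measurable_fun setT (moreau_grad : borel_rV R n -> borel_rV R n).
Proof.
have l0 := lam0; apply: measurable_fun_rV => i.
apply: (@continuous_measurable_rV R n (fun x => moreau_grad x ord0 i)).
move=> /= x U /= /nbhs_ballP[e /= e0 eU].
pose k := lam^-1 * n%:R + 1.
have k0 : 0 < k by rewrite ltr_wpDl// mulr_ge0// invr_ge0 ltW.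
apply/nbhs_ballP; exists (e / k); first by rewrite /= divr_gt0.
move=> y; rewrite -ball_normE /= ltr_pdivlMr// => xy; apply: eU.
rewrite /ball /=; apply: le_lt_trans xy.
have := coord_le_enorm (moreau_grad x - moreau_grad y) i; rewrite !mxE => h.
apply: (le_trans h); apply: (le_trans (moreau_grad_lipschitz _ _)).
have := enorm_le_norm (x - y).
have li : 0 <= lam^-1 by rewrite invr_ge0 ltW.
move=> h2; have := ler_wpM2l li h2; rewrite /k mulrA; have := normr_ge0 (x - y); nra.
Qed.

Lemma measurable_moreau_env : measurable_fun setT (moreau_env : borel_rV R n -> R).
Proof.
apply: continuous_measurable_rV; apply: convex_continuous.
apply: convex_functionP => t x y t0 t1.
(* The envelope is convex because it has a subgradient at the intermediate point [z]: the weighted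
   mean of the two lower bounds loses its linear term. *)
set z := t *: x + _.
have := moreau_env_lower z x; have := moreau_env_lower z y.
have -> : x - z = (1 - t) *: (x - y) by apply/rowP => i; rewrite !mxE; ring.
have -> : y - z = (- t) *: (x - y) by apply/rowP => i; rewrite !mxE; ring.
rewrite !dotVZr; move: (dotV _ _) (moreau_env z) => g b.
move=> h1 h2.
have t1' : 0 <= 1 - t by lra.
have := ler_wpM2l t0 h2; have := ler_wpM2l t1' h1; lra.
Qed.

(** The slope of f from x towards [prox x] is at most [grad_norm f x] by convexity, and at least the
    length of [moreau_grad x] by the subgradient inequality at [prox x] tested at x. *)
Lemma moreau_grad_sqr_le x : (0 < n)%N ->
  ((dotV (moreau_grad x) (moreau_grad x))%:E <= grad_norm f x ^+ 2)%E.
Proof.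
have l0 := lam0; move=> n0; rewrite -enorm_sqr EFin_expe !expe2.
suff h : ((enorm (moreau_grad x))%:E <= grad_norm f x)%E.
  by apply: lee_pmul => //; rewrite lee_fin enorm_ge0.
have [g0|g0] := eqVneq (moreau_grad x) 0.
  by rewrite g0 enorm0; exact: grad_norm_ge0.
have xp : x != prox x.
  rewrite -subr_eq0 subr_prox; apply: contra_neq g0 => /eqP.
  by rewrite scaler_eq0 gt_eqF//= => /eqP.
apply: (le_trans _ (grad_norm_ge_slope cf xp)); rewrite lee_fin.
have ep : 0 < enorm (x - prox x) by rewrite enorm_gt0 subr_eq0.
rewrite ler_pdivlMr//.
have := moreau_grad_subgradient x x; rewrite subr_prox.
move: (moreau_grad x) => g; rewrite enormZ gtr0_norm// dotVZr -enorm_sqr; lra.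
Qed.

End moreau.

(** * Variance of convex functions on the sphere *)

Section dyadic_tangent.
Context {R : realType}.

Definition dyadic_tan m : R := (dyadic_cs m.+1).2 / (dyadic_cs m.+1).1.

Lemma dyadic_cos_gt0 m : 0 < (@dyadic_cs R m.+1).1.
Proof.
have := @dyadic_csS R m; case: (dyadic_cs m) => c s.
by case: (dyadic_cs m.+1) => c' s' [].
Qed.

Lemma dyadic_sin_gt0 m : 0 < (@dyadic_cs R m).2.
Proof. by have := @dyadic_csP R m; case: (dyadic_cs m) => c s []. Qed.

Lemma dyadic_tan_gt0 m : 0 < dyadic_tan m.
Proof. by rewrite divr_gt0// ?dyadic_sin_gt0// dyadic_cos_gt0. Qed.

(** The squared sine is at most 2 ^ - (m + 1), and 1 / 2 <= (3 / 4) ^ 2; the squared cosine is at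
    least 1 / 2, which exceeds (2 / 3) ^ 2. *)
Lemma dyadic_tan_le m : dyadic_tan m <= 3 / 2 * (3 / 4) ^+ m.
Proof.
rewrite /dyadic_tan ler_pdivrMr ?dyadic_cos_gt0//.
have := dyadic_cos_gt0 m; have := @dyadic_csP R m.+1; have := @dyadic_sin_le R m.+1.
case: (dyadic_cs m.+1) => c s /= sle [_ s0 cs1] c0.
have p0 : 0 < (3 / 4 : R) ^+ m by rewrite exprn_gt0//; lra.
have h1 : (2^-1 : R) ^+ m.+1 <= 1 / 2 * ((3 / 4) ^+ m) ^+ 2.
  have h : (2^-1 : R) ^+ m <= ((3 / 4) ^+ 2) ^+ m by apply: lerXn2r; rewrite ?nnegrE; lra.
  by rewrite exprS -exprM mulnC exprM; move: h; move: (_ ^+ m) (_ ^+ m) => p q; lra.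
have h2 : (2^-1 : R) ^+ m.+1 <= 2^-1.
  by rewrite exprS ler_piMr// exprn_ile1//; lra.
have c23 : 2 / 3 <= c by apply: le_of_sqr; [exact: ltW|lra].
apply: (@le_trans _ _ ((3 / 4) ^+ m)).
  by apply: le_of_sqr; [exact: ltW|move: (_ ^+ 2) p0 h1 => ? ? ?; nra].
move: (_ ^+ m) p0 => p p0; nra.
Qed.

Lemma cvg_dyadic_tan : dyadic_tan @ \oo --> 0.
Proof.
apply: (@squeeze_cvgr _ _ _ _ (fun=> 0) (fun m => 3 / 2 * (3 / 4) ^+ m)).
- by apply: nearW => m; rewrite (ltW (dyadic_tan_gt0 m)) dyadic_tan_le.
- exact: cvg_cst.
- rewrite -(mulr0 (3 / 2)); apply: cvgM; first exact: cvg_cst.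
  by apply: cvg_expr; rewrite ger0_norm; lra.
Qed.

End dyadic_tangent.

(** * Directions of vectors and 1-homogeneous extensions *)

Section homogeneous_extension.
Context {R : realType} (n : nat).
Local Notation V := (borel_rV R n).
Implicit Types x y : 'rV[R]_n.

(** At the origin the value is 0, so r times it always lies in the closed ball of radius r, and on
    the sphere off the origin. *)
Definition unitV x : 'rV[R]_n := (enorm x)^-1 *: x.

Lemma enorm_unitV x : x != 0 -> enorm (unitV x) = 1.
Proof.
by move=> x0; rewrite enormZ ger0_norm ?invr_ge0 ?enorm_ge0// mulVf// enorm_eq0.
Qed.

Lemma enorm_unitV_le1 x : enorm (unitV x) <= 1.
Proof.
have [->|x0] := eqVneq x 0; last by rewrite enorm_unitV.
by rewrite /unitV scaler0 enorm0.
Qed.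

Lemma enorm_unitVK x : enorm x *: unitV x = x.
Proof.
have [->|x0] := eqVneq x 0; first by rewrite enorm0 scale0r.
by rewrite scalerA divff ?scale1r// enorm_eq0.
Qed.

Lemma unitVZ (t : R) x : 0 < t -> unitV (t *: x) = unitV x.
Proof.
move=> t0; rewrite /unitV enormZ gtr0_norm// scalerA invfM.
by rewrite mulrAC mulVf ?mul1r// gt_eqF.
Qed.

Lemma unitVN x : unitV (- x) = - unitV x.
Proof. by rewrite /unitV enormN scalerN. Qed.

Lemma measurable_enorm : measurable_fun setT (fun x : V => enorm x).
Proof.
have ms : measurable_fun [set: R] (fun t : R => Num.sqrt t).
  by apply: continuous_measurable_fun; exact: sqrt_continuous.
under eq_fun do rewrite enormE.
apply: (measurableT_comp ms); exact: measurable_sqnorm.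
Qed.

Lemma measurable_unitV : measurable_fun setT (unitV : V -> V).
Proof.
apply: measurable_fun_rV => i; under eq_fun do rewrite mxE.
apply: measurable_funM; last exact: measurable_coord.
have -> : (fun x : V => (enorm x)^-1) = (fun t : R => t `^ (-1)) \o (fun x : V => enorm x).
  by apply/funext => x /=; rewrite powR_inv1// enorm_ge0.
apply: measurableT_comp; [exact: measurable_powR|exact: measurable_enorm].
Qed.

Lemma enorm_sub_le x y : `|enorm x - enorm y| <= enorm (x - y).
Proof.
have h a b : enorm a - enorm b <= enorm (a - b).
  by rewrite lerBlDr -{1}(subrK b a) enormD.
by rewrite ler_norml lerNl opprB h enormB h.
Qed.

Lemma enorm_unitV_sub x y : enorm y * enorm (unitV x - unitV y) <= 2 * enorm (x - y).
Proof.
rewrite -[enorm y in leLHS](ger0_norm (enorm_ge0 y)) -enormZ scalerBr enorm_unitVK.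
rewrite (_ : _ - y = (enorm y - enorm x) *: unitV x + (x - y)); last first.
  by rewrite scalerBl enorm_unitVK addrA subrK.
apply: (le_trans (enormD _ _)); rewrite enormZ.
have h1 := enorm_sub_le y x; have h2 := enorm_unitV_le1 x.
have h3 : `|enorm y - enorm x| * enorm (unitV x) <= enorm (x - y).
  by rewrite enormB -[leRHS]mulr1 ler_pM// enorm_ge0.
lra.
Qed.

End homogeneous_extension.

Lemma cvg_of_dist_le (R : realType) (u e : R^nat) (l : R) :
  (forall k, `|u k - l| <= e k) -> e @ \oo --> 0 -> u @ \oo --> l.
Proof.
move=> ue e0; apply: (@squeeze_cvgr _ _ _ _ (fun k => l - e k) (fun k => l + e k)).
- by apply: nearW => k; have := ue k; rewrite ler_norml => /andP[? ?]; apply/andP; split; lra.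
- by rewrite -[X in _ --> X]subr0; apply: cvgB => //; exact: cvg_cst.
- by rewrite -[X in _ --> X]addr0; apply: cvgD => //; exact: cvg_cst.
Qed.

Section cone_extension.
Context {R : realType} (n : nat).
Local Notation G := (@normalV R n).
Local Notation G2 := (pprod G G).
Local Notation V := (borel_rV R n).
Variables (r M K : R) (g : 'rV[R]_n -> R) (a : 'rV[R]_n -> 'rV[R]_n).
Hypotheses (r0 : 0 <= r) (K0 : 0 <= K).
Hypotheses (mg : measurable_fun setT (g : V -> R)) (ma : measurable_fun setT (a : V -> V)).
Hypothesis glo : forall x z, g x + dotV (a x) (z - x) <= g z.
Hypothesis gup : forall x z,
  g z <= g x + dotV (a x) (z - x) + K * dotV (z - x) (z - x).
Hypothesis gM : forall x, enorm x <= r -> `|g x| <= M.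
Hypothesis aM : forall x, enorm x <= r -> enorm (a x) <= M.
Implicit Types x y : 'rV[R]_n.

Definition sphV x : 'rV[R]_n := r *: unitV x.

Lemma enorm_sphV_le x : enorm (sphV x) <= r.
Proof. by rewrite enormZ ger0_norm// ler_piMr// enorm_unitV_le1. Qed.

Lemma M_ge0 : 0 <= M.
Proof. by apply: le_trans (aM (enorm_sphV_le 0)); exact: enorm_ge0. Qed.

Lemma g_lipschitz x z : enorm x <= r -> enorm z <= r -> `|g x - g z| <= M * enorm (x - z).
Proof.
have h b c : enorm b <= r -> g b - g c <= M * enorm (b - c).
  move=> br; have := glo b c; rewrite -(opprB b) dotVNr.
  have := dotV_le_enorm (a b) (b - c).
  have : enorm (a b) * enorm (b - c) <= M * enorm (b - c).
    by rewrite ler_wpM2r ?enorm_ge0// aM.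
  lra.
by move=> xr zr; rewrite ler_norml lerNl opprB h//= enormB h.
Qed.

Section cone.
Variable m : R.

Definition cone x := enorm x * (g (sphV x) - m).

Lemma coneZ t x : 0 < t -> cone (t *: x) = t * cone x.
Proof. by move=> t0; rewrite /cone enormZ gtr0_norm// /sphV unitVZ// mulrA. Qed.

Definition cone_lip := M + `|m| + 2 * M * r.

Lemma cone_lip_ge0 : 0 <= cone_lip.
Proof. by rewrite !addr_ge0// ?mulr_ge0// M_ge0. Qed.

(** The variation of the norm costs M + |m|; that of the direction costs 2 M r, since the factor |y|
    compensates the blow-up of [unitV] near 0. The global Lipschitz bound dominates all difference
    quotients. *)
Lemma normr_cone_le x y : `|cone x - cone y| <= cone_lip * enorm (x - y).
Proof.
rewrite /cone.
rewrite (_ : _ - _ = (enorm x - enorm y) * (g (sphV x) - m) +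
  enorm y * (g (sphV x) - g (sphV y))); last by ring.
apply: (le_trans (ler_normD _ _)); rewrite !normrM (ger0_norm (enorm_ge0 y)).
have h1 : `|enorm x - enorm y| * `|g (sphV x) - m| <= enorm (x - y) * (M + `|m|).
  apply: ler_pM => //; first exact: enorm_sub_le.
  by apply: (le_trans (ler_normB _ _)); rewrite lerD2r gM// enorm_sphV_le.
have h2 : enorm y * `|g (sphV x) - g (sphV y)| <= M * r * (2 * enorm (x - y)).
  apply: (@le_trans _ _ (enorm y * (M * (r * enorm (unitV x - unitV y))))).
    apply: ler_wpM2l; first exact: enorm_ge0.
    apply: (le_trans (g_lipschitz (enorm_sphV_le x) (enorm_sphV_le y))).
    by rewrite /sphV -scalerBr enormZ ger0_norm.
  rewrite (_ : _ * _ = M * r * (enorm y * enorm (unitV x - unitV y))); last by ring.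
  by apply: ler_wpM2l (enorm_unitV_sub x y); rewrite mulr_ge0// M_ge0.
rewrite /cone_lip; lra.
Qed.

Lemma measurable_sphV : measurable_fun setT (sphV : V -> V).
Proof.
apply: measurable_fun_rV => i.
have -> : (fun x : V => sphV x ord0 i) = (fun x => r * unitV x ord0 i).
  by apply/funext => x; rewrite mxE.
by apply: measurable_funM => //; exact: (measurable_fun_coord _ (@measurable_unitV R n)).
Qed.

Lemma measurable_cone : measurable_fun setT (cone : V -> R).
Proof.
apply: measurable_funM; first exact: measurable_enorm.
by apply: measurable_funB => //; exact: (measurableT_comp mg measurable_sphV).
Qed.

Lemma cone0 : cone 0 = 0.
Proof. by rewrite /cone enorm0 mul0r. Qed.

Lemma sqint_cone : sqint G cone.
Proof.
split; first exact: measurable_cone.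
apply: (@le_integrable _ _ _ G _ _ _ (fun x => (cone_lip ^+ 2)%:E * (dotV x x)%:E)%E) => //.
- by apply/measurable_EFinP; apply: measurable_funX; exact: measurable_cone.
- move=> x _ /=; rewrite lee_fin (ger0_norm (sqr_ge0 _)) (ger0_norm (mulr_ge0 (sqr_ge0 _) (dotV_ge0 _))).
  have := normr_cone_le x 0; rewrite cone0 !subr0 => h.
  rewrite -enorm_sqr -exprMn -(real_normK (num_real (cone x))).
  by apply: lerXn2r => //; rewrite nnegrE; apply: mulr_ge0 cone_lip_ge0 (enorm_ge0 _).
- exact: (integrableZl measurableT _ (@integrable_sqnorm R n)).
Qed.

(** Pulling c out of F (c X + s Y) by homogeneity also absorbs the factor c on F (X), and the step
    becomes the tangent s / c. *)
Lemma difference_quotient_cone k (z : V * V) :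
  difference_quotient cone k.+1 z =
  (cone (z.1 + dyadic_tan k *: z.2) - cone z.1) / dyadic_tan k.
Proof.
rewrite /difference_quotient; have := @dyadic_sin_gt0 R k.+1; have := @dyadic_cos_gt0 R k.
rewrite /dyadic_tan; case: (dyadic_cs k.+1) => c s /= c0 s0.
have -> : c *: z.1 + s *: z.2 = c *: (z.1 + (s / c) *: z.2).
  by rewrite scalerDr scalerA mulrC divfK// gt_eqF.
rewrite coneZ//; move: (cone _) (cone _) => A B; field.
by rewrite !gt_eqF.
Qed.

Lemma difference_quotient_cone_le k (z : V * V) :
  difference_quotient cone k.+1 z ^+ 2 <= cone_lip ^+ 2 * dotV z.2 z.2.
Proof.
rewrite difference_quotient_cone -enorm_sqr -exprMn.
have t0 := @dyadic_tan_gt0 R k.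
rewrite -(real_normK (num_real (_ / _))).
apply: lerXn2r; rewrite ?nnegrE//; first by apply: mulr_ge0 cone_lip_ge0 (enorm_ge0 _).
rewrite normrM (gtr0_norm (_ : 0 < (dyadic_tan k)^-1)) ?invr_gt0// ler_pdivrMr//.
apply: (le_trans (normr_cone_le _ _)).
by rewrite addrAC subrr add0r enormZ (gtr0_norm t0) mulrA mulrAC.
Qed.

(** The gradient of [cone] off the origin: the first term is radial, the second is r times the
    projection of the gradient of g onto the tangent space. *)
Definition cone_grad x : 'rV[R]_n :=
  (g (sphV x) - m) *: unitV x
  + r *: (a (sphV x) - dotV (a (sphV x)) (unitV x) *: unitV x).

Lemma measurable_cone_grad : measurable_fun setT (cone_grad : V -> V).
Proof.
have mas : measurable_fun setT ((a : V -> V) \o (sphV : V -> V)) := measurableT_comp ma measurable_sphV.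
have mgs : measurable_fun setT ((g : V -> R) \o (sphV : V -> V)) := measurableT_comp mg measurable_sphV.
have mu := @measurable_unitV R n.
apply: measurable_fun_rV => i.
have -> : (fun x : V => cone_grad x ord0 i) = (fun x => (g (sphV x) - m) * unitV x ord0 i +
   r * (a (sphV x) ord0 i - dotV (a (sphV x)) (unitV x) * unitV x ord0 i)).
  by apply/funext => x; rewrite !mxE.
apply: measurable_funD.
  apply: measurable_funM; last exact: measurable_fun_coord.
  exact: measurable_funB.
apply: measurable_funM => //; apply: measurable_funB.
  exact: (measurable_fun_coord _ mas).
by apply: measurable_funM; [exact: measurable_dotV|exact: measurable_fun_coord].
Qed.

Lemma dotV_cone_grad x : x != 0 -> dotV (cone_grad x) (cone_grad x) =
  (g (sphV x) - m) ^+ 2 + r ^+ 2 *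
   (dotV (a (sphV x)) (a (sphV x)) - dotV (a (sphV x)) (unitV x) ^+ 2).
Proof.
move=> x0; have uu : dotV (unitV x) (unitV x) = 1 by rewrite -enorm_sqr enorm_unitV// expr1n.
rewrite /cone_grad; move: (unitV x) (a _) (g _) uu => u b c uu.
rewrite !(dotVDl, dotVDr, dotVNl, dotVNr, dotVZl, dotVZr) (dotVC u b) uu; ring.
Qed.

Lemma cvg_difference_quotient_cone (z : V * V) : z.1 != 0 ->
  difference_quotient cone k.+1 z @[k --> \oo] --> dotV (cone_grad z.1) z.2.
Proof.
case: z => x y /= x0; pose tau := @dyadic_tan R.
have t0 k : 0 < tau k := dyadic_tan_gt0 k.
have N0 : 0 < enorm x by rewrite enorm_gt0.
pose xk k := x + tau k *: y.
pose N k := enorm (xk k).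
have Nk0 k : 0 <= N k by exact: enorm_ge0.
have ct : tau @ \oo --> 0 := cvg_dyadic_tan.
have xkx k : enorm (xk k - x) = tau k * enorm y.
  by rewrite /xk addrAC subrr add0r enormZ gtr0_norm.
have cN : N @ \oo --> enorm x.
  apply: (cvg_of_dist_le (e := fun k => tau k * enorm y)) => [k|].
    by rewrite (le_trans (enorm_sub_le _ _))// xkx.
  by rewrite -(mul0r (enorm y)); apply: cvgM => //; exact: cvg_cst.
(* The difference quotient of the norm, with the square roots rationalised. *)
pose rho k := (2 * dotV x y + tau k * dotV y y) / (N k + enorm x).
have crho : rho @ \oo --> dotV (unitV x) y.
  have -> : dotV (unitV x) y = (2 * dotV x y + 0 * dotV y y) / (enorm x + enorm x).
    by rewrite dotVZl; field; rewrite !gt_eqF ?addr_gt0.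
  apply: cvgM.
    apply: cvgD; first exact: cvg_cst.
    by apply: cvgM => //; exact: cvg_cst.
  apply: cvgV; first by rewrite gt_eqF// addr_gt0.
  by apply: cvgD => //; exact: cvg_cst.
have rhoE k : N k - enorm x = tau k * rho k.
  have Np : 0 < N k + enorm x by rewrite ltr_wpDl.
  apply: (mulIf (lt0r_neq0 Np)); rewrite -mulrA divfK ?gt_eqF//.
  rewrite -subr_sqr !enorm_sqr /xk !(dotVDl, dotVDr, dotVZl, dotVZr) (dotVC y x); ring.
set u := unitV x; set w := sphV x.
pose wk k := sphV (xk k).
(* The remainder of g beyond its linear part lies between 0 and K times the squared displacement, by
   [glo] and [gup]; the displacement is of order tau, so [E] is too. *)
pose del k := g (wk k) - g w - dotV (a w) (wk k - w).
pose E k := N k * del k / tau k.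
have qE k : difference_quotient cone k.+1 (x, y) =
    rho k * (g w - m - r * dotV (a w) u) + r * dotV (a w) y + E k.
  rewrite difference_quotient_cone /= -/(tau k) -/(xk k) /cone -/(N k) -/w -/(wk k).
  have h : N k * dotV (a w) (wk k - w) =
      r * (enorm x * dotV (a w) u + tau k * dotV (a w) y - N k * dotV (a w) u).
    rewrite -!dotVZr -dotVDr -dotVNr -dotVDr -dotVZr; congr dotV.
    rewrite enorm_unitVK -/(xk k) -[in RHS](enorm_unitVK (xk k)) -/(N k).
    by apply/rowP => i; rewrite !mxE; ring.
  have gE : N k * g (wk k) = N k * g w + N k * del k + N k * dotV (a w) (wk k - w).
    by rewrite /del; ring.
  have -> : N k * (g (wk k) - m) = N k * g (wk k) - N k * m by ring.
  rewrite gE h /E.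
  have NE : N k = enorm x + tau k * rho k by rewrite -rhoE; ring.
  have tn : tau k != 0 by rewrite gt_eqF.
  move: (N k) (rho k) (del k) (tau k) NE tn => Nk rk dk tk -> tn; by field.
have E0 : E @ \oo --> 0.
  pose C := K * (2 * r * enorm y) * (2 * r * enorm y / enorm x).
  apply: (cvg_of_dist_le (e := fun k => C * tau k)) => [k|]; last first.
    by rewrite -(mulr0 C); apply: cvgM => //; exact: cvg_cst.
  have d0 : 0 <= del k by have := glo w (wk k); rewrite /del; lra.
  have dK : del k <= K * dotV (wk k - w) (wk k - w).
    by have := gup w (wk k); rewrite /del; lra.
  rewrite subr0 ger0_norm; last exact: divr_ge0 (mulr_ge0 (Nk0 k) d0) (ltW (t0 k)).
  rewrite /E ler_pdivrMr//.
  have wE : enorm (wk k - w) = r * enorm (unitV (xk k) - u).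
    by rewrite /wk /w /sphV -scalerBr enormZ ger0_norm.
  have b1 : N k * enorm (wk k - w) <= 2 * r * enorm y * tau k.
    rewrite wE mulrCA; have := enorm_unitV_sub x (xk k).
    rewrite enormB [enorm (x - _)]enormB xkx => /(ler_wpM2l r0); rewrite -/(N k); lra.
  have b2 : enorm (wk k - w) <= 2 * r * enorm y / enorm x * tau k.
    have := enorm_unitV_sub (xk k) x; rewrite xkx => /(ler_wpM2l r0) h.
    rewrite -mulrA [_^-1 * _]mulrC mulrA ler_pdivlMr// wE; lra.
  apply: (@le_trans _ _ (K * ((N k * enorm (wk k - w)) * enorm (wk k - w)))).
    rewrite -mulrA -expr2 enorm_sqr mulrCA; exact: ler_wpM2l.
  rewrite (_ : C * tau k * tau k = K * ((2 * r * enorm y * tau k) *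
    (2 * r * enorm y / enorm x * tau k))); last by rewrite /C; ring.
  by apply: ler_wpM2l => //; apply: ler_pM => //; rewrite ?mulr_ge0 ?enorm_ge0.
have -> : dotV (cone_grad x) y =
    dotV u y * (g w - m - r * dotV (a w) u) + r * dotV (a w) y + 0.
  rewrite /cone_grad -/u -/w !(dotVDl, dotVNl, dotVZl); ring.
under eq_cvg do rewrite qE.
apply: cvgD => //; apply: cvgD; last exact: cvg_cst.
by apply: cvgM => //; exact: cvg_cst.
Qed.

End cone.
End cone_extension.

(** * Bounded functions, variances and Gaussian symmetry *)

Section bounded_functions.
Context d (T : measurableType d) (R : realType) (P : probability T R).

Lemma bounded_integrable (f : T -> R) (B : R) : measurable_fun setT f ->
  (forall x, `|f x| <= B) -> P.-integrable setT (EFin \o f).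
Proof.
move=> mf fB.
apply: (@le_integrable _ _ _ P _ _ _ (EFin \o cst B)) => //.
- exact/measurable_EFinP.
- move=> x _ /=; rewrite lee_fin.
  by rewrite (le_trans (fB x))// ler_norm.
- exact: finite_measure_integrable_cst.
Qed.

Lemma bounded_sqint (f : T -> R) (B : R) : measurable_fun setT f ->
  (forall x, `|f x| <= B) -> sqint P f.
Proof.
move=> mf fB; split => //; apply: (@bounded_integrable _ (B ^+ 2)).
  exact: measurable_funX.
move=> x; rewrite normrX; apply: lerXn2r; rewrite ?nnegrE//.
exact: le_trans (fB x).
Qed.

Lemma Rintegral_prob_cst (k : R) : \int[P]_x k = k.
Proof. by rewrite /Rintegral probability_integral_cst. Qed.

Lemma Rintegral_sqr_sub (f : T -> R) (k : R) : sqint P f ->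
  \int[P]_x ((f x - k) ^+ 2) = \int[P]_x (f x ^+ 2) - 2 * k * \int[P]_x f x + k ^+ 2.
Proof.
move=> sf.
have s1 : sqint P (fun=> 1) by apply: (@bounded_sqint _ 1) => // x; rewrite normr1.
have := Rintegral_sqr_lin 1 (- k) sf s1.
rewrite (_ : \int[P]_x (_ ^+ 2) = \int[P]_x ((f x - k) ^+ 2)); last first.
  by apply: eq_Rintegral => x _; congr (_ ^+ 2); ring.
move=> ->; rewrite (_ : \int[P]_x (f x * 1) = \int[P]_x f x); last first.
  by apply: eq_Rintegral => x _; rewrite mulr1.
by rewrite (_ : \int[P]_x (1 ^+ 2) = 1) ?Rintegral_prob_cst ?expr1n//; ring.
Qed.

Lemma sqr_Rintegral_le (f : T -> R) : sqint P f ->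
  (\int[P]_x f x) ^+ 2 <= \int[P]_x (f x ^+ 2).
Proof.
move=> sf; set c := \int[P]_x f x.
have : 0 <= \int[P]_x ((f x - c) ^+ 2) by apply: Rintegral_ge0 => x _; exact: sqr_ge0.
rewrite (Rintegral_sqr_sub c sf) -/c; lra.
Qed.

Lemma variance_le (f : T -> R) (k : R) : sqint P f ->
  \int[P]_x (f x ^+ 2) - (\int[P]_x f x) ^+ 2 <= \int[P]_x ((f x - k) ^+ 2).
Proof.
move=> sf; rewrite (Rintegral_sqr_sub k sf).
have := sqr_ge0 (\int[P]_x f x - k); lra.
Qed.

End bounded_functions.

Section normalV_symmetry.
Context {R : realType} (n : nat).
Local Notation G := (@normalV R n).
Local Notation V := (borel_rV R n).

(* Rotating four times by an eighth of a turn maps [z] to [- z]. *)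
Lemma Rintegral_normalVN (h : V -> R) : measurable_fun setT h -> (forall x, 0 <= h x) ->
  \int[G]_x h (- x) = \int[G]_x h x.
Proof.
move=> mh h0.
have mN : measurable_fun setT (fun x : V => - x : V).
  apply: measurable_fun_rV => i.
  have -> : (fun x : V => (- x) ord0 i) = (fun x => - (x ord0 i)).
    by apply/funext => x; rewrite mxE.
  by apply: measurable_funN; exact: measurable_coord.
have E (k : V -> R) : measurable_fun setT k -> (forall x, 0 <= k x) ->
    \int[G]_x k x = \int[pprod G G]_z k z.1.
  move=> mk k0; rewrite /Rintegral; congr fine; apply/esym.
  apply: (integral_fst (f := EFin \o k)) => [|x]; first exact/measurable_EFinP.
  by rewrite lee_fin.
rewrite (E h)// (E (fun x => h (- x)))//; last exact: (measurableT_comp mh mN).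
have [c1 c2] : exists2 c : R, c ^+ 2 + c ^+ 2 = 1 & 0 < c.
  exists (Num.sqrt 2^-1); last by rewrite sqrtr_gt0.
  by rewrite sqr_sqrtr//; lra.
move=> c0.
have mr := @measurable_rotVV R n c1 c1.
have m1 : measurable_fun setT (fun z : V * V => h z.1) := measurableT_comp mh measurable_fst.
have m2 := measurableT_comp m1 mr; have m3 := measurableT_comp m2 mr.
have m4 := measurableT_comp m3 mr.
rewrite -[RHS](Rintegral_rotVV c2 c0 m1) -[RHS](Rintegral_rotVV c2 c0 m2).
rewrite -[RHS](Rintegral_rotVV c2 c0 m3) -[RHS](Rintegral_rotVV c2 c0 m4).
apply: eq_Rintegral => -[x y] _ /=; congr h; apply/rowP => i; rewrite !mxE.
move: (x ord0 i) (y ord0 i) => s t.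
have -> : c1 * (c1 * (c1 * (c1 * s + c1 * t) + c1 * (c1 * t - c1 * s))
    + c1 * (c1 * (c1 * t - c1 * s) - c1 * (c1 * s + c1 * t)))
    + c1 * (c1 * (c1 * (c1 * t - c1 * s) - c1 * (c1 * s + c1 * t))
    - c1 * (c1 * (c1 * s + c1 * t) + c1 * (c1 * t - c1 * s))) = - ((c1 ^+ 2 + c1 ^+ 2) ^+ 2 * s).
  by ring.
by rewrite c2 expr1n mul1r.
Qed.

(** The shift by [B] makes the function nonnegative, as the invariance under negation requires. *)
Lemma Rintegral_odd (h : V -> R) (B : R) : measurable_fun setT h ->
  (forall x, `|h x| <= B) -> (forall x, h (- x) = - h x) -> \int[G]_x h x = 0.
Proof.
move=> mh hB hN.
have B0 x : 0 <= B + h x by have := hB x; rewrite ler_norml => /andP[? _]; lra.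
have mB : measurable_fun setT (fun x => B + h x) by exact: measurable_funD.
have := Rintegral_normalVN mB B0.
have ih := bounded_integrable G mh hB.
have ic : G.-integrable setT (EFin \o cst B) by exact: finite_measure_integrable_cst.
under eq_Rintegral do rewrite hN.
rewrite (RintegralB _ ic ih)// (RintegralD _ ic ih)//; lra.
Qed.

End normalV_symmetry.

(** * The variance inequality on the sphere, with room for an atom *)

Section sphere_variance.
Context {R : realType} (n : nat).
Local Notation G := (@normalV R n).
Local Notation G2 := (pprod G G).
Local Notation V := (borel_rV R n).
Variables (r M K : R) (g : 'rV[R]_n -> R) (a : 'rV[R]_n -> 'rV[R]_n).
Hypotheses (n1 : (1 < n)%N) (r0 : 0 <= r) (rn : r ^+ 2 = n%:R - 1) (K0 : 0 <= K).
Hypotheses (mg : measurable_fun setT (g : V -> R)) (ma : measurable_fun setT (a : V -> V)).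
Hypothesis glo : forall x z, g x + dotV (a x) (z - x) <= g z.
Hypothesis gup : forall x z,
  g z <= g x + dotV (a x) (z - x) + K * dotV (z - x) (z - x).
Hypothesis gM : forall x, enorm x <= r -> `|g x| <= M.
Hypothesis aM : forall x, enorm x <= r -> enorm (a x) <= M.
Implicit Types x y : 'rV[R]_n.

Local Notation w := (sphV r).
Let phi x := g (w x).
Let A x := dotV (a (w x)) (a (w x)).
Let T x := dotV (a (w x)) (unitV x).

Let M0 : 0 <= M. Proof. exact: M_ge0 r0 aM. Qed.

Let mw : measurable_fun setT (w : V -> V). Proof. exact: measurable_sphV. Qed.

Let mphi : measurable_fun setT (phi : V -> R).
Proof. exact: (measurableT_comp mg mw). Qed.

Let mA : measurable_fun setT (A : V -> R).
Proof. by apply: measurable_dotV; exact: (measurableT_comp ma mw). Qed.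

Let mT : measurable_fun setT (T : V -> R).
Proof.
by apply: measurable_dotV; [exact: (measurableT_comp ma mw)|exact: measurable_unitV].
Qed.

Let wr x : enorm (w x) <= r. Proof. exact: enorm_sphV_le. Qed.

Let phiM x : `|phi x| <= M. Proof. exact: gM. Qed.

Let A_ge0 x : 0 <= A x. Proof. exact: dotV_ge0. Qed.

Let AM x : `|A x| <= M ^+ 2.
Proof.
by rewrite ger0_norm// /A -enorm_sqr; apply: lerXn2r; rewrite ?nnegrE ?enorm_ge0// aM.
Qed.

Let TM x : `|T x| <= M.
Proof.
apply: (le_trans (normr_dotV_le_enorm _ _)).
rewrite -[leRHS]mulr1; apply: ler_pM; rewrite ?enorm_ge0 ?enorm_unitV_le1//.
exact: aM.
Qed.

Let T2_le_A x : T x ^+ 2 <= A x.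
Proof.
rewrite /T; apply: (le_trans (cauchy_schwarz_dotV _ _)).
by rewrite ler_piMr ?dotV_ge0// -enorm_sqr expr_le1// ?enorm_ge0// enorm_unitV_le1.
Qed.

Let sphi : sqint G phi. Proof. exact: bounded_sqint mphi phiM. Qed.
Let sT : sqint G T. Proof. exact: bounded_sqint mT TM. Qed.
Let iA : G.-integrable setT (EFin \o A). Proof. exact: bounded_integrable mA AM. Qed.
Let iphi : G.-integrable setT (EFin \o phi). Proof. exact: bounded_integrable mphi phiM. Qed.
Let iT : G.-integrable setT (EFin \o T). Proof. exact: bounded_integrable mT TM. Qed.
Let iT2 : G.-integrable setT (EFin \o (fun x => T x ^+ 2)). Proof. exact: sT.2. Qed.

Lemma integrable_enorm : G.-integrable setT (EFin \o (fun x : V => enorm x)).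
Proof.
apply: (@le_integrable _ _ _ G _ _ _ (fun x => 1 + (dotV x x)%:E)%E) => //.
- by apply/measurable_EFinP; exact: measurable_enorm.
- move=> x _ /=; rewrite lee_fin (ger0_norm (enorm_ge0 _)) ger0_norm ?addr_ge0 ?dotV_ge0//.
  rewrite -enorm_sqr; nra.
- apply: integrableD => //; last exact: integrable_sqnorm.
  exact: finite_measure_integrable_cst.
Qed.

(** By independence m is the mean of [phi], but this is not established: [variance_le] bounds the
    variance by the second moment about any point. *)
Lemma exists_centering : exists m, (\int[G]_x (cone r g m x)%:E = 0)%E.
Proof.
have ie := integrable_enorm.
have ief : G.-integrable setT (EFin \o (fun x : V => enorm x * phi x)).
  apply: (@le_integrable _ _ _ G _ _ _ (fun x => M%:E * (enorm x)%:E)%E) => //.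
  - apply/measurable_EFinP; apply: measurable_funM => //; exact: measurable_enorm.
  - move=> x _ /=; rewrite lee_fin !normrM (ger0_norm M0) mulrC.
    exact: ler_wpM2r (phiM x).
  - exact: (integrableZl measurableT _ ie).
have fE : (\int[G]_x (enorm x)%:E)%E \is a fin_num by exact: integrable_fin_num.
have fF : (\int[G]_x (enorm x * phi x)%:E)%E \is a fin_num by exact: integrable_fin_num.
pose e := fine (\int[G]_x (enorm x)%:E)%E.
pose p := fine (\int[G]_x (enorm x * phi x)%:E)%E.
have E m : (\int[G]_x (cone r g m x)%:E)%E = (p - m * e)%:E.
  rewrite EFinB EFinM /p /e !fineK// -integralZl// -integralB//; last first.
    exact: (integrableZl measurableT _ ie).
  apply: eq_integral => x _; rewrite -EFinM -EFinB; congr EFin.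
  by rewrite /cone /phi; ring.
(* If E |X| were 0, then p would vanish as well, being at most M E |X| in absolute value. *)
have [e0|e0] := eqVneq e 0; last first.
  by exists (p / e); rewrite E divfK// subrr.
exists 0; rewrite E mul0r subr0; congr EFin.
have : `|p| <= M * e.
  apply: (le_trans (le_normr_Rintegral measurableT ief)).
  rewrite /e -/(Rintegral G setT (fun x => enorm x)) -RintegralZl//.
  apply: le_Rintegral => //.
  - exact: (integrable_norm ief).
  - exact: (integrableZl measurableT _ ie).
  - move=> x _; rewrite normrM (ger0_norm (enorm_ge0 _)) mulrC.
    exact: ler_wpM2r (enorm_ge0 x) _ _ (phiM x).
by rewrite e0 mulr0 normr_le0 => /eqP.
Qed.

(* The Gaussian Poincare inequality for the 1-homogeneous function [cone r g m],
   read on the sphere through E |X|^2 = n.  The radial part of the gradient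
   leaves the negative term. *)
Lemma sphere_poincare m : (\int[G]_x (cone r g m x)%:E = 0)%E ->
  \int[G]_x ((phi x - m) ^+ 2) <= \int[G]_x A x - \int[G]_x (T x ^+ 2).
Proof.
move=> c0.
have n0 : (0 < n)%N by exact: ltnW.
have mq : measurable_fun setT (fun x : V => (phi x - m) ^+ 2).
  by apply: measurable_funX; exact: measurable_funB.
have Mm x : `|phi x - m| <= M + `|m| by rewrite (le_trans (ler_normB _ _))// lerD2r.
have qM x : 0 <= (phi x - m) ^+ 2 <= (M + `|m|) ^+ 2.
  rewrite sqr_ge0/= -(real_normK (num_real (_ - _))).
  by apply: lerXn2r; rewrite ?nnegrE// addr_ge0.
have iq : G.-integrable setT (EFin \o (fun x : V => (phi x - m) ^+ 2)).
  apply: (bounded_integrable G mq (B := (M + `|m|) ^+ 2)) => x; rewrite ger0_norm ?sqr_ge0//; by have /andP[] := qM x.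
have iAT : G.-integrable setT (EFin \o (fun x => A x - T x ^+ 2)).
  exact: (integrableB measurableT iA iT2).
have irAT : G.-integrable setT (EFin \o (fun x => r ^+ 2 * (A x - T x ^+ 2))).
  exact: (integrableZl measurableT _ iAT).
have aex : {ae G, forall x, x != 0}.
  exists [set 0]; split; first exact: measurable_set1_rV.
    exact: normalV_set0.
  by move=> y /= /negP; rewrite negbK => /eqP.
have lower : (n%:R%:E * \int[G]_x ((phi x - m) ^+ 2)%:E <=
    \int[G]_x (cone r g m x ^+ 2)%:E)%E.
  apply: (le_trans (homogeneous0_sqnorm_ge mq qM _)).
    by move=> t x t0; rewrite /phi /sphV unitVZ.
  rewrite le_eqVlt; apply/orP; left; apply/eqP; apply: eq_integral => x _.
  by congr EFin; rewrite /cone exprMn enorm_sqr mulrC.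
have upper : (\int[G]_x (cone r g m x ^+ 2)%:E <=
    \int[G]_x (dotV (cone_grad r g a m x) (cone_grad r g a m x))%:E)%E.
  apply: (gaussian_gradient_bound (sqint_cone r0 mg glo gM aM m) c0
    (H := fun z => cone_lip r M m ^+ 2 * dotV z.2 z.2)).
  - exact: measurable_cone_grad.
  - apply/integrableP; split.
      apply/measurable_EFinP; apply: measurable_funM => //.
      exact: (measurableT_comp (@measurable_sqnorm R n) measurable_snd).
    rewrite (ge0_pprod2 G G (f := fun z =>
      `|(cone_lip r M m ^+ 2 * dotV z.2 z.2)%:E|%E))//; last first.
      do 2 apply: measurableT_comp => //; apply: measurable_funM => //.
      exact: (measurableT_comp (@measurable_sqnorm R n) measurable_snd).
    rewrite (eq_integral (fun y : V => `|(cone_lip r M m ^+ 2 * dotV y y)%:E|%E)); last first.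
      by move=> y _ /=; rewrite probability_integral_cst.
    by have /integrableP[] := integrableZl measurableT (cone_lip r M m ^+ 2) (@integrable_sqnorm R n).
  - by move=> k z; exact: (difference_quotient_cone_le r0 glo gM aM).
  - have mN : measurable [set z : V * V | z.1 = 0].
      have h : measurable ([set: V * V] `&` fst @^-1` [set (0 : V)]).
        by apply: measurable_fst => //; exact: measurable_set1_rV.
      by rewrite setTI in h.
    exists [set z : V * V | z.1 = 0]; split => //.
      have := @integral_indic _ _ R G2 setT measurableT _ mN; rewrite setIT => <-.
      rewrite (eq_integral (fun z : V * V => (\1_[set (0 : V)] z.1)%:E)); last first.
        by move=> z _; rewrite !indicE; congr ((nat_of_bool _)%:R%:E); apply/idP/idP; rewrite !inE.
      rewrite (integral_fst (f := fun x => (\1_[set (0 : V)] x)%:E)).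
      - have m0 := @measurable_set1_rV R n 0; rewrite integral_indic// setIT; exact: normalV_set0.
      - apply/measurable_EFinP; apply: measurable_indic; exact: measurable_set1_rV.
      - by move=> x; rewrite lee_fin.
    move=> z /= h; apply: contrapT => /eqP z0; apply: h.
    exact: (cvg_difference_quotient_cone r0 K0 glo gup).
have := le_trans lower upper.
rewrite (ge0_ae_eq_integral (f := fun x : V => (dotV (cone_grad r g a m x) (cone_grad r g a m x))%:E) (g := fun x : V => ((phi x - m) ^+ 2 + r ^+ 2 * (A x - T x ^+ 2))%:E));
  last 6 first.
- by [].
- apply/measurable_EFinP; apply: measurable_dotV; exact: measurable_cone_grad.
- apply/measurable_EFinP; apply: measurable_funD => //; apply: measurable_funM => //.
  by apply: measurable_funB => //; exact: measurable_funX.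
- by move=> x _; rewrite lee_fin dotV_ge0.
- move=> x _; rewrite lee_fin addr_ge0 ?sqr_ge0// mulr_ge0 ?sqr_ge0// subr_ge0.
  exact: T2_le_A.
- case: aex => N [mN N0 sN]; exists N; split => // y /= h; apply: sN => /= y0.
  by apply: h => _; rewrite dotV_cone_grad.
have fq : (\int[G]_x ((phi x - m) ^+ 2)%:E)%E \is a fin_num by exact: integrable_fin_num.
have isum : G.-integrable setT
    (EFin \o (fun x => (phi x - m) ^+ 2 + r ^+ 2 * (A x - T x ^+ 2))).
  exact: (integrableD measurableT iq irAT).
have fs : (\int[G]_x ((phi x - m) ^+ 2 + r ^+ 2 * (A x - T x ^+ 2))%:E)%E \is a fin_num.
  exact: integrable_fin_num.
rewrite -(fineK fq) -(fineK fs) -EFinM lee_fin.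
rewrite -/(Rintegral G setT (fun x => (phi x - m) ^+ 2)).
rewrite -/(Rintegral G setT (fun x => (phi x - m) ^+ 2 + r ^+ 2 * (A x - T x ^+ 2))).
(* With Q = E (phi - m) ^ 2, the two bounds read n Q <= Q + (n - 1) (E A - E T ^ 2), and n - 1 > 0
   is divided out. *)
rewrite RintegralD// RintegralZl// RintegralB// rn => h.
have n10 : 0 < n%:R - 1 :> R by rewrite subr_gt0 ltr1n.
rewrite -(ler_pM2l n10); lra.
Qed.

(* By convexity [phi - g 0 <= r * T], so the surplus [T ^+ 2] of the Poincare
   inequality pays for the atom at the origin. *)
Lemma sphere_variance_bound :
  \int[G]_x (phi x ^+ 2) - (\int[G]_x phi x) ^+ 2
   + n%:R^-1 * (\int[G]_x phi x - g 0) ^+ 2 <= \int[G]_x A x.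
Proof.
have [m c0] := exists_centering.
have S1 := le_trans (variance_le m sphi) (sphere_poincare c0).
set m0 := \int[G]_x phi x in S1 *.
have gT x : phi x - g 0 <= r * T x.
  have := glo (w x) 0; rewrite sub0r dotVNr /w /sphV dotVZr -/(w x) -/(phi x) -/(T x); lra.
have ic c : G.-integrable setT (EFin \o (fun _ : V => c)).
  exact: finite_measure_integrable_cst.
have iphic : G.-integrable setT (EFin \o (fun x => phi x - g 0)).
  exact: (integrableB measurableT iphi (ic (g 0))).
have up : m0 - g 0 <= r * \int[G]_x T x.
  rewrite -(Rintegral_prob_cst G (g 0)) /m0 -RintegralB//.
  rewrite -RintegralZl//; apply: le_Rintegral => //.
  exact: (integrableZl measurableT _ iT).
have odd0 : \int[G]_x dotV (a 0) (w x) = 0.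
  apply: (@Rintegral_odd _ _ _ (M * r)).
  - by apply: measurable_dotV.
  - move=> x; apply: (le_trans (normr_dotV_le_enorm _ _)).
    by apply: ler_pM; rewrite ?enorm_ge0// aM// enorm0.
  - by move=> x; rewrite /sphV unitVN scalerN dotVNr.
have iaw : G.-integrable setT (EFin \o (fun x => dotV (a 0) (w x))).
  apply: (bounded_integrable G (B := M * r)); first by apply: measurable_dotV.
  move=> x; apply: (le_trans (normr_dotV_le_enorm _ _)).
  by apply: ler_pM; rewrite ?enorm_ge0// aM// enorm0.
(* Squaring [up] requires a nonnegative left side. This is Jensen's inequality: the linear minorant
   of g at 0 has mean g 0 on the symmetric sphere. *)
have low : 0 <= m0 - g 0.
  rewrite subr_ge0 -(Rintegral_prob_cst G (g 0)) -[leLHS]addr0 -odd0 -RintegralD//.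
  apply: le_Rintegral => //; first exact: (integrableD measurableT (ic (g 0)) iaw).
  by move=> x _; have := glo 0 (w x); rewrite subr0.
have S2 : (m0 - g 0) ^+ 2 <= r ^+ 2 * \int[G]_x (T x ^+ 2).
  apply: (@le_trans _ _ ((r * \int[G]_x T x) ^+ 2)).
    by apply: lerXn2r; rewrite ?nnegrE// (le_trans low).
  by rewrite exprMn ler_wpM2l ?sqr_ge0//; exact: sqr_Rintegral_le.
have T0 : 0 <= \int[G]_x (T x ^+ 2) by apply: Rintegral_ge0 => x _; exact: sqr_ge0.
have n0 : 0 < n%:R :> R by rewrite ltr0n ltnW.
(* The weight 1 / n is enough because r ^ 2 = n - 1 <= n. *)
have S3 : n%:R^-1 * (m0 - g 0) ^+ 2 <= \int[G]_x (T x ^+ 2).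
  rewrite ler_pdivrMl//; apply: (le_trans S2); rewrite rn ler_wpM2r//; lra.
apply: (le_trans (lerD S1 S3)); lra.
Qed.

End sphere_variance.

(** * The extremal measures *)

Section atomic_mixture.
Context d1 d2 (S : measurableType d1) (T : measurableType d2) (R : realType).
Variables (P : probability S R) (phi : {mfun S >-> T}) (a : T) (p : R).
Hypothesis p01 : 0 <= p <= 1.

Let p_ge0 : 0 <= p. Proof. by have /andP[] := p01. Qed.
Let q_ge0 : 0 <= 1 - p. Proof. by have /andP[_] := p01; rewrite subr_ge0. Qed.

Definition atom_part : {measure set T -> \bar R} := mscale (NngNum p_ge0) (\d_a).
Definition law_part : {measure set T -> \bar R} :=
  mscale (NngNum q_ge0) (distribution P phi).

Definition atomic_mixture_measure : set T -> \bar R := measure_add atom_part law_part.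

HB.instance Definition _ := Measure.on atomic_mixture_measure.

Lemma atomic_mixtureE (A : set T) :
  atomic_mixture_measure A = (p%:E * (\1_A a)%:E + (1 - p)%:E * P (phi @^-1` A))%E.
Proof. by rewrite /atomic_mixture_measure measure_addE. Qed.

Let atomic_mixture_setT : atomic_mixture_measure setT = 1%E.
Proof.
rewrite atomic_mixtureE preimage_setT probability_setT.
by rewrite indicT !mule1 -EFinD addrC subrK.
Qed.

HB.instance Definition _ :=
  Measure_isProbability.Build _ _ _ atomic_mixture_measure atomic_mixture_setT.

Definition atomic_mixture : probability T R := atomic_mixture_measure.

Lemma atomic_mixture_atom (A : set T) : A a -> (p%:E <= atomic_mixture A)%E.
Proof.
move=> Aa; rewrite [atomic_mixture A]atomic_mixtureE indicE mem_set// mule1 leeDl//.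
by rewrite mule_ge0.
Qed.

Lemma ge0_integral_atomic_mixture (f : T -> \bar R) :
  measurable_fun setT f -> (forall x, 0 <= f x)%E ->
  (\int[atomic_mixture]_x f x = p%:E * f a + (1 - p)%:E * \int[P]_x f (phi x))%E.
Proof.
move=> mf f0.
have := @ge0_integral_measure_add _ _ _ atom_part law_part setT measurableT f
  (fun x _ => f0 x) mf.
rewrite /atomic_mixture/= => ->; congr (_ + _)%E.
  by rewrite ge0_integral_mscale// integral_dirac// diracT mul1e.
by rewrite ge0_integral_mscale// ge0_integral_pushforward.
Qed.

Lemma ge0_Rintegral_atomic_mixture (f : T -> R) (B : R) :
  measurable_fun setT f -> (forall x, 0 <= f x) -> (forall x, `|f (phi x)| <= B) ->
  atomic_mixture.-integrable setT (EFin \o f) /\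
  \int[atomic_mixture]_x f x = p * f a + (1 - p) * \int[P]_x f (phi x).
Proof.
move=> mf f0 fB.
have iP : P.-integrable setT (EFin \o (f \o phi)).
  by apply: bounded_integrable fB; exact: measurableT_comp.
have E : (\int[atomic_mixture]_x (f x)%:E =
    (p * f a + (1 - p) * \int[P]_x f (phi x))%:E)%E.
  rewrite ge0_integral_atomic_mixture//; last 1 first.
  - exact/measurable_EFinP.
  have <- : ((\int[P]_x f (phi x))%:E = \int[P]_x (f (phi x))%:E)%E.
    by rewrite /Rintegral fineK//; exact: integrable_fin_num.
  by rewrite -!EFinM -EFinD.
split; last by rewrite /Rintegral E.
apply/integrableP; split; first exact/measurable_EFinP.
rewrite (eq_integral (fun x => (f x)%:E)); last by move=> x _ /=; rewrite ger0_norm.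
by rewrite E ltry.
Qed.

(** Written as (f + |f|) - |f|, the function is a difference of nonnegative ones. *)
Lemma Rintegral_atomic_mixture (f : T -> R) (B : R) :
  measurable_fun setT f -> (forall x, `|f (phi x)| <= B) ->
  atomic_mixture.-integrable setT (EFin \o f) /\
  \int[atomic_mixture]_x f x = p * f a + (1 - p) * \int[P]_x f (phi x).
Proof.
move=> mf fB.
have mn : measurable_fun setT (fun x => `|f x|) by exact: measurableT_comp.
have mP : measurable_fun setT (f \o phi) by exact: measurableT_comp.
have nB x : `| `|f (phi x)| | <= B by rewrite normr_id.
have [i1 E1] := @ge0_Rintegral_atomic_mixture (fun x => `|f x|) B mn
  (fun x => normr_ge0 _) nB.
have g0 x : 0 <= f x + `|f x| by rewrite -lerBlDl sub0r ler_normr lexx orbT.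
have gB x : `|f (phi x) + `|f (phi x)| | <= B + B.
  by rewrite (le_trans (ler_normD _ _))// normr_id lerD.
have [i2 E2] := @ge0_Rintegral_atomic_mixture (fun x => f x + `|f x|) (B + B)
  (measurable_funD mf mn) g0 gB.
have fE : f = (fun x => (f x + `|f x|) - `|f x|) by apply/funext => x; rewrite addrK.
have iP := bounded_integrable P mP fB.
have iPn : P.-integrable setT (EFin \o (fun x => `|f (phi x)|)).
  exact: (integrable_norm iP).
split.
  by rewrite fE; exact: (integrableB measurableT i2 i1).
rewrite [in LHS]fE (RintegralB measurableT i2 i1) E1 E2 RintegralD//.
ring.
Qed.

End atomic_mixture.

Section square_integrable.
Context d (T : measurableType d) (R : realType) (P : probability T R).
Implicit Types f : T -> R.

Lemma sqint_Lfun f : sqint P f -> f \in Lfun P 2%:E.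
Proof.
move=> [mf if2]; apply/andP; split; rewrite inE//=.
rewrite /finite_norm/= unlock /Lnorm poweR_lty//.
have /integrableP[_] := if2; apply: le_lt_trans.
rewrite le_eqVlt; apply/orP; left; apply/eqP; apply: eq_integral => x _.
transitivity (`|(f x)%:E| `^ 2)%E => //; rewrite !abse_EFin poweR_EFin.
by rewrite powR_mulrn// real_normK ?num_real// ger0_norm ?sqr_ge0//.
Qed.

Lemma sqint_integrable f : sqint P f -> P.-integrable setT (EFin \o f).
Proof.
move=> sf; have := Lfun_subset12 (fin_num_measure P _ measurableT) (sqint_Lfun sf).
by move=> /Lfun1_integrable.
Qed.

Lemma sqint_expectation f : sqint P f ->
  ('E_P[fun x => (f x ^+ 2)%R] - 'E_P[f] ^+ 2)%E =
  (\int[P]_x (f x ^+ 2) - (\int[P]_x f x) ^+ 2)%:E.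
Proof.
move=> sf; have i1 := sqint_integrable sf.
rewrite unlock EFinB EFin_expe /Rintegral !fineK//.
- exact: integrable_fin_num.
- by apply: integrable_fin_num => //; exact: sf.2.
Qed.

(** The integral of a nonnegative function is a supremum over simple functions below it. This admits
    [grad_norm] on the larger side, of which no measurability is established. *)
Lemma ge0_le_integral_any (h F : T -> \bar R) : (forall x, 0 <= h x)%E ->
  (forall x, h x <= F x)%E -> (\int[P]_x h x <= \int[P]_x F x)%E.
Proof.
move=> h0 hF; rewrite !ge0_integralTE//; last by move=> x; exact: le_trans (hF x).
apply: le_ereal_sup => _ [k kh <-]; exists k => // x; exact: le_trans (kh x) (hF x).
Qed.

End square_integrable.

(** * The convex Poincare inequality for the sphere with an atom at its centre *)

Section sphere_mixture.
Context {R : realType} (n : nat).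
Local Notation G := (@normalV R n).
Local Notation V := (borel_rV R n).
Hypothesis n1 : (1 < n)%N.
Implicit Types (x y : 'rV[R]_n) (f : 'rV[R]_n -> R).

Definition sphV_map (r : R) : V -> V := sphV r.

HB.instance Definition _ (r : R) :=
  isMeasurableFun.Build _ _ V V (sphV_map r) (@measurable_sphV R n r).

Let p : R := n%:R^-1.
Let r : R := Num.sqrt (n%:R - 1).

Lemma invn01 : 0 <= (n%:R^-1 : R) <= 1.
Proof. by rewrite invr_ge0 ler0n invf_le1 ?ler1n ?ltr0n// ltnW. Qed.

(** The uniform law on the sphere is realised as the law of r X / |X| with X Gaussian. *)
Definition sphere_mixture : probability V R := atomic_mixture G (sphV_map r) 0 invn01.
Local Notation mu := sphere_mixture.

Let r0 : 0 <= r. Proof. exact: sqrtr_ge0. Qed.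
Let rn : r ^+ 2 = n%:R - 1.
Proof. by rewrite sqr_sqrtr// subr_ge0 ler1n ltnW. Qed.

Lemma Rintegral_sphere_mixture f (B : R) : measurable_fun setT (f : V -> R) ->
  (forall x, enorm x <= r -> `|f x| <= B) ->
  mu.-integrable setT (EFin \o (f : V -> R)) /\
  \int[mu]_x f x = p * f 0 + (1 - p) * \int[G]_x f (sphV r x).
Proof.
move=> mf fB; have h := @Rintegral_atomic_mixture _ _ V V R G (sphV_map r) 0 _ invn01 f B mf.
apply: h => x.
by apply: fB; exact: enorm_sphV_le.
Qed.

Lemma sqint_sphere_mixture f (B : R) : measurable_fun setT (f : V -> R) ->
  (forall x, enorm x <= r -> `|f x| <= B) -> sqint mu (f : V -> R).
Proof.
move=> mf fB; split => //.
have [] // := @Rintegral_sphere_mixture (fun x => f x ^+ 2) (B ^+ 2).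
- exact: measurable_funX.
- move=> x xr; rewrite normrX; apply: lerXn2r; rewrite ?nnegrE ?fB//.
  exact: le_trans (fB x xr).
Qed.

Lemma le_Rintegral_sphere_mixture (f h : 'rV[R]_n -> R) (B : R) :
  measurable_fun setT (f : V -> R) -> measurable_fun setT (h : V -> R) ->
  (forall x, enorm x <= r -> `|f x| <= B) -> (forall x, enorm x <= r -> `|h x| <= B) ->
  (forall x, enorm x <= r -> f x <= h x) ->
  \int[mu]_x f x <= \int[mu]_x h x.
Proof.
move=> mf mh fB hB fh.
have [_ ->] := Rintegral_sphere_mixture mf fB.
have [_ ->] := Rintegral_sphere_mixture mh hB.
have /andP[p0 p1] := invn01.
have S x : enorm (sphV r x) <= r by exact: enorm_sphV_le.
apply: lerD; first by rewrite ler_wpM2l// fh// enorm0.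
rewrite ler_wpM2l ?subr_ge0//; apply: le_Rintegral => //.
- by apply: (bounded_integrable G (B := B)) => [|x]; [exact: (measurableT_comp mf (measurable_sphV r))|exact: fB].
- by apply: (bounded_integrable G (B := B)) => [|x]; [exact: (measurableT_comp mh (measurable_sphV r))|exact: hB].
- by move=> x _; exact: fh.
Qed.

Section moreau.
Variables (f : 'rV[R]_n -> R) (lam : R).
Hypotheses (cf : convex_function (E := 'rV[R]_n) setT f) (lam0 : 0 < lam).
Local Notation g := (moreau_env cf lam0).
Local Notation a := (moreau_grad cf lam0).

Let mg : measurable_fun setT (g : V -> R). Proof. exact: measurable_moreau_env. Qed.
Let ma : measurable_fun setT (a : V -> V). Proof. exact: measurable_moreau_grad. Qed.

Lemma moreau_bounded : exists M, forall x, enorm x <= r -> `|g x| <= M /\ enorm (a x) <= M.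
Proof.
have l0 := lam0.
have [M1 M10 HM1] := convex_bounded cf r0.
have r1 : 0 <= r + 1 by rewrite addr_ge0.
have [L L0 HL] := convex_lipschitz_ball cf r1.
exists (M1 + lam * L ^+ 2 / 2 + enorm (a 0) + lam^-1 * r) => x xr.
have e0 : 0 <= lam * L ^+ 2 / 2 by rewrite divr_ge0// mulr_ge0 ?sqr_ge0// ltW.
have e1 : 0 <= lam^-1 * r by rewrite mulr_ge0// invr_ge0 ltW.
have e2 := enorm_ge0 (a 0).
split.
  have := moreau_env_le cf lam0 x; have := moreau_env_ge cf lam0 r0 L0 HL xr.
  have := HM1 x xr; rewrite !ler_norml => /andP[h1 h2] h3 h4; apply/andP; split; lra.
have h := moreau_grad_lipschitz cf lam0 x 0; rewrite subr0 in h.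
have := enormD (a x - a 0) (a 0); rewrite subrK => h2.
have : lam^-1 * enorm x <= lam^-1 * r by rewrite ler_wpM2l// invr_ge0 ltW.
lra.
Qed.

Lemma sphere_mixture_variance_moreau :
  ((\int[mu]_x (g x ^+ 2) - (\int[mu]_x g x) ^+ 2)%R%:E <= \int[mu]_x (dotV (a x) (a x))%:E)%E.
Proof.
have [M HM] := moreau_bounded.
have gM x (xr : enorm x <= r) := (HM x xr).1.
have aM x (xr : enorm x <= r) := (HM x xr).2.
have K0 : 0 <= (2 * lam)^-1 by rewrite invr_ge0 mulr_ge0// ltW.
have gup x z : g z <= g x + dotV (a x) (z - x) + (2 * lam)^-1 * dotV (z - x) (z - x).
  by rewrite [_^-1 * _]mulrC; exact: moreau_env_upper.
have key := sphere_variance_bound n1 r0 rn K0 mg ma (moreau_env_lower cf lam0) gup gM aM.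
have mA : measurable_fun setT (fun x : V => dotV (a x) (a x)) by exact: measurable_dotV.
have AM x : enorm x <= r -> `|dotV (a x) (a x)| <= M ^+ 2.
  move=> xr; rewrite ger0_norm ?dotV_ge0// -enorm_sqr.
  by apply: lerXn2r; rewrite ?nnegrE ?enorm_ge0// ?aM// (le_trans (enorm_ge0 _) (aM x xr)).
have g2M x : enorm x <= r -> `|g x ^+ 2| <= M ^+ 2.
  move=> xr; rewrite normrX; apply: lerXn2r; rewrite ?nnegrE ?gM//.
  exact: le_trans (gM x xr).
have [iA EA] := Rintegral_sphere_mixture mA AM.
have [_ E1] := Rintegral_sphere_mixture mg gM.
have [_ E2] := Rintegral_sphere_mixture (measurable_funX 2 mg) g2M.
rewrite -(fineK (integrable_fin_num measurableT iA)) lee_fin.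
rewrite -/(Rintegral mu setT (fun x => dotV (a x) (a x))) EA E1 E2.
have /andP[p0 p1] := invn01; move: key p0 p1; rewrite -/p.
have := dotV_ge0 (a 0).
set I1 := \int[G]_x dotV _ _; set I2 := \int[G]_x (g _ ^+ 2); set I3 := \int[G]_x g _.
move=> d0 key p0 p1.
(* By the law of total variance, the variance under [mu] is 1 - p times the inner bracket. The
   gradient at the atom only adds p |a 0| ^ 2 on the other side. *)
have : 0 <= (1 - p) * (I1 - (I2 - I3 ^+ 2 + p * (I3 - g 0) ^+ 2)).
  by rewrite mulr_ge0// subr_ge0.
have := mulr_ge0 p0 d0; nra.
Qed.

End moreau.

Lemma sphere_mixture_convex_poincare : convex_poincare mu 1.
Proof.
move=> f cf rhs _.
have r1 : 0 <= r + 1 by rewrite addr_ge0.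
have [L L0 HL] := convex_lipschitz_ball cf r1.
have [B B0 HB] := convex_bounded cf r0.
have mf : measurable_fun setT (f : V -> R).
  by apply: continuous_measurable_rV; exact: convex_continuous.
have sf := sqint_sphere_mixture mf HB.
split; first exact: sqint_Lfun.
rewrite (sqint_expectation sf) /rhs mul1e.
apply/lee_addgt0Pr => e e0.
(* If 0 <= f - g <= eta <= 1 and |g|, |k| <= B + 1, then (f - k) ^ 2 exceeds (g - k) ^ 2 by at most
   eta + 2 eta (2 (B + 1)) = eta K. *)
pose K := 1 + 4 * (B + 1).
have K0 : 0 < K by rewrite /K; lra.
pose eta := Num.min 1 (e / K).
have eta0 : 0 < eta by rewrite lt_min ltr01 divr_gt0.
have eta1 : eta <= 1 by rewrite ge_min lexx.
have etaK : eta * K <= e by rewrite -ler_pdivlMr// ge_min lexx orbT.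
have L1 : 0 < L ^+ 2 + 1 by rewrite ltr_wpDl ?sqr_ge0.
(* This parameter keeps the envelope error lam L ^ 2 / 2 of [moreau_env_ge] below eta; the summand 1
   covers L = 0. *)
have lam0 : 0 < 2 * eta / (L ^+ 2 + 1) by rewrite divr_gt0// mulr_gt0.
have lamL : 2 * eta / (L ^+ 2 + 1) * L ^+ 2 / 2 <= eta.
  rewrite (_ : _ / 2 = eta * (L ^+ 2 / (L ^+ 2 + 1))); last by field; rewrite gt_eqF.
  rewrite ler_piMr ?(ltW eta0)// ler_pdivrMr// mul1r; lra.
set lam := 2 * eta / _ in lam0 lamL.
pose g := moreau_env cf lam0.
have mg : measurable_fun setT (g : V -> R) by exact: measurable_moreau_env.
have gf x : enorm x <= r -> f x - eta <= g x <= f x.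
  move=> xr; rewrite (moreau_env_le cf lam0 x) andbT.
  have := moreau_env_ge cf lam0 r0 L0 HL xr; rewrite -/g; lra.
have gB x : enorm x <= r -> `|g x| <= B + 1.
  move=> xr; have := gf x xr; have := HB x xr.
  rewrite !ler_norml => /andP[h1 h2] /andP[h3 h4]; apply/andP; split; lra.
have sg := sqint_sphere_mixture mg gB.
pose k := \int[mu]_x g x.
have B1 : 0 <= B + 1 by rewrite addr_ge0.
have kB : `|k| <= B + 1.
  rewrite ler_norml; apply/andP; split.
  - rewrite -(Rintegral_prob_cst mu (- (B + 1))).
    apply: (@le_Rintegral_sphere_mixture (fun=> _) g (B + 1)) => // x xr.
      by rewrite normrN ger0_norm.
    by have := gB x xr; rewrite ler_norml => /andP[].
  - rewrite -(Rintegral_prob_cst mu (B + 1)).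
    apply: (@le_Rintegral_sphere_mixture g (fun=> _) (B + 1)) => // x xr.
      by rewrite ger0_norm.
    by have := gB x xr; rewrite ler_norml => /andP[].
have mfk : measurable_fun setT (fun x : V => (f x - k) ^+ 2).
  by apply: measurable_funX; exact: measurable_funB.
have mgk : measurable_fun setT (fun x : V => (g x - k) ^+ 2).
  by apply: measurable_funX; exact: measurable_funB.
have sqB u : `|u| <= B + 1 -> `|(u - k) ^+ 2| <= (2 * (B + 1)) ^+ 2.
  move=> uB; rewrite normrX; apply: lerXn2r; rewrite ?nnegrE// ?mulr_ge0//.
  by apply: (le_trans (ler_normB _ _)); rewrite mulr2n mulrDl !mul1r lerD.
have [ig _] := Rintegral_sphere_mixture mgk (fun x xr => sqB _ (gB x xr)).
have V1 : \int[mu]_x ((f x - k) ^+ 2) <= \int[mu]_x ((g x - k) ^+ 2) + eta * K.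
  have iK : mu.-integrable setT (EFin \o (fun _ : V => eta * K)).
    exact: finite_measure_integrable_cst.
  rewrite -[X in _ + X](Rintegral_prob_cst mu) -RintegralD//.
  apply: (@le_Rintegral_sphere_mixture _ _ ((2 * (B + 1)) ^+ 2 + eta * K)) => //.
  - exact: measurable_funD.
  - move=> x xr; apply: (le_trans (sqB (f x) _)); first by rewrite (le_trans (HB x xr))// lerDl.
    by rewrite lerDl mulr_ge0// ltW.
  - move=> x xr; rewrite (le_trans (ler_normD _ _))// (ger0_norm (mulr_ge0 (ltW eta0) (ltW K0))).
    by rewrite lerD2r sqB// gB.
  - move=> x xr; have := gf x xr => /andP[h1 h2].
    have := gB x xr; move: kB; rewrite !ler_norml => /andP[k1 k2] /andP[g1 g2].
    have a0 : 0 <= f x - g x by lra.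
    have a1 : f x - g x <= eta by lra.
    have a2 : g x - k <= 2 * (B + 1) by lra.
    have s1 : (f x - g x) * (f x - g x) <= eta * 1.
      by apply: ler_pM => //; exact: le_trans a1 eta1.
    have s2 : (f x - g x) * (g x - k) <= eta * (2 * (B + 1)).
      have := ler_wpM2l a0 a2.
      have := ler_wpM2r (mulr_ge0 (ler0n R 2) B1) a1; lra.
    have -> : (f x - k) ^+ 2 = (f x - g x) * (f x - g x) + 2 * ((f x - g x) * (g x - k)) + (g x - k) ^+ 2.
      by ring.
    rewrite /K; lra.
have V2 := le_trans (variance_le k sf) V1.
rewrite (Rintegral_sqr_sub k sg) -/k in V2.
apply: (@le_trans _ _ ((\int[mu]_x (g x ^+ 2) - k ^+ 2)%:E + e%:E)%E).
  rewrite -EFinD lee_fin; lra.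
rewrite leeD2r// (le_trans (sphere_mixture_variance_moreau cf lam0))//.
apply: ge0_le_integral_any => x; first by rewrite lee_fin dotV_ge0.
by apply: moreau_grad_sqr_le; exact: ltnW.
Qed.

End sphere_mixture.

Section identity.
Context {d} {T : measurableType d}.

Definition idM : T -> T := fun x => x.

HB.instance Definition _ := isMeasurableFun.Build _ _ T T idM (@measurable_id _ T setT).

End identity.

(** * A two-point law satisfying the convex Poincare inequality *)

Section two_points.
Context {R : realType} (n : nat).
Local Notation V := (borel_rV R n).
Variable e : 'rV[R]_n.
Hypothesis e1 : enorm e = 1.

Lemma half01 : 0 <= (2^-1 : R) <= 1.
Proof. by apply/andP; split; lra. Qed.

(* The radius [sqrt (d - 1)] degenerates for [d = 1]; there this measure bounds
   the set of deviation constants. *)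
Definition two_point : probability V R :=
  atomic_mixture (\d_(e : V)) (@idM _ V) (0 : V) half01.

Let e_neq0 : e != 0.
Proof. by apply/negP => /eqP e0; move: e1; rewrite e0 enorm0 => /esym/eqP; rewrite oner_eq0. Qed.

Lemma Rintegral_two_point (f : V -> R) : measurable_fun setT f ->
  [/\ sqint two_point f, \int[two_point]_x f x = (f 0 + f e) / 2 &
    \int[two_point]_x (f x ^+ 2) = (f 0 ^+ 2 + f e ^+ 2) / 2].
Proof.
move=> mf.
have E (h : V -> R) : measurable_fun setT h -> (forall x, 0 <= h x) ->
    (\int[two_point]_x (h x)%:E = ((h 0 + h e) / 2)%:E)%E.
  move=> mh h0; rewrite ge0_integral_atomic_mixture//; last exact/measurable_EFinP.
  rewrite integral_dirac//; last exact/measurable_EFinP.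
  rewrite diracT mul1e -!EFinM -EFinD; congr EFin; rewrite /idM; lra.
have m2 : measurable_fun setT (fun x => f x ^+ 2) by exact: measurable_funX.
have mn : measurable_fun setT (fun x => `|f x|) by exact: measurableT_comp.
have sf : sqint two_point f.
  split => //; apply/integrableP; split; first exact/measurable_EFinP.
  rewrite (eq_integral (fun x => (f x ^+ 2)%:E)).
    by rewrite E ?ltry// => x; exact: sqr_ge0.
  by move=> x _ /=; rewrite ger0_norm ?sqr_ge0.
split => //; last by rewrite /Rintegral E// => x; exact: sqr_ge0.
have i1 := sqint_integrable sf.
have in1 : two_point.-integrable setT (EFin \o (fun x => `|f x|)) by exact: (integrable_norm i1).
have ip := integrableD measurableT i1 in1.
have p0 x : 0 <= f x + `|f x| by rewrite -lerBlDl sub0r ler_normr lexx orbT.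
have E1 := E _ (measurable_funD mf mn) p0.
have E2 := E _ mn (fun x => normr_ge0 _).
have : \int[two_point]_x (f x + `|f x|) = \int[two_point]_x f x + \int[two_point]_x `|f x|.
  exact: RintegralD.
rewrite {1}/Rintegral E1 [X in _ = _ + X]/Rintegral E2/=; lra.
Qed.

(** The variance is (f e - f 0) ^ 2 / 4. At the point with the larger value, the slope towards the
    other is |f e - f 0|, so that point alone contributes at least half its square to the right
    side. *)
Lemma two_point_convex_poincare : (0 < n)%N -> convex_poincare two_point 1.
Proof.
move=> n0 f cf rhs _.
have mf : measurable_fun setT (f : V -> R).
  by apply: continuous_measurable_rV; exact: convex_continuous.
have [sf E1 E2] := Rintegral_two_point mf.
split; first exact: sqint_Lfun.
rewrite (sqint_expectation sf) E1 E2 /rhs mul1e.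
have grad0 x : (0 <= grad_norm f x ^+ 2)%E by rewrite expe2 mule_ge0// grad_norm_ge0.
have key (a b : 'rV[R]_n) : enorm (a - b) = 1 -> f b <= f a ->
    (((f a - f b) ^+ 2)%:E <= grad_norm f a ^+ 2)%E.
  move=> ab1 fab; rewrite EFin_expe !expe2.
  have ab : a != b.
    apply/negP => /eqP abE; move: ab1; rewrite abE subrr enorm0 => /esym/eqP.
    by rewrite oner_eq0.
  have := grad_norm_ge_slope cf ab; rewrite ab1 divr1 => h.
  by apply: lee_pmul => //; rewrite lee_fin subr_ge0.
have [q [qE qh]] : exists q : 'rV[R]_n, (q = 0 \/ q = e) /\
    (((f e - f 0) ^+ 2)%:E <= grad_norm f q ^+ 2)%E.
  have [fe|/ltW fe] := leP (f 0) (f e).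
    by exists e; split; [right|apply: key; rewrite ?subr0].
  exists 0; split; [by left|rewrite -sqrrN opprB; apply: key => //].
  by rewrite sub0r enormN.
(* A measurable minorant of the squared slope, carried by the single point [q]. *)
pose h (x : V) := (f e - f 0) ^+ 2 * \1_[set q] x.
have mh : measurable_fun setT h.
  apply: measurable_funM => //; apply: measurable_indic; exact: measurable_set1_rV.
have h0 x : 0 <= h x by rewrite mulr_ge0 ?sqr_ge0.
apply: (@le_trans _ _ (\int[two_point]_x (h x)%:E)%E); last first.
  apply: ge0_le_integral_any => x; first by rewrite lee_fin.
  rewrite /h indicE; have [|] := boolP (x \in [set q]).
    by rewrite inE => /= ->; rewrite mulr1.
  by rewrite mulr0.
have [sh Eh _] := Rintegral_two_point mh.
rewrite -(fineK (integrable_fin_num measurableT (sqint_integrable sh))) lee_fin.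
rewrite -/(Rintegral two_point setT h) Eh /h -mulrDr.
have -> : \1_[set q] (0 : V) + \1_[set q] (e : V) = 1 :> R.
  rewrite !indicE; case: qE => ->.
    rewrite mem_set// memNset ?addr0//= => e0; by have := e_neq0; rewrite e0 eqxx.
  by rewrite memNset ?add0r ?mem_set//= => e0; have := e_neq0; rewrite -e0 eqxx.
have := sqr_ge0 (f e - f 0); nra.
Qed.

End two_points.

(** * Deviation constants *)

Section deviation_constants.
Context {R : realType} (n : nat).
Local Notation V := (borel_rV R n).

Lemma enorm_convex : convex_function (E := 'rV[R]_n) setT (@enorm R n).
Proof.
apply: convex_functionP => t x y t0 t1; apply: (le_trans (enormD _ _)).
by rewrite !enormZ !ger0_norm// subr_ge0.
Qed.

Lemma enorm_lipschitz1 : lipschitz1 (@enorm R n).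
Proof. by move=> x y; exact: enorm_sub_le. Qed.

(** The deviation inequality is tested on the Euclidean norm at t equal to its mean: the event then
    contains the origin, whence p <= 2 exp (- c t). *)
Lemma deviation_constant_le (mu : probability V R) (p t c : R) : 0 < p -> 0 < t ->
  convex_poincare mu 1 -> (forall A : set V, A (0 : 'rV[R]_n)%R -> (p%:E <= mu A)%E) ->
  ('E_mu[fun x => enorm x] = t%:E)%E -> deviation_constant n c -> c <= ln (2 / p) / t.
Proof.
move=> p0 t0 pmu pA Et dc.
have law : has_law mu (@idM _ V) mu by [].
have := dc mu pmu _ _ mu (@idM _ V) law _ enorm_convex enorm_lipschitz1 t (ltW t0).
move=> h; have {h} : (p%:E <= (2 * expR (- (c * t)))%:E)%E.
  apply: le_trans h; apply: pA => /=.
  by rewrite /idM Et subee// enorm0.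
rewrite lee_fin => h; rewrite ler_pdivlMr// -ler_expR lnK ?posrE ?divr_gt0//.
rewrite ler_pdivlMr//; move: h; rewrite expRN -/(2 / _) ler_pdivlMr ?expR_gt0//.
by rewrite mulrC.
Qed.

Lemma deviation_constant0 : deviation_constant n (0 : R).
Proof.
move=> mu _ disp Omega P X _ f cf lf t t0; rewrite mul0r oppr0 expR0 mulr1.
apply: (@le_trans _ _ 1%E); last by rewrite lee_fin ler1n.
apply: probability_le1.
have mf : measurable_fun setT (f \o X).
  apply: measurableT_comp => //; apply: continuous_measurable_rV; exact: convex_continuous.
rewrite -[X in measurable X]setTI; apply: emeasurable_fun_infty_c => //.
exact/measurable_EFinP.
Qed.

(** For given data with t > 0 and event of probability y > 0, the inequality says c <= ln (2 / y) /
    t, a condition that passes to the supremum. For t = 0 it does not depend on c, and for y = 0 it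
    is trivial. *)
Lemma largest_deviation_constantP (b : R) : (forall c, deviation_constant n c -> c <= b) ->
  deviation_constant n (largest_deviation_constant R n) /\
  (forall c, deviation_constant n c -> c <= largest_deviation_constant R n).
Proof.
move=> Sb; pose S := [set c : R | deviation_constant n c].
have S0 : S !=set0 by exists 0; exact: deviation_constant0.
have uS : has_ubound S by exists b.
split; last by move=> c Sc; exact: ub_le_sup.
move=> mu pmu disp Omega P X law f cf lf t.
rewrite le_eqVlt => /predU1P[<-|t0].
  have := deviation_constant0 pmu law cf lf (lexx 0).
  by rewrite !mulr0.
set A := [set w | _].
have bA c : S c -> (P A <= (2 * expR (- (c * t)))%:E)%E.
  by move=> Sc; exact: (Sc mu pmu _ _ P X law f cf lf t (ltW t0)).
have PA : P A \is a fin_num.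
  by rewrite ge0_fin_numE//; apply: (le_lt_trans (bA _ deviation_constant0)); exact: ltry.
rewrite -(fineK PA) lee_fin; set y := fine (P A).
have y0 : 0 <= y by rewrite fine_ge0.
move: y0; rewrite le_eqVlt => /predU1P[<-|y0].
  by rewrite mulr_ge0// expR_ge0.
suff h : sup S <= ln (2 / y) / t.
  rewrite expRN -/(2 / _) ler_pdivlMr ?expR_gt0// mulrC -ler_pdivlMr//.
  by rewrite -[leRHS]lnK ?posrE ?divr_gt0// ler_expR -ler_pdivlMr.
apply: ge_sup => // c Sc.
rewrite ler_pdivlMr// -ler_expR lnK ?posrE ?divr_gt0// ler_pdivlMr//.
have := bA c Sc; rewrite -(fineK PA) lee_fin -/y expRN -/(2 / _) ler_pdivlMr ?expR_gt0//.
by rewrite mulrC.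
Qed.

Lemma deviation_constant_bounded : (0 < n)%N -> 
  exists b : R, forall c, deviation_constant n c -> c <= b.
Proof.
move=> n0; pose e : 'rV[R]_n := delta_mx ord0 (Ordinal n0).
have e1 : enorm e = 1.
  rewrite /enorm (bigD1 (Ordinal n0))//= big1 => [|i /negbTE i0]; last first.
    by rewrite mxE eqxx i0 expr0n.
  by rewrite mxE !eqxx expr1n addr0 sqrtr1.
exists (ln (2 / 2^-1) / 2^-1) => c Sc.
apply: (deviation_constant_le _ _ (two_point_convex_poincare e1 n0)) => //.
  by move=> A A0; exact: atomic_mixture_atom.
have [sf E _] := Rintegral_two_point e (@measurable_enorm R n).
rewrite unlock -(fineK (integrable_fin_num measurableT (sqint_integrable sf))).
by rewrite -/(Rintegral _ _ _) E enorm0 e1 add0r mul1r.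
Qed.

Lemma deviation_constant_le_sphere (c : R) : (1 < n)%N -> deviation_constant n c ->
  c <= n%:R * ln (2 * n%:R) / (n%:R - 1) `^ (3 / 2).
Proof.
move=> n1 Sc; have n0 : 0 < n%:R :> R by rewrite ltr0n ltnW.
have n10 : 0 < n%:R - 1 :> R by rewrite subr_gt0 ltr1n.
set r : R := Num.sqrt (n%:R - 1).
have r0 : 0 < r by rewrite sqrtr_gt0.
have t0 : 0 < (1 - n%:R^-1) * r.
  by rewrite mulr_gt0// subr_gt0 invf_lt1// ltr1n.
have -> : n%:R * ln (2 * n%:R) / (n%:R - 1) `^ (3 / 2) =
    ln (2 / n%:R^-1) / ((1 - n%:R^-1) * r).
  rewrite (_ : 3 / 2 = 1 + 2^-1); last lra.
  rewrite powRD ?gt_eqF ?implybT// powRr1 ?ltW// powR12_sqrt ?ltW// -/r invrK.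
  by field; rewrite !gt_eqF.
have cp := @sphere_mixture_convex_poincare R n n1.
have h := deviation_constant_le _ _ cp.
apply: h => //.
- by rewrite invr_gt0.
- by move=> A A0; exact: atomic_mixture_atom.
have er (x : 'rV[R]_n) : enorm x <= r -> `|enorm x| <= r by rewrite ger0_norm ?enorm_ge0.
have [iE E] := Rintegral_sphere_mixture n1 (@measurable_enorm R n) er.
rewrite unlock -(fineK (integrable_fin_num measurableT iE)).
rewrite -/(Rintegral _ _ _) E enorm0 mulr0 add0r; congr EFin; congr (_ * _).
rewrite -[RHS](Rintegral_prob_cst (normalV n)) /Rintegral; congr fine.
(* The norm of [sphV r x] equals r except at the origin, which is a Gaussian null set. *)
apply: ge0_ae_eq_integral => //.
- apply/measurable_EFinP.
  exact: (measurableT_comp (@measurable_enorm R n) (measurable_sphV _)).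
- by move=> x _; rewrite lee_fin enorm_ge0.
- by move=> x _; rewrite lee_fin ltW.
exists [set 0]; split; [exact: measurable_set1_rV|by apply: normalV_set0; exact: ltnW|].
move=> x /= h; apply: contrapT => /eqP x0; apply: h => _.
by rewrite /sphV enormZ enorm_unitV// mulr1 gtr0_norm.
Qed.

End deviation_constants.

(** * Asymptotics of the bound *)

Lemma sphere_bound_rate (R : realType) (e : R) : 0 < e ->
  exists N : nat, forall d : nat, (N <= d)%N ->
  d%:R * ln (2 * d%:R) / (d%:R - 1) `^ (3 / 2) * Num.sqrt d%:R / ln d%:R <= 1 + e.
Proof.
(* The quotient is a product of three factors, each at most 1 + delta, and (1 + delta) ^ 3 <= 1 + 7
   delta for delta <= 1. *)
move=> e0; pose delta := Num.min 1 (e / 7).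
have d0 : 0 < delta by rewrite lt_min ltr01 divr_gt0.
have d1 : delta <= 1 by rewrite ge_min lexx.
have de : 7 * delta <= e by rewrite mulrC -ler_pdivlMr// ge_min lexx orbT.
(* The first two terms make x / (x - 1) <= 1 + delta, and hence also its square root; the last one
   makes ln 2 / ln x <= delta. *)
pose b := 2 + delta^-1 + expR (ln 2 / delta).
have iv0 : 0 < delta^-1 by rewrite invr_gt0.
have b0 : 0 <= b by rewrite /b; have := expR_gt0 (ln 2 / delta); lra.
exists (Num.truncn b).+1 => d Nd.
have bd : b < d%:R by apply: (lt_le_trans (truncnS_gt b)); rewrite ler_nat.
move: bd; set x : R := d%:R; rewrite /b => bd.
have E0 := expR_gt0 (ln 2 / delta).
have x2 : 2 < x by lra.
have x0 : 0 < x by lra.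
have x1 : 0 < x - 1 by lra.
have lx : 0 < ln x by apply: ln_gt0; lra.
have -> : ln (2 * x) = ln 2 + ln x by rewrite lnM ?posrE.
rewrite (_ : 3 / 2 = 1 + 2^-1); last lra.
rewrite powRD ?gt_eqF ?implybT// powRr1 ?(ltW x1)// powR12_sqrt ?(ltW x1)//.
have s1 : 0 < Num.sqrt (x - 1) by rewrite sqrtr_gt0.
have -> : x * (ln 2 + ln x) / ((x - 1) * Num.sqrt (x - 1)) * Num.sqrt x / ln x =
    (x / (x - 1)) * (Num.sqrt x / Num.sqrt (x - 1)) * (1 + ln 2 / ln x).
  by field; rewrite !gt_eqF.
have w1 : x / (x - 1) <= 1 + delta.
  rewrite ler_pdivrMr// mulrDl mul1r.
  have : delta * delta^-1 <= delta * (x - 1) by rewrite ler_pM2l//; lra.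
  rewrite divff ?gt_eqF//; lra.
have w2 : Num.sqrt x / Num.sqrt (x - 1) <= 1 + delta.
  rewrite ler_pdivrMr//; apply: le_of_sqr.
    by rewrite mulr_ge0 ?sqrtr_ge0//; lra.
  rewrite exprMn !sqr_sqrtr ?(ltW x0) ?(ltW x1)//.
  move: w1; rewrite ler_pdivrMr// => w1.
  have : 1 + delta <= (1 + delta) ^+ 2 by rewrite expr2; nra.
  move=> /(ler_wpM2r (ltW x1)); lra.
have w3 : ln 2 / ln x <= delta.
  rewrite ler_pdivrMr// mulrC -ler_pdivrMr//.
  rewrite -ler_expR lnK ?posrE//; lra.
apply: (@le_trans _ _ ((1 + delta) * (1 + delta) * (1 + delta))); last first.
  have q1 : delta * delta <= delta by rewrite ler_piMr// ltW.
  have := ler_wpM2r (ltW d0) q1; lra.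
have ln2 : 0 <= ln 2 / ln x by apply: divr_ge0 (ltW lx); rewrite ln_ge0// ler1n.
have q1 : 0 <= x / (x - 1) by exact: divr_ge0 (ltW x0) (ltW x1).
have q2 : 0 <= Num.sqrt x / Num.sqrt (x - 1) by rewrite divr_ge0// sqrtr_ge0.
by apply: ler_pM; [rewrite mulr_ge0|lra|exact: ler_pM|lra].
Qed.

Theorem propositionB1 (R : realType) :
  let c := largest_deviation_constant R in
  [/\ (forall d : nat, (1 <= d)%N ->
         deviation_constant d (c d) /\
         (forall c' : R, deviation_constant d c' -> c' <= c d)),
      (forall d : nat, (2 <= d)%N ->
         c d <= d%:R * ln (2 * d%:R) / (d%:R - 1) `^ (3 / 2)) &
      (limn_esup (fun d : nat => (c d * Num.sqrt d%:R / ln d%:R)%:E)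
         <= 1%E)%E].
Proof.
move=> c.
have cP d : (1 <= d)%N -> deviation_constant d (c d) /\
    (forall c' : R, deviation_constant d c' -> c' <= c d).
  by move=> d1; have [b] := @deviation_constant_bounded R d d1; exact: largest_deviation_constantP.
have c_le d : (2 <= d)%N -> c d <= d%:R * ln (2 * d%:R) / (d%:R - 1) `^ (3 / 2).
  by move=> d2; apply: deviation_constant_le_sphere => //; exact: (cP d (ltnW d2)).1.
split => //.
apply/lee_addgt0Pr => e e0; have [N HN] := sphere_bound_rate e0.
rewrite /limn_esup limf_esupE.
apply: (@le_trans _ _ (ereal_sup
  ((fun d : nat => (c d * Num.sqrt d%:R / ln d%:R)%:E) @` [set d | (maxn N 2 <= d)%N]))).
  apply: ereal_inf_lbound; exists [set d | (maxn N 2 <= d)%N] => //.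
  exact: nbhs_infty_ge.
apply: ge_ereal_sup => _ [d /= + <-]; rewrite geq_max => /andP[Nd d2].
rewrite -EFinD lee_fin; apply: le_trans (HN d Nd).
have lnd : 0 < ln d%:R :> R by rewrite ln_gt0// ltr1n.
by rewrite ler_pM2r ?invr_gt0// ler_wpM2r ?sqrtr_ge0// c_le.
Qed.
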